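(* Let $G$ be the Chevalley supergroup functor attached to $\mathfrak g$, $V$ (and an admissible lattice $M$ of $V$) over $k$. For any $A\in(\mathrm{salg})$, the group product yields bijections $$G_0(A)\times G_1^{-,<}(A)\times G_1^{+,<}(A)\ \longrightarrow\ G(A)$$ and all the similar bijections obtained by permuting the factors $G_1^{\pm,<}(A)$ and/or switching the factor $G_0(A)$ to the right.
   Context: $\mathbb K$ is an algebraically closed field of characteristic $0$. A finite dimensional non-Abelian Lie superalgebra $\mathfrak g=\mathfrak g_0\oplus\mathfrak g_1$ over $\mathbb K$ is classical if it has no nontrivial homogeneous ideals and $\mathfrak g_1$ is completely reducible as a $\mathfrak g_0$-module; by Kac these are the simple Lie algebras and $A(m,n),B(m,n),C(n),D(m,n),F(4),G(3),D(2,1;a),P(n),Q(n)$ (Kac's notation), where $P(n)=\big\{\begin{pmatrix}A&B\\C&-A^t\end{pmatrix}: A\in\mathfrak{sl}(n+1),\,B^t=B,\,C^t=-C\big\}$. Standing assumption: $\mathfrak g$ is classical, not of type $A(1,1)$, $P(3)$, $Q(n)$, nor $D(2,1;a)$ with $a\notin\mathbb Z$. Roots. $\mathfrak h$ is a fixed Cartan subalgebra of $\mathfrak g_0$; $\mathfrak g_\alpha=\{x\in\mathfrak g: [h,x]=\alpha(h)x\ \forall h\in\mathfrak h\}$; $\Delta_0=\{\alpha\ne0:\mathfrak g_\alpha\cap\mathfrak g_0\neq0\}$, $\Delta_1=\{\alpha:\mathfrak g_\alpha\cap\mathfrak g_1\ne0\}$, $\Delta=\Delta_0\cup\Delta_1$;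 $\ell=\dim\mathfrak h$. On $\mathfrak h$ and $\mathfrak h^*$ one has a nondegenerate symmetric form $(\ ,\ )$: the restriction of an even nondegenerate invariant form on $\mathfrak g$ if $\mathfrak g$ is not of type $P(n)$, and the one coming from $\mathfrak g_0\cong\mathfrak{sl}(n+1)$ for $P(n)$. Fix a distinguished simple root system $\Pi$ (all its elements even except one, if $\mathfrak g_1\neq0$; every root is a sum of elements of $\Pi$, ''positive'', or the opposite of such a sum, ''negative''); $\Delta^\pm$ are the positive/negative roots, $\Delta_i^\pm=\Delta^\pm\cap\Delta_i$. Coroots. If $\mathfrak g$ is not of type $P(n)$, $H_\alpha\in\mathfrak h$ is proportional to the element dual to $\alpha$ under the form, normalized by $\alpha(H_\alpha)=2$ if $(\alpha,\alpha)\ne0$, and, if $(\alpha,\alpha)=0$, so that the numbers $\beta(H_\alpha)$ $(\beta\in\Delta)$ generate $\mathbb Z$ (unique up to an immaterial sign, with $H_{-\alpha}=-H_\alpha$). For $P(n)$, with $\varepsilon_i$ the diagonal coordinates, the even roots are $\alpha_{i,j}=\varepsilon_i-\varepsilon_j$ with usual coroots, the odd ones are $\pm\beta_{i,j}$, $\beta_{i,j}=\beta_{j,i}=\varepsilon_i+\varepsilon_j$ $(i<j)$, and $\gamma_i=2\varepsilon_i$; the positive odd roots are the $\beta_{i,j}$ and $\gamma_i$; $H_{\pm\beta_{i,j}}:=\pm H_{\alpha_{i,j}}$ $(i<j)$; sums and strings of roots of $P(n)$ are computed formally in the free $\mathbb Z$-module on $\varepsilon_1,\dots,\varepsilon_{n+1}$.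 The $\alpha$-string through $\beta$ is $\{\beta-r\alpha,\dots,\beta+q\alpha\}$ with $r,q\geq0$ largest such that $\beta+j\alpha\in\Delta\cup\{0\}$ for $-r\le j\le q$. A Chevalley basis of $\mathfrak g$ is a homogeneous $\mathbb K$-basis $\{H_1,\dots,H_\ell\}\sqcup\{X_\alpha\}_{\alpha\in\Delta}$ such that: (a) $\{H_i\}$ is a $\mathbb K$-basis of $\mathfrak h$, and $\mathfrak h_{\mathbb Z}:=\mathrm{Span}_{\mathbb Z}(H_1,\dots,H_\ell)=\mathrm{Span}_{\mathbb Z}\{H_\alpha:\alpha\in\Delta\cap(-\Delta)\}$; (b) $[H_i,H_j]=0$, $[H_i,X_\alpha]=\alpha(H_i)X_\alpha$; (c) $[X_\alpha,X_{-\alpha}]=\sigma_\alpha H_\alpha$ for $\alpha\in\Delta\cap(-\Delta)$, with $\sigma_\alpha=-1$ if $\alpha\in\Delta_1^-$ and $\sigma_\alpha=1$ otherwise; (d) $[X_\alpha,X_\beta]=c_{\alpha,\beta}X_{\alpha+\beta}$ for $\alpha\ne-\beta$, where: if $\alpha+\beta\notin\Delta$, then $c_{\alpha,\beta}=0$, $X_{\alpha+\beta}:=0$; if $\alpha+\beta\in\Delta$ and $(\alpha,\alpha)\ne0$ or $(\beta,\beta)\neq0$, then $c_{\alpha,\beta}=\pm(r+1)$ with $r$ from the $\alpha$-string through $\beta$, except that $c_{\alpha,\beta}=\pm(r+2)$ if $\mathfrak g=P(n)$, $\alpha=\beta_{j,i}$, $\beta=\alpha_{i,j}$; if $\alpha+\beta\in\Delta$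 and $(\alpha,\alpha)=0=(\beta,\beta)$, then $c_{\alpha,\beta}=\pm\beta(H_\alpha)$. Fix a Chevalley basis. $K_{\mathbb Z}(\mathfrak g)$ is the unital $\mathbb Z$-subsuperalgebra of $U(\mathfrak g)$ generated by all $X_\alpha^{(n)}:=X_\alpha^n/n!$ $(\alpha\in\Delta_0)$, $X_\gamma$ $(\gamma\in\Delta_1)$, $\binom{H_i}{n}$, $n\in\mathbb N$. Module. $V$ is a faithful finite dimensional rational $\mathfrak g$-module, i.e. $V=\bigoplus_\mu V_\mu$ (weight spaces for $\mathfrak h$) and $\mu(H_i)\in\mathbb Z$ for all $i$ and all weights $\mu$ of $V$; $M$ is an admissible lattice of $V$, i.e. a $K_{\mathbb Z}(\mathfrak g)$-stable $\mathbb Z$-span of a $\mathbb K$-basis of $V$. Supergroups. $k$ is a commutative unital ring in which $2$ and $3$ are nonzero and not zero divisors; all $k$-modules are assumed without $2$- and $3$-torsion. $(\mathrm{salg})$ is the category of commutative $k$-superalgebras $A=A_0\oplus A_1$ ($xy=(-1)^{p(x)p(y)}yx$ on homogeneous elements) with parity preserving unital morphisms. Put $V_k=k\otimes_{\mathbb Z}M$, $V_k(A)=A\otimes_kV_k$, and let $\mathrm{GL}(V_k(A))$ be its group of parity preserving $A$-linear automorphisms. In it define: $x_\alpha(t)=\exp(tX_\alpha)=\sum_nt^nX_\alpha^{(n)}$ for $\alpha\in\Delta_0$, $t\in A_0$; $x_\gamma(\vartheta)=1+\vartheta X_\gamma$ for $\gamma\in\Delta_1$, $\vartheta\in A_1$;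 if $\gamma\in\Delta_1$ and $2\gamma\in\Delta$, also $x_\gamma(t,\vartheta)=(1+\vartheta X_\gamma)\exp(tX_\gamma^2)$ (where $X_\gamma^2=\frac12[X_\gamma,X_\gamma]=\pm2X_{2\gamma}$); $h_i(t)$ for $t\in U(A_0)$ (units), acting on $V_\mu$-components as $t^{\mu(H_i)}$. Let $x_\delta(A)$, $h_i(A)$ be the sets of all such elements (for $2\gamma\in\Delta$, $x_\gamma(A)$ is the set of all $x_\gamma(t,\vartheta)$). Put $G_0(A)=\langle h_i(A),x_\alpha(A): 1\le i\le\ell,\alpha\in\Delta_0\rangle$ and $G(A)=\langle G_0(A),x_\beta(A):\beta\in\Delta_1\rangle$; $G$ is the Chevalley supergroup functor. For fixed total orders on $\Delta_1^+$ and $\Delta_1^-$, with $N_\pm=|\Delta_1^\pm|$ and $\gamma_1\prec\cdots\prec\gamma_{N_\pm}$ the elements of $\Delta_1^\pm$, put $G_1^{\pm,<}(A)=\{\prod_{i=1}^{N_\pm}x_{\gamma_i}(\vartheta_i):\vartheta_1,\dots,\vartheta_{N_\pm}\in A_1\}$ (product in the given order). *)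

(* Defs.v *)
From mathcomp Require Import all_boot all_order all_algebra.

Set Implicit Arguments.
Unset Strict Implicit.
Unset Printing Implicit Defensive.

Import Order.TTheory GRing.Theory Num.Theory.
Local Open Scope ring_scope.

(* Parities are booleans: [false] is even, [true] is odd. *)

Record lieSuperalg (K : fieldType) := LieSuperalg {
  ls_sort :> vectType K;
  part : bool -> {vspace ls_sort};
  br : ls_sort -> ls_sort -> ls_sort;
  br_linl : forall y, linear (br^~ y);
  br_linr : forall x, linear (br x);
  part_sum : (part false + part true = fullv)%VS;
  part_cap : (part false :&: part true = 0)%VS;
  br_part : forall i j x y, x \in part i -> y \in part j ->
    br x y \in part (i (+) j);
  br_anti : forall i j x y, x \in part i -> y \in part j ->
    br x y = - ((-1) ^+ (i && j) *: br y x);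
  br_jacobi : forall i j x y z, x \in part i -> y \in part j ->
    br x (br y z) = br (br x y) z + (-1) ^+ (i && j) *: br y (br x z)
}.

Section Classical.
Variables (K : fieldType) (g : lieSuperalg K).

Definition homogeneous (I : {vspace g}) : Prop :=
  I = ((I :&: part g false) + (I :&: part g true))%VS.

Definition ideal (I : {vspace g}) : Prop :=
  forall x y, y \in I -> br x y \in I.

Definition even_stable (W : {vspace g}) : Prop :=
  forall x w, x \in part g false -> w \in W -> br x w \in W.

Definition classical : Prop :=
  [/\ exists x y : g, br x y != 0,
      forall I : {vspace g}, homogeneous I -> ideal I ->
        I = 0%VS \/ I = fullv
    & forall W : {vspace g}, (W <= part g true)%VS -> even_stable W ->
        exists U : {vspace g},
          [/\ even_stable U, (W + U)%VS = part g true & (W :&: U)%VS = 0%VS]].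

Definition nilpotent_sub (h : {vspace g}) : Prop :=
  exists n, forall (s : seq g) (y : g), size s = n ->
    {subset s <= h} -> y \in h -> foldr (@br K g) y s = 0.

Definition cartan (h : {vspace g}) : Prop :=
  [/\ (h <= part g false)%VS,
      forall x y, x \in h -> y \in h -> br x y \in h,
      nilpotent_sub h
    & forall x, x \in part g false -> (forall y, y \in h -> br x y \in h) ->
        x \in h].

End Classical.

Section Types.
Variables (K : fieldType) (g : lieSuperalg K).

Definition mx_homog p q (i : bool) (M : 'M[K]_(p + q)) : Prop :=
  if i then ulsubmx M = 0 /\ drsubmx M = 0
  else ursubmx M = 0 /\ dlsubmx M = 0.

Definition mx_sbr p q (i j : bool) (M N : 'M[K]_(p + q)) : 'M[K]_(p + q) :=
  M *m N - (-1) ^+ (i && j) *: (N *m M).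

(* [f] induces an isomorphism from S modulo the scalar matrices of S, where
   S is a subalgebra of gl(p|q), onto [g]. *)
Definition mx_quotient p q (S : 'M[K]_(p + q) -> Prop)
    (f : 'Hom('M[K]_(p + q), g)) : Prop :=
  [/\ forall x : g, exists2 M, S M & f M = x,
      forall M, S M -> (f M = 0 <-> is_scalar_mx M),
      forall i M, S M -> mx_homog i M -> f M \in part g i
    & forall i j M N, S M -> S N -> mx_homog i M -> mx_homog j N ->
        f (mx_sbr i j M N) = br (f M) (f N)].

(* A(1,1) = psl(2|2) *)
Definition A11_mx (M : 'M[K]_(2 + 2)) : Prop :=
  \tr (ulsubmx M) = \tr (drsubmx M).

Definition type_A11 : Prop := exists f, mx_quotient A11_mx f.

Definition Q_mx n (M : 'M[K]_(n.+1 + n.+1)) : Prop :=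
  exists A B : 'M[K]_n.+1, \tr B = 0 /\ M = block_mx A B B A.

Definition type_Q (n : nat) : Prop :=
  (2 <= n)%N /\ exists f, mx_quotient (@Q_mx n) f.

Definition P_mx n (M : 'M[K]_(n.+1 + n.+1)) : Prop :=
  exists A B C : 'M[K]_n.+1,
    [/\ \tr A = 0, B^T = B, C^T = - C & M = block_mx A B C (- A^T)].

Definition P_iso n (f : 'Hom(g, 'M[K]_(n.+1 + n.+1))) : Prop :=
  [/\ lker f = 0%VS,
      forall M, (exists x, f x = M) <-> P_mx M,
      forall i x, x \in part g i -> mx_homog i (f x)
    & forall i j x y, x \in part g i -> y \in part g j ->
        f (br x y) = mx_sbr i j (f x) (f y)].

Definition type_P (n : nat) : Prop :=
  (2 <= n)%N /\ exists f : 'Hom(g, 'M[K]_(n.+1 + n.+1)), P_iso f.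

(* D(2,1;a): g_0 = sl_2^3 (the images of the three maps phi i), g_1 is the
   tensor product of three copies of K^2 (psi being the universal trilinear
   map), with bracket g_1 x g_1 -> g_0
     [u, v] = sum_i s_i (prod_(j != i) omega(u_j, v_j)) p(u_i, v_i)
   where omega is the symplectic form on K^2 and
     p(u, v) w = omega(v, w) u + omega(u, w) v.
   The Jacobi identity amounts to s_0 + s_1 + s_2 = 0; in Kac's
   parametrization by the Cartan matrix (0 1 a; -1 2 0; -1 0 2) the s_i are
   proportional to the square lengths of the three positive even roots,
   namely to 1 + a, -1, -a. *)
Definition omega (u v : 'cV[K]_2) : K := u 0 0 * v 1 0 - u 1 0 * v 0 0.

Definition symp : 'M[K]_2 := delta_mx 0 1 - delta_mx 1 0.

Definition pmap (u v : 'cV[K]_2) : 'M[K]_2 :=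
  u *m v^T *m symp + v *m u^T *m symp.

Definition upd (u : {ffun 'I_3 -> 'cV[K]_2}) (i : 'I_3) (w : 'cV[K]_2) :
    {ffun 'I_3 -> 'cV[K]_2} :=
  [ffun j => if j == i then w else u j].

Definition D21_iso (s : 'I_3 -> K) (phi : 'I_3 -> 'Hom('M[K]_2, g))
    (psi : {ffun 'I_3 -> 'cV[K]_2} -> g) : Prop :=
  [/\ [/\ forall i x, \tr x = 0 -> phi i x \in part g false,
          forall x, x \in part g false -> exists y : 'I_3 -> 'M[K]_2,
            (forall i, \tr (y i) = 0) /\ x = \sum_i phi i (y i)
        & \dim (part g false) = 9%N],
      [/\ forall u, psi u \in part g true,
          forall u i, linear (fun w => psi (upd u i w)),
          forall x, x \in part g true -> exists us : seq _,
            x = \sum_(u <- us) psi u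
        & \dim (part g true) = 8%N],
      forall i j (x y : 'M[K]_2), \tr x = 0 -> \tr y = 0 ->
        br (phi i x) (phi j y) =
          if i == j then phi i (x *m y - y *m x) else 0,
      forall i (x : 'M[K]_2) u, \tr x = 0 ->
        br (phi i x) (psi u) = psi (upd u i (x *m u i))
    & forall u v, br (psi u) (psi v) =
        \sum_i (s i * \prod_(j | j != i) omega (u j) (v j))
          *: phi i (pmap (u i) (v i))].

Definition type_D21 (a : K) : Prop :=
  [/\ a != 0, a != -1
    & exists phi psi, D21_iso (fun i => [:: 1 + a; -1; - a]`_i) phi psi].

(* One isomorphism class D(2,1;a) contains several values of the parameter
   (a, 1/a, -1-a and so on); it is excluded when none of them is an integer. *)
Definition allowed_type : Prop :=
  [/\ ~ type_A11, ~ type_P 3, forall n, ~ type_Q n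
    & (exists a, type_D21 a) -> exists z : int, type_D21 z%:~R].

End Types.

Section Roots.
Variables (K : fieldType) (g : lieSuperalg K).

Definition inv_form (B : g -> g -> K) : Prop :=
  [/\ (forall y, scalar (B^~ y)) /\ (forall x, scalar (B x)),
      forall x y, x \in part g false -> y \in part g true -> B x y = 0,
      forall i j x y, x \in part g i -> y \in part g j ->
        B x y = (-1) ^+ (i && j) * B y x,
      forall x y z, B (br x y) z = B x (br y z)
    & forall x, (forall y, B x y = 0) -> x = 0].

(* Weights of h are elements of [hdual h]; [ev] is only meaningful on h. *)
Definition hdual (h : {vspace g}) := 'Hom(subvs_of h, K^o).
Definition ev (h : {vspace g}) (mu : hdual h) (x : g) : K := mu (vsproj h x).

(* The extra structure used to handle roots: an invariant form when g is not
   of type P(n), a realization by matrices when it is. *)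
Variant root_kind : Type :=
| NotP of g -> g -> K
| TypeP n of 'Hom(g, 'M[K]_(n.+1 + n.+1)).

Definition kind_ok (h : {vspace g}) (kd : root_kind) : Prop :=
  match kd with
  | NotP B => (forall n, ~ type_P g n) /\ inv_form B
  | TypeP n f =>
      [/\ (2 <= n)%N, P_iso f & forall x, (x \in h) = is_diag_mx (f x)]
  end.

Variable h : {vspace g}.

(* The group where roots live: the dual of h, except that for P(n) it is the
   free Z-module on eps_1, ..., eps_{n+1}. *)
Definition lat (kd : root_kind) : zmodType :=
  match kd with
  | NotP _ => hdual h
  | TypeP n _ => 'rV[int]_n.+1
  end.

Definition wt (kd : root_kind) : lat kd -> g -> K :=
  match kd return lat kd -> g -> K with
  | NotP _ => @ev h
  | TypeP n f => fun a x =>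
      \sum_i (a 0 i)%:~R * f x (lshift n.+1 i) (lshift n.+1 i)
  end.

Definition form (kd : root_kind) (x y : g) : K :=
  match kd with
  | NotP B => B x y
  | TypeP n f => \tr (ulsubmx (f x) *m ulsubmx (f y))
  end.

Definition root_vec (kd : root_kind) (a : lat kd) (x : g) : Prop :=
  forall y, y \in h -> br y x = wt a y *: x.

Definition eps n (i : 'I_n) : 'rV[int]_n := delta_mx 0 i.

Definition is_root (kd : root_kind) (i : bool) : lat kd -> Prop :=
  match kd return lat kd -> Prop with
  | NotP B => fun a => (i || (a != 0)) /\
      exists x, [/\ x != 0, x \in part g i & root_vec (kd := NotP B) a x]
  | TypeP n f => fun a : 'rV[int]_n.+1 =>
      if i then
        (exists j l : 'I_n.+1, (j < l)%N /\
           (a = eps j + eps l \/ a = - (eps j + eps l))) \/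
        (exists j, a = eps j *+ 2)
      else exists j l, j != l /\ a = eps j - eps l
  end.

(* (a, a) = 0, with the form transported to the dual of h *)
Definition isotropic (kd : root_kind) (a : lat kd) : Prop :=
  exists t, [/\ t \in h, forall x, x \in h -> form kd t x = wt a x
    & wt a t = 0].

(* The pairs (beta_{j,i}, alpha_{i,j}) of P(n) *)
Definition special_pair (kd : root_kind) : lat kd -> lat kd -> Prop :=
  match kd return lat kd -> lat kd -> Prop with
  | NotP _ => fun _ _ => False
  | TypeP n _ => fun a b : 'rV[int]_n.+1 =>
      exists i j, [/\ i != j, a = eps j + eps i & b = eps i - eps j]
  end.

(* [D] enumerates the roots. *)
Definition coroots_ok (kd : root_kind) : seq (lat kd) -> (lat kd -> g) -> Prop :=
  match kd return seq (lat kd) -> (lat kd -> g) -> Prop with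
  | NotP B => fun D H => forall a, a \in D ->
      [/\ H a \in h /\
            (exists c, forall x, x \in h -> B (H a) x = c * ev a x),
          ~ isotropic (kd := NotP B) a -> ev a (H a) = 2,
          isotropic (kd := NotP B) a -> forall x : K,
            inIntSpan (in_tuple [seq ev b (H a) | b <- D]) x <->
              exists z : int, x = z%:~R
        & H (- a) = - H a]
  | TypeP n f => fun D (H : 'rV[int]_n.+1 -> g) =>
      (forall i j, i != j ->
         let E : 'M[K]_n.+1 := delta_mx i i - delta_mx j j in
         f (H (eps i - eps j)) = block_mx E 0 0 (- E)) /\
      (forall i j : 'I_n.+1, (i < j)%N ->
         H (eps i + eps j) = H (eps i - eps j) /\
         H (- (eps i + eps j)) = - H (eps i - eps j))
  end.

End Roots.

(* A choice of Cartan subalgebra, roots, simple roots and Chevalley basis. *)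
Record chevData (K : fieldType) (g : lieSuperalg K) := ChevData {
  cd_h : {vspace g};
  cd_kind : root_kind g;
  (* the even and the odd roots *)
  cd_root : bool -> seq (lat cd_h cd_kind);
  cd_m : nat;
  (* simple roots, and the coordinates of the roots on them *)
  cd_simple : cd_m.-tuple (lat cd_h cd_kind);
  cd_coord : lat cd_h cd_kind -> 'I_cd_m -> int;
  cd_coroot : lat cd_h cd_kind -> g;
  cd_H : (\dim cd_h).-tuple g;
  cd_X : lat cd_h cd_kind -> g
}.

Arguments cd_coord {K g} c _ _.
Arguments cd_coroot {K g} c _.
Arguments cd_X {K g} c _.

Section Chevalley.
Variables (K : fieldType) (g : lieSuperalg K) (c : chevData g).

Local Notation h := (cd_h c).
Local Notation L := (lat (cd_h c) (cd_kind c)).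
Local Notation Hc := (cd_coroot c).
Local Notation H := (cd_H c).
Local Notation X := (cd_X c).

Implicit Types a b : L.

Definition roots : seq L := undup (cd_root c false ++ cd_root c true).

Definition roots_ok : Prop :=
  forall i, uniq (cd_root c i) /\
    (forall a, a \in cd_root c i <-> is_root i a).

Definition pos a : bool := [forall i, 0 <= cd_coord c a i].
Definition neg a : bool := [forall i, cd_coord c a i <= 0].

(* Every root is a sum of simple roots or the opposite of such a sum.  The sum
   is a formal one: for A(n,n) the simple roots are linearly dependent in the
   dual of h (and 0 is a nontrivial sum of them), hence the coordinates on the
   simple roots are required to come from a grading of g. *)
Definition simple_ok : Prop :=
  [/\ uniq (cd_simple c) /\ {subset cd_simple c <= roots},
      forall i j, cd_coord c (tnth (cd_simple c) i) j = (i == j)%:R,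
      forall a, a \in roots ->
        a = \sum_i tnth (cd_simple c) i *~ cd_coord c a i /\ (pos a || neg a),
      (forall i, cd_coord c 0 i = 0) /\
      (forall a b x y, a \in roots -> b \in roots -> root_vec a x ->
         root_vec b y -> br x y != 0 ->
         forall i, cd_coord c (a + b) i = cd_coord c a i + cd_coord c b i)
      (* all the simple roots are even, except one if g_1 <> 0 *)
    & if part g true == 0%VS then {subset cd_simple c <= cd_root c false}
      else exists2 p, (p \in cd_simple c) && (p \in cd_root c true)
        & forall q, q \in cd_simple c -> q != p -> q \in cd_root c false].

(* The largest r such that b - j a is a root or 0 for all j <= r *)
Definition string_bound a b (r : nat) : Prop :=
  let in_string j := (b - a *+ j == 0) || (b - a *+ j \in roots) in
  (forall j, (j <= r)%N -> in_string j) /\ ~~ in_string r.+1.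

Definition chev_sign a : K :=
  if (a \in cd_root c true) && neg a then -1 else 1.

Definition chev_const a b (z : K) : Prop :=
  if a + b \in roots then
    (~ isotropic a \/ ~ isotropic b -> exists r,
       string_bound a b r /\
       (special_pair a b -> z = (r + 2)%:R \/ z = - (r + 2)%:R) /\
       (~ special_pair a b -> z = (r + 1)%:R \/ z = - (r + 1)%:R)) /\
    (isotropic a /\ isotropic b -> z = wt b (Hc a) \/ z = - wt b (Hc a))
  else z = 0.

Definition chevalley_basis : Prop :=
  [/\ basis_of fullv (H ++ [seq X a | a <- roots]) /\
        (forall a, a \in roots -> exists i, X a \in part g i),
      basis_of h H /\
        (forall x, inIntSpan H x <->
           inIntSpan (in_tuple [seq Hc a | a <- roots & - a \in roots]) x),
      (forall i j, br (tnth H i) (tnth H j) = 0) /\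
        (forall i a, a \in roots ->
           br (tnth H i) (X a) = wt a (tnth H i) *: X a),
      forall a, a \in roots -> - a \in roots ->
        br (X a) (X (- a)) = chev_sign a *: Hc a
    & forall a b, a \in roots -> b \in roots -> a != - b ->
        exists2 z, chev_const a b z & br (X a) (X b) = z *: X (a + b)].

Definition chev_ok : Prop :=
  [/\ cartan h, kind_ok h (cd_kind c), roots_ok, simple_ok
    & coroots_ok roots Hc /\ chevalley_basis].

End Chevalley.

Arguments pos {K g} c a.
Arguments neg {K g} c a.

Section Modules.
Variables (K : fieldType) (g : lieSuperalg K).

Record lieSupermod := LieSupermod {
  lm_sort :> vectType K;
  mpart : bool -> {vspace lm_sort};
  rho : g -> 'End(lm_sort);
  mpart_sum : (mpart false + mpart true = fullv)%VS;
  mpart_cap : (mpart false :&: mpart true = 0)%VS;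
  rho_lin : linear rho;
  rho_part : forall i j x v, x \in part g i -> v \in mpart j ->
    rho x v \in mpart (i (+) j);
  rho_br : forall i j x y v, x \in part g i -> y \in part g j ->
    rho (br x y) v = rho x (rho y v) - (-1) ^+ (i && j) *: rho y (rho x v)
}.

Variables (c : chevData g) (V : lieSupermod).

Local Notation L := (lat (cd_h c) (cd_kind c)).
Local Notation X := (cd_X c).

Definition faithful : Prop := forall x, rho V x = 0 -> x = 0.

Definition in_weight (mu : hdual (cd_h c)) (v : V) : Prop :=
  forall x, x \in cd_h c -> rho V x v = ev mu x *: v.

Definition rational : Prop :=
  (forall v : V, exists ws : seq V,
     v = \sum_(w <- ws) w /\ (forall w, w \in ws -> exists mu, in_weight mu w))
  /\ (forall mu v, v != 0 -> in_weight mu v ->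
        forall i, exists z : int, ev mu (tnth (cd_H c) i) = z%:~R).

Definition power (u : 'End(V)) (n : nat) : 'End(V) :=
  iter n (comp_lfun u) \1%VF.

Definition div_power (u : 'End(V)) (n : nat) : 'End(V) :=
  (n`!%:R)^-1 *: power u n.

Definition div_binom (u : 'End(V)) (n : nat) : 'End(V) :=
  (n`!%:R)^-1 *: foldr (@comp_lfun K V V V) \1%VF
                   [seq u - j%:R *: \1%VF | j <- iota 0 n].

(* The action on V of the elements of the Kostant superring K_Z(g): the
   subring of End(V) generated by the images of its generators *)
Inductive kostant : 'End(V) -> Prop :=
| kostant_X a n of a \in cd_root c false :
    kostant (div_power (rho V (X a)) n)
| kostant_Xodd a of a \in cd_root c true : kostant (rho V (X a))
| kostant_H i n : kostant (div_binom (rho V (tnth (cd_H c) i)) n)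
| kostant_1 : kostant \1%VF
| kostant_B u v of kostant u & kostant v : kostant (u - v)
| kostant_M u v of kostant u & kostant v : kostant (u \o v)%VF.

(* The lattice is the Z-span of the basis [e]; it is a graded lattice, the
   vector e_i having parity [p i]. *)
Definition admissible d (e : d.-tuple V) (p : 'I_d -> bool) : Prop :=
  [/\ basis_of fullv e,
      forall i, tnth e i \in mpart V (p i)
    & forall u v, kostant u -> inIntSpan e v -> inIntSpan e (u v)].

End Modules.

(* The zero superalgebra is allowed.  Since its image is even, the structure
   morphism has central values. *)
Record comSuperalg (k : comPzRingType) := ComSuperalg {
  sa_sort :> pzRingType;
  sa_str : {rmorphism k -> sa_sort};
  sa_part : bool -> sa_sort -> Prop;
  sa_str_even : forall x, sa_part false (sa_str x);
  sa_part0 : forall i, sa_part i 0;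
  sa_partB : forall i x y, sa_part i x -> sa_part i y -> sa_part i (x - y);
  sa_partM : forall i j x y, sa_part i x -> sa_part j y ->
    sa_part (i (+) j) (x * y);
  sa_sum : forall x, exists y z, [/\ sa_part false y, sa_part true z & x = y + z];
  sa_cap : forall x, sa_part false x -> sa_part true x -> x = 0;
  sa_com : forall i j x y, sa_part i x -> sa_part j y ->
    x * y = (-1) ^+ (i && j) * (y * x)
}.

Definition torsionfree (M : zmodType) (n : nat) : Prop :=
  forall x : M, x *+ n = 0 -> x = 0.

(* V_k(A) is A (x)_k (k (x)_Z M) = A (x)_Z M, a free left A-module with basis
   the e_i: its elements are row vectors, and A-linear endomorphisms act by
   right multiplication by a matrix.  If t in A and an operator u of V
   preserving M have the same parity, the endomorphism
     t u : a (x) m |-> (-1)^(|a||u|) t a (x) u(m) = a t (x) u(m)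
   has matrix t *: N, where N is the integer matrix of u (whose i-th row lists
   the coordinates of u(e_i)). *)
Section Supergroup.
Variables (K : fieldType) (g : lieSuperalg K) (c : chevData g).
Variables (V : lieSupermod g) (d : nat) (e : d.-tuple V) (p : 'I_d -> bool).
Variables (k : comPzRingType) (A : comSuperalg k).

Local Notation L := (lat (cd_h c) (cd_kind c)).
Local Notation X := (cd_X c).

Definition int_mx (u : 'End(V)) (N : 'M[int]_d) : Prop :=
  forall i, u (tnth e i) = \sum_j tnth e j *~ N i j.

Definition amx m (N : 'M[int]_(m, d)) : 'M[A]_(m, d) := map_mx intr N.

(* Composition of endomorphisms acting on row vectors *)
Definition gmul (x y : 'M[A]_d) : 'M[A]_d := y *m x.

Definition in_GL (x : 'M[A]_d) : Prop :=
  (forall i j, sa_part (p i (+) p j) (x i j)) /\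
  (exists y, gmul x y = 1%:M /\ gmul y x = 1%:M).

Definition subgroup_GL (P : 'M[A]_d -> Prop) : Prop :=
  [/\ forall x, P x -> in_GL x,
      P 1%:M,
      forall x y, P x -> P y -> P (gmul x y)
    & forall x y, P x -> gmul x y = 1%:M -> gmul y x = 1%:M -> P y].

Definition generated (S : 'M[A]_d -> Prop) (x : 'M[A]_d) : Prop :=
  forall P, subgroup_GL P -> (forall y, S y -> P y) -> P x.

(* exp(t u), for u nilpotent (so that u^n = 0 for n >= d) with divided powers
   preserving the lattice *)
Definition is_exp (u : 'End(V)) (t : A) (x : 'M[A]_d) : Prop :=
  exists2 N : nat -> 'M[int]_d,
    forall n, int_mx (div_power u n) (N n)
  & x = \sum_(n < d.+1) t ^+ n *: amx (N n).

Definition is_one_plus (u : 'End(V)) (t : A) (x : 'M[A]_d) : Prop :=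
  exists2 N, int_mx u N & x = 1%:M + t *: amx N.

(* [x_even a] and [x_odd a] are x_a(A) for a an even root, an odd root *)
Definition x_even (a : L) (x : 'M[A]_d) : Prop :=
  exists2 t, sa_part false t & is_exp (rho V (X a)) t x.

Definition x_odd (a : L) (x : 'M[A]_d) : Prop :=
  if a *+ 2 \in roots c then
    exists t th y z,
      [/\ sa_part false t, sa_part true th, is_one_plus (rho V (X a)) th y,
          is_exp (rho V (X a) \o rho V (X a))%VF t z & x = gmul y z]
  else exists2 th, sa_part true th & is_one_plus (rho V (X a)) th x.

Definition zpow (t s : A) (z : int) : A :=
  match z with Posz n => t ^+ n | Negz n => s ^+ n.+1 end.

(* The elements h_i(t), with s the inverse of t *)
Definition h_set (i : 'I_(\dim (cd_h c))) (x : 'M[A]_d) : Prop :=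
  exists t s, [/\ sa_part false t, sa_part false s, t * s = 1, s * t = 1
    & forall (mu : hdual (cd_h c)) (z : int) (m : 'rV[int]_d),
        in_weight mu (\sum_j tnth e j *~ m 0 j) ->
        ev mu (tnth (cd_H c) i) = z%:~R ->
        amx m *m x = zpow t s z *: amx m].

Definition G0 : 'M[A]_d -> Prop :=
  generated (fun x => (exists i, h_set i x) \/
                      (exists2 a, a \in cd_root c false & x_even a x)).

Definition G : 'M[A]_d -> Prop :=
  generated (fun x => G0 x \/ (exists2 a, a \in cd_root c true & x_odd a x)).

(* The products of the x_gamma(theta_gamma), gamma running along [s] *)
Definition G1 (s : seq L) (x : 'M[A]_d) : Prop :=
  exists (N : L -> 'M[int]_d) (th : L -> A),
    [/\ forall a, a \in s -> int_mx (rho V (X a)) (N a),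
        forall a, a \in s -> sa_part true (th a)
      & x = foldr gmul 1%:M [seq 1%:M + th a *: amx (N a) | a <- s]].

Definition product_bijection (P Q R T : 'M[A]_d -> Prop) : Prop :=
  (forall x y z, P x -> Q y -> R z -> T (gmul (gmul x y) z)) /\
  (forall w, T w -> exists! t : 'M[A]_d * 'M[A]_d * 'M[A]_d,
     [/\ P t.1.1, Q t.1.2, R t.2 & w = gmul (gmul t.1.1 t.1.2) t.2]).

End Supergroup.

(* Main.v *)
Require Import Defs.
From mathcomp Require Import all_boot all_order all_algebra.
From mathcomp Require Import ring zify.

Set Implicit Arguments.
Unset Strict Implicit.
Unset Printing Implicit Defensive.

Import Order.TTheory GRing.Theory Num.Theory.
Local Open Scope ring_scope.

(* Existence.  Two odd letters [1 + u X_a], [1 + v X_b] commute up to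
   [1 + uv [X_a, X_b]], which lies in [G_0(A)].  Hence a word in odd letters can
   be sorted modulo [G_0(A)] on the left, the error terms having their
   parameters in higher and higher powers of the nilpotent ideal generated by
   the finitely many parameters of the word; conjugation by [G_0(A)] turns odd
   letters into products of odd letters.

   Uniqueness.  Elements of [G_0(A)] are block diagonal for the parity, the
   [X_a] with [a] odd are block antidiagonal.  If two products over [G_0(A)]
   coincide and their parameters differ by elements of the n-th power of the
   ideal, comparing antidiagonal blocks modulo the (n+1)-th power gives
   [sum_a (th'_a - th_a) X_a = 0] there, and the [X_a] are independent modulo
   every ideal of A provided that each [X_a] acts on M by a primitive integer
   matrix and that M is the direct sum of its weight lattices.

   Primitivity.  If [X_a] is divisible by m on M, so is [H_a]; then m divides all
   the integers [b(H_a)], and they generate Z when a is isotropic.  For the other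
   roots one uses sl_2 (a even) and osp(1|2) (a odd), and for P(n) brackets with
   structure constant 1 or -1 leading to an even root.  Primitivity also shows
   that the Z-span of the odd [X_a] contains every odd element of g preserving M,
   whence the stability under [G_0(A)] and the integrality of all the structure
   constants. *)

(** * Commutative superalgebras *)

(** Two obstacles shape the details. The basis [e] of M need not consist of weight vectors, so
    independence modulo ideals is not visible in single matrix entries; it is read off traces
    against integer matrices, which come from a Bezout relation and are cut down to one weight by
    the weight projections. These preserve M because the indicator function of a weight is an
    integral polynomial in the binomials of the H_i. Odd roots are separated in this way only if
    their restrictions to h determine them. For P(n), weights equal on h differ by a multiple of (1,
    ..., 1), whose coordinate sum is divisible by n + 1, while the coordinate sums of two odd roots
    differ by 0, 4 or -4: only P(3) fails. Without 2-torsion odd parameters have square zero, so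
    each occurs at most once in a product and the ideal that they generate is nilpotent.
    Endomorphisms act on rows from the right, so group products appear reversed in the matrix ring.
    Factorizations with G_0 on the other side follow by inversion. *)

Section Superalgebra.
Variables (k : comPzRingType) (A : comSuperalg k).
Local Notation part i x := (@sa_part k A i x).

Lemma sa_partN i (x : A) : part i x -> part i (- x).
Proof. by move=> hx; rewrite -sub0r; apply: sa_partB => //; apply: sa_part0. Qed.

Lemma sa_partD i (x y : A) : part i x -> part i y -> part i (x + y).
Proof. by move=> hx hy; rewrite -[y]opprK; apply: sa_partB => //; apply: sa_partN. Qed.

Lemma sa_part1 : part false (1 : A).
Proof. by rewrite -(rmorph1 (sa_str A)); apply: sa_str_even. Qed.

Lemma sa_part_sum i (I : Type) (r : seq I) (P : pred I) (F : I -> A) :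
  (forall j, P j -> part i (F j)) -> part i (\sum_(j <- r | P j) F j).
Proof.
move=> hF; elim/big_ind: _ => //; first exact: sa_part0.
by move=> x y; apply: sa_partD.
Qed.

Lemma sa_partMn i (x : A) n : part i x -> part i (x *+ n).
Proof.
move=> hx; elim: n => [|n IH]; first by rewrite mulr0n; apply: sa_part0.
by rewrite mulrS; apply: sa_partD.
Qed.

Lemma sa_partMz i (x : A) (z : int) : part i x -> part i (x *~ z).
Proof.
by move=> hx; case: z => n; [|apply: sa_partN]; apply: sa_partMn.
Qed.

Lemma sa_part_int (z : int) : part false (z%:~R : A).
Proof. by apply: sa_partMz; apply: sa_part1. Qed.

Lemma sa_partX (x : A) n : part false x -> part false (x ^+ n).
Proof.
move=> hx; elim: n => [|n IH]; first exact: sa_part1.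
by rewrite exprS; apply: (@sa_partM _ _ false false).
Qed.

Lemma even_central (x y : A) : part false x -> x * y = y * x.
Proof.
move=> hx; have [y0 [y1 [h0 h1 ->]]] := sa_sum y.
rewrite mulrDr mulrDl (sa_com hx h0) (sa_com hx h1) /= expr0 !mul1r.
by [].
Qed.

Lemma odd_anti (x y : A) : part true x -> part true y -> x * y = - (y * x).
Proof. by move=> hx hy; rewrite (sa_com hx hy) /= expr1 mulN1r. Qed.

Lemma odd_sq0 (x : A) : torsionfree A 2 -> part true x -> x * x = 0.
Proof.
move=> tf2 hx; apply: tf2; rewrite mulr2n.
by rewrite {2}(odd_anti hx hx) subrr.
Qed.

Lemma com_int (x : A) (z : int) : x * z%:~R = z%:~R * x.
Proof. by rewrite (even_central x (sa_part_int z)). Qed.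

(* The n-th power of the ideal generated by the odd elements listed in [Th],
   in a form that makes its vanishing for large n evident. *)
Fixpoint fil (Th : seq A) (n : nat) (u : A) : Prop :=
  if Th is th :: Th' then
    exists a b, [/\ fil Th' n a, fil Th' n.-1 b & u = a + b * th]
  else n = 0 \/ u = 0.

Lemma fil0 Th n : fil Th n 0.
Proof.
elim: Th n => [|t Th IH] n /=; first by right.
by exists 0, 0; rewrite mul0r addr0.
Qed.

Lemma filD Th n u v : fil Th n u -> fil Th n v -> fil Th n (u + v).
Proof.
elim: Th n u v => [|t Th IH] n u v /=.
  by move=> [->|->] [h|->]; rewrite ?addr0; [left|left|left|right].
move=> [a [b [ha hb ->]]] [a' [b' [ha' hb' ->]]].
exists (a + a'), (b + b'); split; [exact: IH|exact: IH|].
by rewrite mulrDl addrACA.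
Qed.

Lemma filN Th n u : fil Th n u -> fil Th n (- u).
Proof.
elim: Th n u => [|t Th IH] n u /=.
  by move=> [->|->]; rewrite ?oppr0; [left|right].
move=> [a [b [ha hb ->]]]; exists (- a), (- b); split; [exact: IH|exact: IH|].
by rewrite mulNr opprD.
Qed.

Lemma fil_all Th u : fil Th 0 u.
Proof.
elim: Th u => [|t Th IH] u /=; first by left.
by exists u, 0; rewrite mul0r addr0.
Qed.

Lemma filW Th m n u : (m <= n)%N -> fil Th n u -> fil Th m u.
Proof.
elim: Th m n u => [|t Th IH] m n u lemn /=.
  by case=> [n0|->]; [left; move: lemn; rewrite n0 leqn0 => /eqP|right].
move=> [a [b [ha hb ->]]]; exists a, b; split=> //; first exact: IH ha.
by apply: IH hb; rewrite -!subn1 leq_sub2r.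
Qed.

(** Moving the odd t past u applies the parity involution to u, and this preserves the filtration
    because its generators are homogeneous. *)
Lemma fil_swap Th n (t u : A) :
  (forall x, x \in Th -> part true x) -> part true t -> fil Th n u ->
  exists2 v, fil Th n v & t * u = v * t.
Proof.
move=> hTh ht; elim: Th hTh n u => [|x Th IH] hTh n u /=.
  case=> [n0|->]; last by exists 0; [right | rewrite mulr0 mul0r].
  have [u0 [u1 [h0 h1 ->]]] := sa_sum u.
  exists (u0 - u1); first by left.
  by rewrite mulrDr mulrBl -(even_central t h0) (odd_anti ht h1).
have hTh' : forall y, y \in Th -> part true y.
  by move=> y yTh; apply: hTh; rewrite inE yTh orbT.
move=> [a [b [ha hb ->]]].
have [a' ha' ea] := IH hTh' _ _ ha; have [b' hb' eb] := IH hTh' _ _ hb.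
exists (a' - b' * x).
  by exists a', (- b'); split=> //; [exact: filN | rewrite mulNr].
rewrite mulrDr mulrBl ea mulrA eb -mulrA (odd_anti ht (hTh _ (mem_head _ _))).
by rewrite mulrN mulrA.
Qed.

(** In the product of a + b t and c + e t the term containing t twice vanishes, since t has square
    zero; this is where the absence of 2-torsion enters. The two terms containing t once are put in
    normal form by [fil_swap]. *)
Lemma filM Th m n u v : torsionfree A 2 -> (forall x, x \in Th -> part true x) ->
  fil Th m u -> fil Th n v -> fil Th (m + n) (u * v).
Proof.
move=> tf2; elim: Th m n u v => [|t Th IH] m n u v hTh /=.
  by move=> [->|->] [->|->]; rewrite ?mulr0 ?mul0r; [left|right|right|right].
have hTh' : forall y, y \in Th -> part true y.
  by move=> y yTh; apply: hTh; rewrite inE yTh orbT.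
have ht := hTh t (mem_head _ _).
move=> [a [b [ha hb ->]]] [c [e [hc he ->]]].
have [c' hc' ec] := fil_swap hTh' ht hc.
have [e' he' ee] := fil_swap hTh' ht he.
exists (a * c), (a * e + b * c'); split; first exact: IH.
  apply: filD.
    apply: filW (IH _ _ _ _ hTh' ha he); case: n {hc he hc' he'} => [|n] /=.
      by rewrite addn0 leq_pred.
    by rewrite addnS.
  by apply: filW (IH _ _ _ _ hTh' hb hc'); case: m {ha hb} => //=; rewrite leq_pred.
rewrite mulrDr !mulrDl !mulrA -(mulrA b t c) ec -(mulrA b t e) ee.
rewrite -!mulrA (odd_sq0 tf2 ht) !mulr0 addr0 !mulrA -addrA; congr (_ + _).
by rewrite addrC.
Qed.

Lemma fil_big Th n u : (size Th < n)%N -> fil Th n u -> u = 0.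
Proof.
elim: Th n u => [|t Th IH] n u /=; first by move=> n0 [n0'|//]; rewrite n0' in n0.
case: n => // n; rewrite ltnS => ln [a [b [ha hb ->]]].
by rewrite (IH _ _ (ltnW _) ha) // (IH _ _ ln hb) mul0r addr0.
Qed.

Lemma fil_mem Th t : t \in Th -> fil Th 1 t.
Proof.
elim: Th => //= x Th IH; rewrite inE => /orP[/eqP->|tTh].
  by exists 0, 1; rewrite add0r mul1r; split=> //; [apply: fil0|apply: fil_all].
by exists t, 0; rewrite mul0r addr0; split; [exact: IH|apply: fil0|].
Qed.

Lemma fil_sum Th n (I : Type) (r : seq I) (P : pred I) (F : I -> A) :
  (forall j, P j -> fil Th n (F j)) -> fil Th n (\sum_(j <- r | P j) F j).
Proof.
by move=> hF; elim/big_ind: _ => //; [apply: fil0|move=> x y; apply: filD].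
Qed.

End Superalgebra.

(** * Sorting words in odd unipotent elements *)

(** P and Q annihilate the commutator from the left, so the right-hand side is just (1 + Q)(1 + P)
    plus the commutator. *)
Lemma one_plus_comm (E : pzRingType) (P Q : E) :
  P * P = 0 -> Q * Q = 0 -> P * Q * P = 0 -> Q * P * Q = 0 ->
  (1 + P) * (1 + Q) = (1 + Q) * (1 + P) * (1 + (P * Q - Q * P)).
Proof.
move=> PP QQ PQP QPQ.
have zP : P * (P * Q - Q * P) = 0 by rewrite mulrBr !mulrA PP PQP mul0r subrr.
have zQ : Q * (P * Q - Q * P) = 0 by rewrite mulrBr !mulrA QQ QPQ mul0r subrr.
set C := P * Q - Q * P in zP zQ *.
have -> : (1 + Q) * (1 + P) * (1 + C) = (1 + Q) * (1 + P) + C.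
  rewrite mulrDr mulr1; congr (_ + _).
  by rewrite -mulrA !mulrDl !mul1r zP addr0 zQ addr0.
rewrite !mulrDl !mulrDr !mulr1 !mul1r /C addrACA -!addrA; congr (_ + _).
do 2!congr (_ + _).
by rewrite addrC subrK.
Qed.

Section Scaled.
Variables (k : comPzRingType) (A : comSuperalg k) (d : nat).
Local Notation part i x := (@sa_part k A i x).

(** A pure tensor of A with the integer matrices. Integers are central in A, so products are taken
    factor by factor without signs. *)
Definition scaled_mx (u : A) (N : 'M[int]_d) : 'M[A]_d := u *: map_mx intr N.
Local Notation sc := scaled_mx.

Lemma scM u v N N' : sc u N * sc v N' = sc (u * v) (N * N').
Proof.
apply/matrixP => i j; rewrite !mxE rmorph_sum mulr_sumr; apply: eq_bigr => l _.
rewrite !mxE rmorphM /= !mulrA; congr (_ * _).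
by rewrite -!mulrA com_int.
Qed.

Lemma sc0l N : sc 0 N = 0. Proof. exact: scale0r. Qed.

Lemma scDl u v N : sc (u + v) N = sc u N + sc v N. Proof. exact: scalerDl. Qed.

Lemma scNl u N : sc (- u) N = - sc u N. Proof. exact: scaleNr. Qed.

Lemma scDr u N N' : sc u (N + N') = sc u N + sc u N'.
Proof. by rewrite /sc map_mxD scalerDr. Qed.

Lemma scNr u N : sc u (- N) = - sc u N.
Proof. by rewrite /sc map_mxN scalerN. Qed.

Lemma scBr u N N' : sc u (N - N') = sc u N - sc u N'.
Proof. by rewrite scDr scNr. Qed.

Lemma sc_sumr u (I : Type) (r : seq I) (P : pred I) (F : I -> 'M[int]_d) :
  sc u (\sum_(a <- r | P a) F a) = \sum_(a <- r | P a) sc u (F a).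
Proof.
elim/big_rec2: _ => [|a x y _ <-]; first by rewrite /sc map_mx0 scaler0.
by rewrite scDr.
Qed.

Lemma scZr u z N : sc u (z *: N) = sc (u * z%:~R) N.
Proof. by apply/matrixP => i j; rewrite !mxE intrM mulrA. Qed.

Lemma sc11 : sc 1 1%:M = 1.
Proof. by rewrite /sc scale1r; apply/matrixP => i j; rewrite !mxE rmorphMn. Qed.
End Scaled.

Section Sorting.
Variables (k : comPzRingType) (A : comSuperalg k) (tf2 : torsionfree A 2).
Variable d : nat.
Local Notation part i x := (@sa_part k A i x).
Local Notation sc := (@scaled_mx k A d).
Local Notation E := 'M[A]_d.
Variables (I : eqType) (s : seq I) (N : I -> 'M[int]_d).
Variables (ev : 'M[int]_d -> Prop) (G0 : E -> Prop).
Hypothesis s_uniq : uniq s.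
Hypothesis ev_br : forall Y Y', ev Y -> ev Y' -> ev (Y * Y' - Y' * Y).
Hypothesis ev_odd : forall Y a, ev Y -> a \in s -> exists z : I -> int,
  Y * N a - N a * Y = \sum_(b <- s) z b *: N b.
Hypothesis odd_odd : forall a b, a \in s -> b \in s -> ev (N a * N b + N b * N a).
Hypothesis odd_sq : forall a, a \in s -> ev (N a * N a).
Hypothesis G0_1 : G0 1.
Hypothesis G0_M : forall x y, G0 x -> G0 y -> G0 (x * y).
Hypothesis G0_ev : forall u Y, part false u -> u * u = 0 -> ev Y -> G0 (1 + sc u Y).

Variable Th : seq A.
Hypothesis Th_odd : forall t, t \in Th -> part true t.

(** Even letters have parameters of square zero, so that 1 + u Y involves no higher divided powers
    and lies in G_0. Commutators of letters only produce even letters of this kind. The index n is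
    the depth in the filtration. *)
Inductive letter (n : nat) : E -> Prop :=
| EvenLetter u Y of part false u & u * u = 0 & fil Th n u & ev Y :
    letter n (sc u Y)
| OddLetter u a of part true u & fil Th n u & a \in s : letter n (sc u (N a)).

Inductive word (n : nat) : E -> Prop :=
| word1 : word n 1
| word_cons P w of letter n P & word n w : word n ((1 + P) * w).

Lemma word_mul n x y : word n x -> word n y -> word n (x * y).
Proof.
elim=> [|P w hP hw IH] hy; first by rewrite mul1r.
by rewrite -mulrA; apply: word_cons => //; apply: IH.
Qed.

Lemma word_letter n P : letter n P -> word n (1 + P).
Proof. by move=> hP; rewrite -[1 + P]mulr1; apply: word_cons => //; apply: word1. Qed.

Lemma letterW m n P : (m <= n)%N -> letter n P -> letter m P.
Proof.
move=> lemn [u Y hu uu hf hY|u a hu hf ha].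
  by apply: EvenLetter => //; apply: filW hf.
by apply: OddLetter => //; apply: filW hf.
Qed.

Lemma wordW m n w : (m <= n)%N -> word n w -> word m w.
Proof.
move=> lemn; elim=> [|P x hP hx IH]; first exact: word1.
by apply: word_cons => //; apply: letterW hP.
Qed.

Lemma word_big n w : (size Th < n)%N -> word n w -> w = 1.
Proof.
move=> lt_n; elim=> // P x hP _ ->; rewrite mulr1.
by case: hP => [u Y _ _ hf _|u a _ hf _];
   rewrite (fil_big lt_n hf) sc0l addr0.
Qed.

(** All the terms carry the same odd factor u, so the cross terms vanish and the sum splits into a
    product of odd letters. *)
Lemma word_sum n u (z : I -> int) (s' : seq I) :
  part true u -> fil Th n u -> {subset s' <= s} ->
  word n (1 + \sum_(b <- s') sc (u * (z b)%:~R) (N b)).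
Proof.
move=> hu hf; elim: s' => [|b s' IH] ss; first by rewrite big_nil addr0; apply: word1.
have -> : 1 + \sum_(c <- b :: s') sc (u * (z c)%:~R) (N c) =
  (1 + sc (u * (z b)%:~R) (N b)) * (1 + \sum_(c <- s') sc (u * (z c)%:~R) (N c)).
  have z0 : sc (u * (z b)%:~R) (N b) * \sum_(c <- s') sc (u * (z c)%:~R) (N c) = 0.
    rewrite mulr_sumr big1 // => c _; rewrite scM.
    by rewrite com_int -mulrA (mulrA u u) odd_sq0 // mul0r mulr0 sc0l.
  rewrite big_cons mulrDl mul1r mulrDr mulr1 z0 addr0.
  by rewrite -addrA; congr (_ + _); rewrite addrC.
apply: word_cons; last by apply: IH => c cs'; apply: ss; rewrite inE cs' orbT.
apply: OddLetter; last by apply: ss; rewrite mem_head.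
  by rewrite mulrzr; apply: sa_partMz.
by rewrite -[n]addn0; apply: filM => //; apply: fil_all.
Qed.

Lemma mul_uvu i j (u v : A) : part i u -> part j v -> u * u = 0 -> u * v * u = 0.
Proof.
move=> hu hv uu; rewrite (sa_com hu hv) -!mulrA uu mulr0.
by rewrite mulr0.
Qed.

(** Exchanging two odd parameters costs a sign, which turns the commutator of two odd letters into
    uv times the anticommutator of the matrices, an even letter. An even and an odd letter give a
    sum of odd letters with parameter uv up to sign, handled by [word_sum]. *)
Lemma letter_comm m n P Q : letter m P -> letter n Q ->
  exists2 r, word (m + n) r & (1 + P) * (1 + Q) = (1 + Q) * (1 + P) * r.
Proof.
move=> hP hQ.
exists (1 + (P * Q - Q * P)); last first.
  have form p R : letter p R -> exists i u Y, [/\ part i u, u * u = 0 & R = sc u Y].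
    case=> [u Y hu uu _ _|u a hu _ _]; first by exists false, u, Y.
    by exists true, u, (N a); split=> //; apply: odd_sq0.
  have [i [u [Y [hu uu ->]]]] := form _ _ hP.
  have [j [v [Y' [hv vv ->]]]] := form _ _ hQ.
  apply: one_plus_comm; rewrite !scM.
  - by rewrite uu sc0l.
  - by rewrite vv sc0l.
  - by rewrite (mul_uvu hu hv uu) sc0l.
  - by rewrite (mul_uvu hv hu vv) sc0l.
case: hP => [u Y hu uu fu hY|u a hu fu ha]; case: hQ => [v Y' hv vv fv hY'|v b hv fv hb].
- rewrite !scM -(even_central v hu) -scBr; apply: word_letter; apply: EvenLetter.
  + exact: (@sa_partM _ _ false false).
  + by rewrite mulrA (mul_uvu hu hv uu) mul0r.
  + exact: filM.
  + exact: ev_br.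
- rewrite !scM -(even_central v hu) -scBr.
  have [z ->] := ev_odd hY hb; rewrite sc_sumr.
  under eq_bigr do rewrite scZr.
  apply: word_sum => //; last exact: filM.
  exact: (@sa_partM _ _ false true).
- rewrite !scM (even_central u hv) -scBr.
  have [z e] := ev_odd hY' ha; rewrite -opprB e scNr -scNl sc_sumr.
  under eq_bigr do rewrite scZr.
  apply: word_sum => //.
    by apply: sa_partN; apply: (@sa_partM _ _ true false).
  by apply: filN; apply: filM.
- rewrite !scM (odd_anti hv hu) scNl opprK -scDr; apply: word_letter; apply: EvenLetter.
  + exact: (@sa_partM _ _ true true).
  + by rewrite mulrA (mul_uvu hu hv) ?mul0r // odd_sq0.
  + exact: filM.
  + exact: odd_odd.
Qed.

Lemma word_comm j m n x y : (0 < m)%N -> (0 < n)%N ->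
  ((size Th).*2.+2 <= m + n + j)%N -> word m x -> word n y ->
  exists2 r, word (m + n) r & x * y = y * x * r.
Proof.
elim: j m n x y => [|j IH] m n x y m0 n0 le hx hy.
  exists 1; first exact: word1.
  have [lt_m|le_m] := ltnP (size Th) m.
    by rewrite (word_big lt_m hx) mul1r !mulr1.
  have lt_n : (size Th < n)%N.
    rewrite ltnNge; apply/negP => le_n; move: le; rewrite addn0 leqNgt.
    by rewrite -addnn ltnS ltnW // ltnS leq_add.
  by rewrite (word_big lt_n hy) mul1r !mulr1.
have single b : letter n b -> exists2 r, word (m + n) r & x * (1 + b) = (1 + b) * x * r.
  move=> hb; elim: hx => [|P w hP hw [r1 hr1 e1]].
    by exists 1; [exact: word1 | rewrite mul1r !mulr1].
  have [r0 hr0 e0] := letter_comm hP hb.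
  (* The pair of depths (m + n, m) replaces (m, n): the total grows by m, which is at least 1 and
     pays for one unit of j. *)
  have le' : ((size Th).*2.+2 <= m + n + m + j)%N.
    by apply: leq_trans le _; rewrite -(addnA (m + n)) leq_add2l -add1n leq_add2r.
  have mn0 : (0 < m + n)%N by rewrite addn_gt0 m0.
  have [r2 hr2 e2] := IH _ _ _ _ mn0 m0 le' hr0 hw.
  exists (r0 * r2 * r1).
    do !apply: word_mul => //; apply: wordW hr2; by rewrite leq_addr.
  rewrite -mulrA e1 !mulrA e0 -!mulrA; congr (_ * (_ * _)).
  by rewrite !mulrA e2.
elim: hy => [|P w hP hw [r1 hr1 e1]].
  by exists 1; [exact: word1 | rewrite mul1r !mulr1].
have [r0 hr0 e0] := single _ hP.
have le' : ((size Th).*2.+2 <= m + n + n + j)%N.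
  by apply: leq_trans le _; rewrite -(addnA (m + n)) leq_add2l -add1n leq_add2r.
have mn0 : (0 < m + n)%N by rewrite addn_gt0 m0.
have [r2 hr2 e2] := IH _ _ _ _ mn0 n0 le' hr0 hw.
exists (r1 * (r0 * r2)).
  apply: word_mul => //; apply: word_mul => //.
  by apply: wordW hr2; rewrite leq_addr.
rewrite mulrA e0 -(mulrA _ r0) e2 !mulrA; congr (_ * _ * _).
by rewrite -(mulrA (1 + P) x w) e1 !mulrA.
Qed.

Lemma word_commute m n x y : (0 < m)%N -> (0 < n)%N -> word m x -> word n y ->
  exists2 r, word (m + n) r & x * y = y * x * r.
Proof. by move=> m0 n0; apply: (word_comm (j := (size Th).*2.+2)); rewrite ?leq_addl. Qed.

Definition odd_prod (r : seq I) (th : I -> A) : E :=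
  \prod_(a <- r) (1 + sc (th a) (N a)).

Definition odd_params (th : I -> A) : Prop :=
  forall a, part true (th a) /\ fil Th 1 (th a).

Lemma word_odd_prod r th : {subset r <= s} -> odd_params th -> word 1 (odd_prod r th).
Proof.
rewrite /odd_prod => rs hth; elim: r rs => [|a r IH] rs; first by rewrite big_nil; apply: word1.
rewrite big_cons; apply: word_cons; last by apply: IH => b br; apply: rs; rewrite inE br orbT.
by have [h1 h2] := hth a; apply: OddLetter => //; apply: rs; rewrite mem_head.
Qed.

Lemma eq_odd_prod r th th' : {in r, th =1 th'} -> odd_prod r th = odd_prod r th'.
Proof.
rewrite /odd_prod => e; rewrite !big_seq; apply: eq_bigr => a ar; by rewrite e.
Qed.

(** The letter is moved left through the factors following that of [a] and merged with the latter.
    Since its own depth is n and all parameters have depth 1, every error has depth n + 1. *)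
Lemma odd_prod_letter n th u a : (0 < n)%N -> odd_params th -> part true u ->
  fil Th n u -> a \in s -> exists th' r, [/\ odd_params th', word n.+1 r &
    odd_prod s th * (1 + sc u (N a)) = odd_prod s th' * r].
Proof.
move=> n0 hth hu fu ha.
pose th' b := if b == a then th a + u else th b.
have hth' : odd_params th'.
  move=> b; rewrite /th'; case: eqP => // _; have [h1 h2] := hth a; split.
    exact: sa_partD.
  by apply: filD => //; apply: filW fu.
have [s1 [s2 es]] : exists s1 s2, s = s1 ++ a :: s2.
  by case/splitPr: ha => s1 s2; exists s1, s2.
have s2s : {subset s2 <= s} by move=> b b2; rewrite es mem_cat inE b2 !orbT.
have [na1 na2] : a \notin s1 /\ a \notin s2.
  move: s_uniq; rewrite es cat_uniq /= negb_or => /and3P[_ /andP[-> _] /andP[-> _]].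
  by [].
have hl : letter n (sc u (N a)) by apply: OddLetter.
have [r hr er] := word_commute (ltnSn 0) n0 (word_odd_prod s2s hth) (word_letter hl).
have [hta fta] := hth a.
have [Yw hYw] : exists2 w, word n.+1 w & 
   (1 + sc (th a) (N a)) * (1 + sc u (N a)) = (1 + sc (th' a) (N a)) * w.
  (* Merging two letters of the same root leaves the square of N a with the even parameter th a * u;
     the cubic term contains th a or u twice and vanishes. *)
  exists (1 + sc (th a * u) (N a * N a)).
    apply: word_letter; apply: EvenLetter; last exact: odd_sq.
    - exact: (@sa_partM _ _ true true).
    - by rewrite mulrA (mul_uvu hta hu) ?mul0r // odd_sq0.
    - by rewrite -add1n; apply: filM.
  rewrite /th' eqxx scDl !mulrDl !mul1r !mulrDr !mulr1 !scM.
  rewrite mulrA odd_sq0 // mul0r sc0l addr0.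
  rewrite mulrA (mul_uvu hu hta) ?odd_sq0 // sc0l addr0.
  rewrite -!addrA; congr (_ + _); rewrite addrCA [RHS]addrCA; congr (_ + _).
  by rewrite addrC.
move=> eYw.
have [r' hr' er'] := word_commute (ltn0Sn n) (ltnSn 0) hYw (word_odd_prod s2s hth).
exists th', (Yw * r' * r); split=> //.
  apply: word_mul; last by rewrite -add1n.
  by apply: word_mul => //; apply: wordW hr'; rewrite leq_addr.
have e1 : odd_prod s1 th = odd_prod s1 th'.
  by apply: eq_odd_prod => b b1; rewrite /th'; case: eqP b1 na1 => // -> ->.
have e2 : odd_prod s2 th = odd_prod s2 th'.
  by apply: eq_odd_prod => b b1; rewrite /th'; case: eqP b1 na2 => // -> ->.
rewrite /odd_prod es !big_cat !big_cons /= -!/(odd_prod _ _) -!mulrA er -e1 -e2.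
congr (_ * _); rewrite !mulrA eYw; congr (_ * _); rewrite -!mulrA; congr (_ * _).
by rewrite er' !mulrA.
Qed.

(** Two nested inductions: on the missing depth j, and on the word at a fixed depth. The error left
    by one letter is deeper and is sorted at once by the outer induction, before the next letter is
    absorbed. *)
Lemma sort_word j n r th : (0 < n)%N -> (size Th < n + j)%N -> word n r ->
  odd_params th -> exists g th', [/\ G0 g, odd_params th' &
    odd_prod s th * r = g * odd_prod s th'].
Proof.
elim: j n r th => [|j IH] n r th n0 lt_n hr hth.
  exists 1, th; split=> //.
  by rewrite (word_big _ hr) ?mulr1 ?mul1r //; rewrite addn0 in lt_n.
elim: hr th hth => {r} [|P w hP hw IHw] th hth.
  by exists 1, th; rewrite mulr1 mul1r.
have lt_n1 : (size Th < n.+1 + j)%N by rewrite addSnnS.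
have [g [th1 [r [hg hth1 hr e]]]] : exists g th1 r, [/\ G0 g, odd_params th1, word n.+1 r &
    odd_prod s th * (1 + P) = g * odd_prod s th1 * r].
  case: hP => [u Y hu uu fu hY|u a hu fu ha].
    have hl : letter n (sc u Y) by apply: EvenLetter.
    have ss : {subset s <= s} by [].
    have [r hr er] := word_commute (ltnSn 0) n0 (word_odd_prod ss hth) (word_letter hl).
    by exists (1 + sc u Y), th, r; split=> //; apply: G0_ev.
  have [th' [r [h1 h2 h3]]] := odd_prod_letter n0 hth hu fu ha.
  by exists 1, th', r; rewrite mul1r.
have [g2 [th2 [hg2 hth2 e2]]] := IH n.+1 r th1 isT lt_n1 hr hth1.
have [g3 [th3 [hg3 hth3 e3]]] := IHw th2 hth2.
exists (g * g2 * g3), th3; split=> //; first by do !apply: G0_M.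
by rewrite mulrA e -(mulrA g) e2 -!mulrA e3 !mulrA.
Qed.

End Sorting.

(** * Products of odd unipotents: inverses, uniqueness of the parameters, factorization *)

Section OddProducts.
Variables (k : comPzRingType) (A : comSuperalg k) (tf2 : torsionfree A 2).
Variable d : nat.
Local Notation part i x := (@sa_part k A i x).
Local Notation sc := (@scaled_mx k A d).
Local Notation E := 'M[A]_d.
Variables (I : eqType) (N : I -> 'M[int]_d).

Lemma sc_odd_sq0 u M M' : part true u -> sc u M * sc u M' = 0.
Proof. by move=> hu; rewrite scM odd_sq0 // sc0l. Qed.

Lemma odd_letter_inv u M : part true u -> (1 + sc u M) * (1 + sc (- u) M) = 1.
Proof.
move=> hu; rewrite scNl mulrBr mulr1 mulrDl mul1r.
by rewrite sc_odd_sq0 // addr0 -addrA subrr addr0.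
Qed.

Lemma odd_prodV r (th : I -> A) : (forall a, a \in r -> part true (th a)) ->
  odd_prod N r th * odd_prod N (rev r) (fun a => - th a) = 1.
Proof.
rewrite /odd_prod; elim: r => [|a r IH] hth; first by rewrite !big_nil mulr1.
rewrite rev_cons -cats1 big_cat big_seq1 big_cons -mulrA (mulrA (\prod_(_ <- r) _)).
rewrite IH ?mul1r; last by move=> b br; apply: hth; rewrite inE br orbT.
by rewrite odd_letter_inv //; apply: hth; rewrite mem_head.
Qed.

Lemma odd_prodVl r (th : I -> A) : (forall a, a \in r -> part true (th a)) ->
  odd_prod N (rev r) (fun a => - th a) * odd_prod N r th = 1.
Proof.
move=> hth; have := @odd_prodV (rev r) (fun a => - th a).
rewrite revK => <-; last by move=> a; rewrite mem_rev => /hth; apply: sa_partN.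
by congr (_ * _); apply: eq_odd_prod => a _; rewrite opprK.
Qed.

Section Filtered.
Variable Th : seq A.
Hypothesis Th_odd : forall t, t \in Th -> part true t.

Definition fil_mx n (M : E) : Prop := forall i j, fil Th n (M i j).

Lemma fil_mxD n M M' : fil_mx n M -> fil_mx n M' -> fil_mx n (M + M').
Proof. by move=> h h' i j; rewrite mxE; apply: filD. Qed.

Lemma fil_mxN n M : fil_mx n M -> fil_mx n (- M).
Proof. by move=> h i j; rewrite mxE; apply: filN. Qed.

Lemma fil_mxM m n M M' : fil_mx m M -> fil_mx n M' -> fil_mx (m + n) (M * M').
Proof. by move=> h h' i j; rewrite mxE; apply: fil_sum => l _; apply: filM. Qed.

Lemma fil_mxW m n M : (m <= n)%N -> fil_mx n M -> fil_mx m M.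
Proof. by move=> le h i j; apply: filW (h i j). Qed.

Lemma fil_mx_sc n u M : fil Th n u -> fil_mx n (sc u M).
Proof. by move=> h i j; rewrite !mxE -[n]addn0; apply: filM => //; apply: fil_all. Qed.

Lemma fil_mx_sum n (r : seq I) (F : I -> E) :
  (forall a, a \in r -> fil_mx n (F a)) -> fil_mx n (\sum_(a <- r) F a).
Proof.
elim: r => [|a r IH] h; first by rewrite big_nil => i j; rewrite mxE; apply: fil0.
rewrite big_cons; apply: fil_mxD; first by apply: h; rewrite mem_head.
by apply: IH => b br; apply: h; rewrite inE br orbT.
Qed.

Lemma odd_prod_fil r (th : I -> A) : (forall a, a \in r -> fil Th 1 (th a)) ->
  fil_mx 1 (odd_prod N r th - 1).
Proof.
rewrite /odd_prod; elim: r => [|a r IH] h.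
  by rewrite big_nil subrr => i j; rewrite mxE; apply: fil0.
rewrite big_cons mulrDl mul1r addrAC.
have ha : fil Th 1 (th a) by apply: h; rewrite mem_head.
apply: fil_mxD; first by apply: IH => b br; apply: h; rewrite inE br orbT.
rewrite -[1%N]addn0; apply: fil_mxM; first exact: fil_mx_sc.
by move=> i j; apply: fil_all.
Qed.

(** Every nonlinear term in the difference of the products contains one difference of parameters, of
    degree n, and at least one further parameter, of degree 1. *)
Lemma odd_prod_linear n r (th th' : I -> A) :
  (forall a, a \in r -> [/\ fil Th 1 (th a), fil Th 1 (th' a) & fil Th n (th' a - th a)]) ->
  fil_mx n.+1 (odd_prod N r th' - odd_prod N r th
               - \sum_(a <- r) sc (th' a - th a) (N a)).
Proof.
elim: r => [|a r IH] h.
  by rewrite /odd_prod !big_nil subrr subr0 => i j; rewrite mxE; apply: fil0.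
have hr b : b \in r -> [/\ fil Th 1 (th b), fil Th 1 (th' b) & fil Th n (th' b - th b)].
  by move=> br; apply: h; rewrite inE br orbT.
have [h1 h2 h3] := h a (mem_head _ _).
rewrite /odd_prod !big_cons -!/(odd_prod _ _ _) scDl scNl.
set W := odd_prod N r th; set W' := odd_prod N r th'.
set D := \sum_(b <- r) _; set X := sc (th a) _; set X' := sc (th' a) _.
(* In each of the two added products one factor is a difference, of degree n, and the other has
   degree 1. *)
have -> : (1 + X') * W' - (1 + X) * W - (X' - X + D) =
   (W' - W - D) + ((X' - X) * (W' - 1) + X * (W' - W)).
  have zmod1 (Z : zmodType) (w w' p p' q e : Z) :
      (w' + p') - (w + p) - (q + e) = (w' - w - e) + (p' - p - q).
    by rewrite opprD (addrACA w') [q + e]addrC opprD [LHS]addrACA.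
  have zmod2 (Z : zmodType) (p p' q r' : Z) : p' - p - q = (p' - r' - q) + (r' - p).
    by rewrite [RHS]addrAC addrA subrK.
  rewrite !(mulrDl 1) !mul1r zmod1; congr (_ + _).
  by rewrite (mulrBr (X' - X)) mulr1 mulrBl (mulrBr X); apply: zmod2.
apply: fil_mxD; first exact: IH.
apply: fil_mxD.
  rewrite -addn1; apply: fil_mxM; last by apply: odd_prod_fil => b /hr[].
  by rewrite -scNl -scDl; apply: fil_mx_sc.
rewrite -add1n; apply: fil_mxM; first exact: fil_mx_sc.
have -> : W' - W = (W' - W - D) + D by rewrite subrK.
apply: fil_mxD; first by apply: fil_mxW (IH hr).
by apply: fil_mx_sum => b /hr[_ _ hb]; apply: fil_mx_sc.
Qed.
End Filtered.

Lemma trace_sc (C M : 'M[int]_d) (u : A) :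
  \tr (map_mx intr C *m sc u M) = u * (\tr (C *m M))%:~R.
Proof.
rewrite /mxtrace rmorph_sum mulr_sumr; apply: eq_bigr => i _; rewrite !mxE.
rewrite rmorph_sum mulr_sumr; apply: eq_bigr => j _; rewrite !mxE rmorphM /= mulrA.
by rewrite -com_int mulrA.
Qed.

Variables (p : 'I_d -> bool) (s : seq I).
Hypothesis s_uniq : uniq s.
Hypothesis N_odd : forall a i j, a \in s -> p i = p j -> N a i j = 0.
Hypothesis N_dual : forall b, b \in s -> exists C : 'M[int]_d,
  forall a, a \in s -> \tr (C *m N a) = (a == b)%:R.

(* Modulo each power of the ideal of the parameters, the difference of the
   two products is the sum of the [(th' a - th a) N a], which are linearly
   independent and block-antidiagonal. *)
Lemma odd_prod_inj (g : E) (th th' : I -> A) :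
  (forall i j, p i != p j -> g i j = 0) ->
  (forall a, a \in s -> part true (th a)) -> (forall a, a \in s -> part true (th' a)) ->
  g * odd_prod N s th = odd_prod N s th' -> {in s, th =1 th'}.
Proof.
move=> hg hth hth' e.
pose Th := map th s ++ map th' s.
have Th_odd t : t \in Th -> part true t.
  by rewrite mem_cat => /orP[] /mapP[a sa ->]; [apply: hth | apply: hth'].
have f1 a : a \in s -> fil Th 1 (th a).
  by move=> sa; apply: fil_mem; rewrite mem_cat map_f.
have f1' a : a \in s -> fil Th 1 (th' a).
  by move=> sa; apply: fil_mem; rewrite mem_cat (map_f th') ?orbT.
set W := odd_prod N s th in e; set W' := odd_prod N s th' in e.
have WV : W * odd_prod N (rev s) (fun a => - th a) = 1 by apply: odd_prodV.
set V := odd_prod N (rev s) _ in WV.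
have step n : (0 < n)%N -> (forall a, a \in s -> fil Th n (th' a - th a)) ->
    forall a, a \in s -> fil Th n.+1 (th' a - th a).
  move=> n0 hn b sb; set D := \sum_(a <- s) sc (th' a - th a) (N a).
  have hD : fil_mx Th n.+1 (W' - W - D).
    by apply: odd_prod_linear => // a sa; split; auto.
  have hWW : fil_mx Th n (W' - W).
    rewrite -[W' - W](subrK D); apply: fil_mxD; first exact: fil_mxW hD.
    by apply: fil_mx_sum => a sa; apply: fil_mx_sc => //; apply: hn.
  have eg : g - 1 = (W' - W) * V.
    by rewrite mulrBl -e -mulrA WV mulr1.
  have hg1 : fil_mx Th n (g - 1).
    rewrite eg -[n]addn0; apply: fil_mxM => // i j; exact: fil_all.
  have hgD : fil_mx Th n.+1 (g - 1 - D).
    (* This rewrites g W = W' as (g - 1) W = W' - W; the product on the right has degree n + 1. *)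
    have -> : g - 1 - D = (W' - W - D) - (g - 1) * (W - 1).
      rewrite (mulrBr (g - 1)) mulr1 mulrBl mul1r e.
      by rewrite (opprB (W' - W)) [RHS]addrC [RHS]addrA subrK.
    apply: fil_mxD => //; apply: fil_mxN; rewrite -addn1; apply: fil_mxM => //.
    exact: odd_prod_fil.
  (* The block-diagonal entries of D are zero; at the other entries g - 1 vanishes, so there D
     agrees with -(g - 1 - D). *)
  have {}hD : fil_mx Th n.+1 D.
    move=> i j; case: (eqVneq (p i) (p j)) => pij.
      rewrite /D summxE big_seq big1; first exact: fil0.
      by move=> a sa; rewrite !mxE N_odd // mulr0.
    have := hgD i j; rewrite !mxE hg // (_ : i == j = false).
      by rewrite mulr0n subr0 sub0r => /filN; rewrite opprK.
    by apply/negbTE; apply: contraNneq pij => ->.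
  have [C hC] := N_dual sb.
  (* The trace against the dual matrix isolates one coefficient without any division, which is what
     makes the argument valid modulo an ideal. *)
  have <- : \tr (map_mx intr C *m D) = th' b - th b.
    rewrite mulmx_sumr raddf_sum /= (bigD1_seq b) //= big_seq_cond big1 => [|a].
      by rewrite trace_sc hC // eqxx mulr1 addr0.
    by case/andP=> sa nab; rewrite trace_sc hC // (negbTE nab) mulr0.
  apply: fil_sum => i _; rewrite mxE; apply: fil_sum => j _; rewrite mxE.
  by rewrite -[n.+1]add0n; apply: filM => //; apply: fil_all.
have all_n n a : a \in s -> fil Th n.+1 (th' a - th a).
  elim: n a => [|n IH] a sa; first by apply: filD; [apply: f1' | apply: filN; apply: f1].
  exact: step.
move=> a sa; apply/eqP; rewrite eq_sym -subr_eq0; apply/eqP.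
exact: (fil_big (ltnSn _) (all_n (size Th) a sa)).
Qed.

Variables (ev : 'M[int]_d -> Prop) (G0 : E -> Prop).
Hypothesis ev_br : forall Y Y', ev Y -> ev Y' -> ev (Y * Y' - Y' * Y).
Hypothesis ev_odd : forall Y a, ev Y -> a \in s -> exists z : I -> int,
  Y * N a - N a * Y = \sum_(b <- s) z b *: N b.
Hypothesis odd_odd : forall a b, a \in s -> b \in s -> ev (N a * N b + N b * N a).
Hypothesis odd_sq : forall a, a \in s -> ev (N a * N a).
Hypothesis G0_1 : G0 1.
Hypothesis G0_M : forall x y, G0 x -> G0 y -> G0 (x * y).
Hypothesis G0_V : forall x, G0 x -> exists y, [/\ G0 y, x * y = 1 & y * x = 1].
Hypothesis G0_ev : forall u Y, part false u -> u * u = 0 -> ev Y -> G0 (1 + sc u Y).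
Hypothesis G0_even : forall x i j, G0 x -> part false (x i j).
Hypothesis G0_conj : forall x y a, G0 x -> x * y = 1 -> y * x = 1 -> a \in s ->
  exists2 al : I -> A, (forall b, part false (al b)) &
    x * map_mx intr (N a) * y = \sum_(b <- s) sc (al b) (N b).

Definition odd_list (l : seq (A * I)) : Prop :=
  forall q, q \in l -> part true q.1 /\ q.2 \in s.

Definition list_prod (l : seq (A * I)) : E := \prod_(q <- l) (1 + sc q.1 (N q.2)).

Lemma list_prod_cons q l : list_prod (q :: l) = (1 + sc q.1 (N q.2)) * list_prod l.
Proof. by rewrite /list_prod big_cons. Qed.

Lemma list_prod_cat l l' : list_prod (l ++ l') = list_prod l * list_prod l'.
Proof. by rewrite /list_prod big_cat. Qed.

Lemma odd_list_cat l l' : odd_list l -> odd_list l' -> odd_list (l ++ l').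
Proof. by move=> h h' q; rewrite mem_cat => /orP[/h|/h']. Qed.

(** The conjugate is 1 plus a sum of terms all carrying u, and the square of u is zero: the sum is a
    product of odd letters. *)
Lemma conj_letter x y u a : G0 x -> x * y = 1 -> y * x = 1 -> part true u -> a \in s ->
  exists2 l, odd_list l & x * (1 + sc u (N a)) * y = list_prod l.
Proof.
move=> hx xy yx hu sa; have [al hal e] := G0_conj hx xy yx sa.
exists [seq (u * al b, b) | b <- s].
  move=> q /mapP[b sb ->] /=; split=> //.
  exact: (@sa_partM _ _ true false).
have -> : x * (1 + sc u (N a)) * y = 1 + u *: (x * map_mx intr (N a) * y).
  rewrite mulrDr mulr1 mulrDl xy; congr (_ + _).
  have -> : x * sc u (N a) = u *: (x * map_mx intr (N a)).
    apply/matrixP => i j; rewrite !mxE mulr_sumr; apply: eq_bigr => l _; rewrite !mxE.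
    by rewrite !mulrA (even_central u (G0_even _ _ hx)).
  exact: esym (scalemxAl _ _ _).
rewrite e /list_prod big_map scaler_sumr.
have : {subset s <= s} by [].
elim: {1 3 4}s => [|b r IH] rs; first by rewrite !big_nil addr0.
have {}IH := IH (fun c cr => rs c (mem_behead (s := b :: r) cr)).
rewrite !big_cons -IH /= mulrDl mul1r mulrDr mulr1 mulr_sumr.
rewrite [X in _ = _ + (_ + X)]big1 ?addr0; last first.
  move=> c _; rewrite -[u *: sc _ _]/(u *: (_ *: _)) scalerA -/(sc _ _) scM.
  rewrite -mulrA (mulrA (al b)) (even_central u (hal b)) -(mulrA u) (mulrA u u).
  by rewrite odd_sq0 // mul0r sc0l.
rewrite -[u *: sc _ (N b)]/(u *: (_ *: _)) scalerA -/(sc _ _).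
by rewrite -[RHS]addrA [X in _ = _ + X]addrC.
Qed.

Lemma conj_list x y l : G0 x -> x * y = 1 -> y * x = 1 -> odd_list l ->
  exists2 l', odd_list l' & x * list_prod l * y = list_prod l'.
Proof.
move=> hx xy yx; elim: l => [|[u a] l IH] hl.
  by exists [::] => //; rewrite /list_prod !big_nil mulr1.
have [l1 hl1 e1] := IH (fun q ql => hl q (mem_behead (s := _ :: _) ql)).
have [/= hu sa] := hl _ (mem_head _ _).
have [l0 hl0 e0] := conj_letter hx xy yx hu sa.
exists (l0 ++ l1); first exact: odd_list_cat.
rewrite list_prod_cat -e0 -e1 list_prod_cons /=.
by rewrite !mulrA -(mulrA _ y x) yx mulr1.
Qed.

Lemma list_prodV l : odd_list l ->
  exists2 l', odd_list l' & list_prod l * list_prod l' = 1 /\ list_prod l' * list_prod l = 1.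
Proof.
elim: l => [|[u a] l IH] hl.
  by exists [::] => //; rewrite /list_prod !big_nil mulr1.
have [l1 hl1 [e1 e2]] := IH (fun q ql => hl q (mem_behead (s := _ :: _) ql)).
have [/= hu sa] := hl _ (mem_head _ _).
exists (l1 ++ [:: (- u, a)]).
  apply: odd_list_cat => // q; rewrite inE => /eqP-> /=; split=> //.
  exact: sa_partN.
rewrite list_prod_cat !list_prod_cons (_ : list_prod [::] = 1) ?mulr1 /=; last first.
  by rewrite /list_prod big_nil.
set L := list_prod l in e1 e2 *; set L1 := list_prod l1 in e1 e2 *.
split; first by rewrite mulrA -(mulrA _ L) e1 mulr1 odd_letter_inv.
rewrite mulrA -(mulrA L1) -{2}[u]opprK odd_letter_inv ?mulr1 //.
exact: sa_partN.
Qed.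

(** Here the odd letters come in any order and with repetitions. Such elements already form a group,
    which is what containing G requires; they are sorted afterwards. *)
Definition factored (x : E) : Prop :=
  exists l g, [/\ odd_list l, G0 g & x = list_prod l * g].

Lemma factoredM x y : factored x -> factored y -> factored (x * y).
Proof.
move=> [l [g [hl hg ->]]] [l1 [g1 [hl1 hg1 ->]]].
have [h [hh gh hgg]] := G0_V hg.
have [l2 hl2 e2] := conj_list hg gh hgg hl1.
exists (l ++ l2), (g * g1); split; [exact: odd_list_cat | exact: G0_M |].
rewrite list_prod_cat -e2 !mulrA.
by rewrite -(mulrA _ h g) hgg mulr1.
Qed.

Lemma factored_G0 g : G0 g -> factored g.
Proof. by move=> hg; exists [::], g; split=> //; rewrite /list_prod big_nil mul1r. Qed.

Lemma factored_odd u a : part true u -> a \in s -> factored (1 + sc u (N a)).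
Proof.
move=> hu sa; exists [:: (u, a)], 1; split=> //.
  by move=> q; rewrite inE => /eqP->.
by rewrite /list_prod big_seq1 mulr1.
Qed.

Lemma factoredV x : factored x -> exists y, [/\ factored y, x * y = 1 & y * x = 1].
Proof.
move=> [l [g [hl hg ->]]].
have [h [hh gh hgg]] := G0_V hg; have [l1 hl1 [e1 e2]] := list_prodV hl.
exists (h * list_prod l1); split.
- apply: factoredM; first exact: factored_G0.
  by exists l1, 1; split=> //; rewrite mulr1.
- by rewrite mulrA -(mulrA _ g h) gh mulr1.
- by rewrite mulrA -(mulrA _ _ (list_prod l)) e2 mulr1.
Qed.

Lemma factored_sorted x : factored x -> exists g th,
  [/\ G0 g, forall a, part true (th a) & x = g * odd_prod N s th].
Proof.
move=> [l [g [hl hg ->]]].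
have [h [hh gh hgg]] := G0_V hg.
have [l1 hl1 e1] := conj_list hh hgg gh hl.
have -> : list_prod l * g = g * list_prod l1.
  by rewrite -e1 !mulrA gh mul1r.
(* The ideal of the filtration is generated by the parameters of this word; its letters have depth
   1, so the missing depth is the number of letters. *)
pose Th := map fst l1.
have Th_odd t : t \in Th -> part true t by move=> /mapP[q /hl1[hq _] ->].
have hw : word s N ev Th 1 (list_prod l1).
  have : {subset l1 <= l1} by [].
  rewrite /list_prod; elim: {1 3}l1 => [|[u a] r IH] rl; first by rewrite big_nil; apply: word1.
  have ru : (u, a) \in l1 by apply: rl; rewrite mem_head.
  have [/= hu sa] := hl1 _ ru; rewrite big_cons /=; apply: word_cons.
    by apply: OddLetter => //; apply: fil_mem; apply/mapP; exists (u, a).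
  by apply: IH => q qr; apply: rl; rewrite inE qr orbT.
(* Sorting starts from the product with all parameters zero, which is 1. *)
have h0 : odd_params Th (fun _ : I => (0 : A)).
  by move=> a; split; [exact: sa_part0 | exact: fil0].
have lt1 : (size Th < 1 + size Th)%N by [].
have [g1 [th [hg1 hth e]]] := sort_word tf2 s_uniq ev_br ev_odd odd_odd odd_sq G0_1 G0_M
  G0_ev Th_odd (ltnSn 0) lt1 hw h0.
exists (g * g1), th; split; [exact: G0_M | by move=> a; case: (hth a) |].
rewrite -mulrA -e; congr (_ * _).
rewrite [odd_prod _ _ _]big1 ?mul1r // => a _.
by rewrite sc0l addr0.
Qed.

End OddProducts.

(** * Integer matrices in characteristic zero *)

Lemma bezout_seq (I : eqType) (r : seq I) (F : I -> int) : uniq r ->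
  exists (g : int) (c : I -> int),
    (forall i, i \in r -> (g %| F i)%Z) /\ \sum_(i <- r) c i * F i = g.
Proof.
elim: r => [|i r IH] /=; first by exists 0, (fun _ => 0); rewrite big_nil.
case/andP=> ir /IH[g [c [hg hc]]].
have [u [v huv]] := Bezoutz (F i) g.
exists (gcdz (F i) g), (fun j => if j == i then u else v * c j); split.
  move=> j; rewrite inE => /orP[/eqP->|jr]; first exact: dvdz_gcdl.
  by apply: dvdz_trans (hg _ jr); apply: dvdz_gcdr.
rewrite big_cons eqxx -huv; congr (_ + _).
rewrite -hc mulr_sumr !big_seq; apply: eq_bigr => j jr.
by rewrite mulrA; case: eqP jr ir => // -> ->.
Qed.

(** Here g is the content of N. Writing it as a trace turns divisibility questions into evaluations
    of a linear form, which survive the passage to K or to A. *)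
Lemma bezout_mx d (N : 'M[int]_d) : exists (g : int) (B N' : 'M[int]_d),
  N = g *: N' /\ \tr (B *m N) = g.
Proof.
have [g [c [hg hc]]] := bezout_seq (fun q : 'I_d * 'I_d => N q.1 q.2) (enum_uniq {: 'I_d * 'I_d}).
exists g, (\matrix_(i, j) c (j, i)), (\matrix_(i, j) (N i j %/ g)%Z); split.
  apply/matrixP => i j; rewrite !mxE mulrC divzK //.
  by apply: (hg (i, j)); rewrite mem_enum.
rewrite -hc big_enum /= (eq_bigr (fun q => c (q.1, q.2) * N q.1 q.2)); last by case.
rewrite -(pair_bigA _ (fun i j => c (i, j) * N i j)) /= exchange_big.
by apply: eq_bigr => i _; rewrite mxE; apply: eq_bigr => j _; rewrite mxE.
Qed.

Lemma sqmx_scalel (R : pzRingType) d (k : R) (A B : 'M[R]_d) : (k *: A) * B = k *: (A * B).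
Proof. by rewrite -!mulmxE scalemxAl. Qed.

Lemma sqmx_scaler (R : comPzRingType) d (k : R) (A B : 'M[R]_d) : A * (k *: B) = k *: (A * B).
Proof. by rewrite -!mulmxE scalemxAr. Qed.

Lemma scale_intmx_inj d (k : int) (A B : 'M[int]_d) : k != 0 -> k *: A = k *: B -> A = B.
Proof.
move=> nk /matrixP E; apply/matrixP => i j; apply: (mulfI nk).
by have := E i j; rewrite !mxE.
Qed.

Definition primitive d (N : 'M[int]_d) := exists B : 'M[int]_d, \tr (B *m N) = 1.

Section CharZero.
Variables (K : fieldType) (char_K : [pchar K] =i pred0).

Lemma natK_eq0 n : (n%:R == 0 :> K) = (n == 0)%N.
Proof. by move: n; apply/pcharf0P. Qed.

Lemma intK_eq0 (z : int) : (z%:~R == 0 :> K) = (z == 0).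
Proof.
case: z => n; first exact: natK_eq0.
by rewrite NegzE mulrNz oppr_eq0 oppr_eq0 natK_eq0.
Qed.

Lemma intK_inj : injective (fun z : int => z%:~R : K).
Proof.
move=> x y e; apply/eqP; rewrite -subr_eq0 -intK_eq0 rmorphB /= e subrr.
by [].
Qed.

Definition imx d (N : 'M[int]_d) : 'M[K]_d := map_mx intr N.

Lemma imx_inj d : injective (@imx d).
Proof.
move=> M N /matrixP e; apply/matrixP => i j; apply: intK_inj.
by have := e i j; rewrite !mxE.
Qed.

Lemma imxM d (M N : 'M[int]_d) : imx (M * N) = imx M * imx N.
Proof. exact: (map_mxM intr). Qed.

Lemma imxD d (M N : 'M[int]_d) : imx (M + N) = imx M + imx N.
Proof. exact: (map_mxD intr). Qed.

Lemma imxN d (N : 'M[int]_d) : imx (- N) = - imx N.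
Proof. exact: (map_mxN intr). Qed.

Lemma imxB d (M N : 'M[int]_d) : imx (M - N) = imx M - imx N.
Proof. exact: (map_mxB intr). Qed.

Lemma imxZ d z (N : 'M[int]_d) : imx (z *: N) = z%:~R *: imx N.
Proof. exact: (map_mxZ intr). Qed.

Lemma imx1 d : imx (1 : 'M[int]_d) = 1.
Proof. exact: (map_mx1 intr). Qed.

Lemma imx0 d : imx (0 : 'M[int]_d) = 0.
Proof. exact: (map_mx0 intr). Qed.

Lemma imx_sum d (I : Type) (r : seq I) (F : I -> 'M[int]_d) :
  imx (\sum_(i <- r) F i) = \sum_(i <- r) imx (F i).
Proof.
elim/big_rec2: _ => [|i x y _ <-]; first by rewrite imx0.
by rewrite imxD.
Qed.

Lemma imx_trace d (B N : 'M[int]_d) : \tr (imx B *m imx N) = (\tr (B *m N))%:~R.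
Proof. by rewrite -[LHS]/(\tr (map_mx _ _ *m map_mx _ _)) -map_mxM -(trace_map_mx intr). Qed.

(** Pairing with the Bezout matrix of N shows that c is the trace of an integer matrix. *)
Lemma primitive_int d (N M : 'M[int]_d) (c : K) : primitive N ->
  c *: imx N = imx M -> exists z : int, c = z%:~R.
Proof.
move=> [B hB] e; exists (\tr (B *m M)).
by rewrite -imx_trace -e -scalemxAr linearZ /= imx_trace hB mulr1.
Qed.

(** The binomial coefficient of x and n: the eigenvalue of [div_binom] where H_i acts by x. *)
Definition bin_poly (x : K) n : K := (n`!%:R)^-1 * \prod_(j <- iota 0 n) (x - j%:R).

Lemma bin_poly0 x : bin_poly x 0 = 1.
Proof. by rewrite /bin_poly big_nil fact0 invr1 mulr1. Qed.

(** Pascal's rule. Shifting the index of the product on the left exposes the common factor of the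
    three terms. *)
Lemma bin_polyS x n : bin_poly (x + 1) n.+1 = bin_poly x n.+1 + bin_poly x n.
Proof.
rewrite /bin_poly.
have -> : iota 0 n.+1 = rcons (iota 0 n) n by rewrite -[in LHS]addn1 iotaD cats1.
rewrite -cats1 !big_cat !big_seq1 /=.
have -> : (\prod_(j <- iota 0 n) (x + 1 - j%:R)) * (x + 1 - n%:R) = (x + 1) * \prod_(j <- iota 0 n) (x - j%:R).
  have <- : \prod_(j <- iota 0 n.+1) (x + 1 - j%:R) = (\prod_(j <- iota 0 n) (x + 1 - j%:R)) * (x + 1 - n%:R).
    by rewrite -[in LHS]addn1 iotaD big_cat big_seq1 /=.
  rewrite /= big_cons subr0; congr (_ * _).
  rewrite (iotaDl 1 0 n) big_map; apply: eq_bigr => j _; rewrite natrD.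
  by rewrite opprD addrA addrK.
rewrite factS natrM; set P := \prod_(_ <- _) _.
have n1 : n.+1%:R != 0 :> K by rewrite natK_eq0.
have n2 : n`!%:R != 0 :> K by rewrite natK_eq0 -lt0n fact_gt0.
rewrite -natr1 in n1 *.
by field; rewrite n1 n2.
Qed.

Lemma bin_poly_small m n : (m < n)%N -> bin_poly m%:R n = 0.
Proof.
move=> lt; rewrite /bin_poly (bigD1_seq m) ?mem_iota ?iota_uniq //= subrr mul0r mulr0.
by [].
Qed.

Lemma bin_poly_nn n : bin_poly n%:R n = 1.
Proof.
elim: n => [|n IH]; first exact: bin_poly0.
by rewrite -natr1 bin_polyS IH bin_poly_small ?add0r.
Qed.

Lemma bin_poly_opp1 n : bin_poly (-1) n = (-1) ^+ n.
Proof.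
elim: n => [|n IH]; first exact: bin_poly0.
have := bin_polyS (-1) n; rewrite addNr (@bin_poly_small 0) // IH => /esym/eqP.
by rewrite addr_eq0 exprS mulN1r => /eqP.
Qed.

(* The value 1 at z = 0 comes from the extreme terms, the two factors killing
   respectively the negative and the positive values of z. *)
Lemma bin_poly_indicator n (z : int) : (`|z| <= n)%N ->
  (-1) ^+ n * (bin_poly (z%:~R + n%:R) n * bin_poly (z%:~R - 1) n) = (z == 0)%:R.
Proof.
case: z => [[|m]|m] le_n.
- rewrite add0r bin_poly_nn mul1r sub0r bin_poly_opp1 -expr2 sqrr_sign.
  by [].
- rewrite -pmulrn -natr1 addrK (bin_poly_small (m := m)) //.
  by rewrite !mulr0.
have -> : (Negz m)%:~R + n%:R = (n - m.+1)%:R :> K.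
  by rewrite NegzE mulrNz natrB // addrC.
rewrite bin_poly_small ?mul0r ?mulr0 //.
by rewrite ltn_subrL /= (leq_trans _ le_n).
Qed.

Section Indicators.
Variables (T : finType) (Phi : (T -> K) -> Prop) (x : T -> int).
Hypothesis Phi_ext : forall f f', f =1 f' -> Phi f -> Phi f'.
Hypothesis Phi1 : Phi (fun=> 1).
Hypothesis PhiB : forall f f', Phi f -> Phi f' -> Phi (fun t => f t - f' t).
Hypothesis PhiM : forall f f', Phi f -> Phi f' -> Phi (fun t => f t * f' t).
Hypothesis Phi_bin : forall n, Phi (fun t => bin_poly (x t)%:~R n).

Let PhiN f : Phi f -> Phi (fun t => - f t).
Proof.
move=> hf; have h0 := PhiB hf hf; have := PhiB h0 hf.
by apply: Phi_ext => t; rewrite subrr sub0r.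
Qed.

Let PhiD f f' : Phi f -> Phi f' -> Phi (fun t => f t + f' t).
Proof.
move=> hf hf'; have := PhiB hf (PhiN hf').
by apply: Phi_ext => t; rewrite opprK.
Qed.

(** Pascal's rule gives the positive shifts by addition; solved for the term of the same degree, it
    gives the negative ones by subtraction. *)
Lemma Phi_shift n (c : int) : Phi (fun t => bin_poly ((x t)%:~R + c%:~R) n).
Proof.
have pos m : Phi (fun t => bin_poly ((x t)%:~R + m%:R) n).
  elim: m n => [|m IH] n.
    by apply: Phi_ext (Phi_bin n) => t; rewrite addr0.
  case: n => [|n]; first by apply: Phi_ext Phi1 => t; rewrite bin_poly0.
  apply: Phi_ext (PhiD (IH n.+1) (IH n)) => t.
  by rewrite -natr1 addrA bin_polyS.
case: c => m; first exact: pos.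
elim: m n {pos} => [|m IH] n.
  elim: n => [|n IH]; first by apply: Phi_ext Phi1 => t; rewrite bin_poly0.
  apply: Phi_ext (PhiB (Phi_bin n.+1) IH) => t; rewrite NegzE mulrNz /=.
  by rewrite -{1}[(x t)%:~R](subrK 1) bin_polyS addrK.
elim: n => [|n IH']; first by apply: Phi_ext Phi1 => t; rewrite bin_poly0.
apply: Phi_ext (PhiB (IH n.+1) IH') => t; rewrite !NegzE !mulrNz.
have -> : (x t)%:~R - m.+1%:~R = (x t)%:~R - m.+2%:~R + 1 :> K.
  rewrite -!pmulrn -[m.+2%:R]natr1 opprD addrA subrK.
  by [].
by rewrite bin_polyS addrK.
Qed.

(** As the index set is finite, one n bounds all the distances |x t - c|; then [bin_poly_indicator]
    writes the indicator as a signed product of two shifted binomials of degree n. *)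
Lemma Phi_indicator (c : int) : Phi (fun t => (x t == c)%:R).
Proof.
pose n := \max_t `|(x t - c)%R|%N.
have h1 := PhiM (Phi_shift n (n%:Z - c)) (Phi_shift n (- c - 1)).
have hs : Phi (fun=> (-1) ^+ n).
  elim: n {h1} => [|n IH]; first by [].
  by apply: Phi_ext (PhiN IH) => t; rewrite exprS mulN1r.
apply: Phi_ext (PhiM hs h1) => t.
rewrite -subr_eq0 -(@bin_poly_indicator n); last exact: (leq_bigmax t).
congr (_ * (bin_poly _ _ * bin_poly _ _)).
  by rewrite !rmorphB /= addrCA addrC.
by rewrite !rmorphB rmorphN /= addrA.
Qed.

End Indicators.
End CharZero.

(** * Integral weight projections *)

Section BlockDiagonal.
Variables (d : nat) (p : 'I_d -> bool).

Definition block_diag (R : pzRingType) (N : 'M[R]_d) : Prop :=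
  forall i j, p i != p j -> N i j = 0.

Lemma block_diag1 (R : pzRingType) : block_diag (1 : 'M[R]_d).
Proof.
by move=> i j pij; rewrite !mxE (_ : i == j = false) //; apply: contraNF pij => /eqP->.
Qed.

Lemma block_diagB (R : pzRingType) (M N : 'M[R]_d) :
  block_diag M -> block_diag N -> block_diag (M - N).
Proof. by move=> hM hN i j pij; rewrite !mxE hM // hN // subr0. Qed.

Lemma block_diagM (R : pzRingType) (M N : 'M[R]_d) :
  block_diag M -> block_diag N -> block_diag (M * N).
Proof.
move=> hM hN i j pij; rewrite mxE big1 // => l _.
case: (eqVneq (p i) (p l)) => [il|il]; last by rewrite hM ?mul0r.
by rewrite hN ?mulr0 // -il.
Qed.

Lemma block_diag_sum (R : pzRingType) (I : Type) (r : seq I) (F : I -> 'M[R]_d) :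
  (forall a, block_diag (F a)) -> block_diag (\sum_(a <- r) F a).
Proof. by move=> h i j pij; rewrite summxE big1 // => a _; apply: h. Qed.
End BlockDiagonal.

Section WeightProjections.
Variables (K : fieldType) (char_K : [pchar K] =i pred0).
Variables (d l : nat) (p : 'I_d -> bool) (T : 'I_l -> 'M[int]_d).
Variables (P : 'M[K]_d) (z : 'I_d -> 'I_l -> int).

(** The operator for which row j of P is an eigenvector of eigenvalue f j, acting on rows from the
    right. *)
Definition diag_op (f : 'I_d -> K) : 'M[K]_d := invmx P *m diag_mx (\row_j f j) *m P.

Hypothesis P_unit : P \in unitmx.
Hypothesis T_diag : forall i, imx K (T i) = diag_op (fun j => (z j i)%:~R).
Hypothesis T_bin : forall i n, exists2 B, block_diag p B &
  imx K B = diag_op (fun j => bin_poly (z j i)%:~R n).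

Lemma eq_diag_op f f' : f =1 f' -> diag_op f = diag_op f'.
Proof.
by move=> e; congr (_ *m diag_mx _ *m _); apply/rowP => j; rewrite !mxE e.
Qed.

Lemma diag_opM f f' : diag_op f * diag_op f' = diag_op (fun j => f j * f' j).
Proof.
rewrite /diag_op -!mulmxE !mulmxA mulmxK //; congr (_ *m _).
rewrite -!mulmxA; congr (_ *m _); apply/matrixP => i j; rewrite mul_diag_mx !mxE.
by rewrite mulrnAr.
Qed.

Lemma diag_opB f f' : diag_op f - diag_op f' = diag_op (fun j => f j - f' j).
Proof.
rewrite /diag_op -mulmxBl -mulmxBr; congr (_ *m _ *m _).
by apply/matrixP => i j; rewrite !mxE mulrnBl.
Qed.

Lemma diag_op1 : diag_op (fun=> 1) = 1.
Proof.
rewrite /diag_op (_ : diag_mx _ = 1%:M) ?mulmx1 ?mulVmx //.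
by apply/matrixP => i j; rewrite !mxE.
Qed.

Lemma diag_op0 : diag_op (fun=> 0) = 0.
Proof.
rewrite /diag_op (_ : diag_mx _ = 0) ?mulmx0 ?mul0mx //.
by apply/matrixP => i j; rewrite !mxE mul0rn.
Qed.

Lemma diag_op_sum (I : Type) (r : seq I) (f : I -> 'I_d -> K) :
  \sum_(c <- r) diag_op (f c) = diag_op (fun j => \sum_(c <- r) f c j).
Proof.
elim: r => [|c r IH].
  rewrite big_nil -diag_op0; apply: eq_diag_op => j; by rewrite big_nil.
rewrite big_cons IH.
have -> g h : diag_op g + diag_op h = diag_op (fun j => g j + h j).
  rewrite -[diag_op h]opprK -[- diag_op h]sub0r -diag_op0 !diag_opB.
  by apply: eq_diag_op => j; rewrite sub0r opprK.
by apply: eq_diag_op => j; rewrite big_cons.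
Qed.

Definition weight (j : 'I_d) : {ffun 'I_l -> int} := [ffun i => z j i].
Definition weights : seq {ffun 'I_l -> int} := undup [seq weight j | j <- enum 'I_d].

Definition weight_proj (Pi : {ffun 'I_l -> int} -> 'M[int]_d) : Prop :=
  forall c, block_diag p (Pi c) /\ imx K (Pi c) = diag_op (fun j => (weight j == c)%:R).

(** The indicator of a weight is the product over i of the indicators of its coordinates, each
    integral in the binomials of H_i. Hence the projection preserves M, and it is block diagonal
    because the H_i are even. *)
Lemma weight_proj_exists : exists Pi, weight_proj Pi.
Proof.
pose Phi f := exists2 B, block_diag p B & imx K B = diag_op f.
have Phi_ext f f' : f =1 f' -> Phi f -> Phi f'.
  by move=> e [B hB eB]; exists B; rewrite // eB; apply: eq_diag_op.
have Phi1 : Phi (fun=> 1).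
  by exists 1; [exact: block_diag1 | rewrite imx1 diag_op1].
have PhiB f f' : Phi f -> Phi f' -> Phi (fun t => f t - f' t).
  move=> [B hB eB] [B' hB' eB']; exists (B - B'); first exact: block_diagB.
  by rewrite imxB eB eB' diag_opB.
have PhiM f f' : Phi f -> Phi f' -> Phi (fun t => f t * f' t).
  move=> [B hB eB] [B' hB' eB']; exists (B * B'); first exact: block_diagM.
  by rewrite imxM eB eB' diag_opM.
have Phi_c (c : {ffun 'I_l -> int}) : Phi (fun j => (weight j == c)%:R).
  have : Phi (fun j => \prod_(i <- enum 'I_l) (z j i == c i)%:R).
    elim: (enum 'I_l) => [|i r IH]; first by apply: Phi_ext Phi1 => j; rewrite big_nil.
    apply: (Phi_ext (fun j => (z j i == c i)%:R * \prod_(i <- r) (z j i == c i)%:R)).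
      by move=> j; rewrite big_cons.
    apply: (PhiM _ _ _ IH).
    exact: (Phi_indicator char_K Phi_ext Phi1 PhiB PhiM (x := fun j => z j i) (T_bin i)).
  apply: (Phi_ext) => j; rewrite big_enum /=; case: eqP => [<-|ne].
    by rewrite big1 // => i _; rewrite ffunE eqxx.
  have [i ni] : exists i, z j i != c i.
    apply/existsP; apply: contra_notT ne; rewrite negb_exists => /forallP h.
    by apply/ffunP => i; rewrite ffunE; apply/eqP; rewrite -[_ == _]negbK h.
  by rewrite (bigD1 i) //= (negbTE ni) mul0r.
have /fin_all_exists[pi hpi] : forall j, exists B : 'M[int]_d,
    block_diag p B /\ imx K B = diag_op (fun j' => (weight j' == weight j)%:R).
  by move=> j; have [B h1 h2] := Phi_c (weight j); exists B.
(* An index c that is not a weight of V gets the zero projection. *)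
exists (fun c => if [pick j | weight j == c] is Some j then pi j else 0) => c.
case: pickP => [j /eqP<-|no] //; split; first by move=> i j _; rewrite mxE.
by rewrite imx0 -diag_op0; apply: eq_diag_op => j; rewrite no.
Qed.

Variable Pi : {ffun 'I_l -> int} -> 'M[int]_d.
Hypothesis PiP : weight_proj Pi.

Lemma sum_weights (F : {ffun 'I_l -> int} -> K) j :
  \sum_(c <- weights) (weight j == c)%:R * F c = F (weight j).
Proof.
rewrite (bigD1_seq (weight j)) ?undup_uniq //=; last first.
  by rewrite mem_undup map_f // mem_enum.
rewrite eqxx mul1r big1 ?addr0 // => c; rewrite eq_sym => /negbTE->.
by rewrite mul0r.
Qed.

Lemma weight_proj_sum : \sum_(c <- weights) Pi c = 1.
Proof.
apply: (imx_inj char_K); rewrite imx_sum imx1.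
under eq_bigr do rewrite (PiP _).2.
rewrite diag_op_sum -diag_op1; apply: eq_diag_op => j.
by rewrite -[RHS](sum_weights (fun=> 1) j); apply: eq_bigr => c _; rewrite mulr1.
Qed.

Lemma weight_projM c c' : Pi c * Pi c' = if c == c' then Pi c else 0.
Proof.
apply: (imx_inj char_K); rewrite imxM !(PiP _).2 diag_opM.
case: eqP => [<-|ne].
  by rewrite (PiP _).2; apply: eq_diag_op => j; case: eqP; rewrite ?mulr1 ?mulr0.
rewrite imx0 -diag_op0; apply: eq_diag_op => j.
by case: eqP => [->|]; [rewrite mul1r; case: eqP | rewrite mul0r].
Qed.

Variables (N : 'M[int]_d) (b : {ffun 'I_l -> int}).
Hypothesis N_weight : forall i, N * T i - T i * N = b i *: N.

Let Nt : 'M[K]_d := P *m imx K N *m invmx P.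

(** In the weight basis the commutator with T i multiplies the entry (j, j') by the difference of
    the i-th coordinates of the two weights. *)
Let Nt_entry j j' : Nt j j' != 0 -> weight j' = weight j + b.
Proof.
move=> nz; apply/ffunP => i; rewrite !ffunE; apply: (intK_inj char_K).
have := congr1 (fun M => P *m M *m invmx P) (congr1 (@imx K d) (N_weight i)).
rewrite imxB !imxM imxZ T_diag /diag_op -!mulmxE mulmxBr mulmxBl.
rewrite -scalemxAr -scalemxAl -/Nt !mulmxA mulmxV // mul1mx mulmxK //.
rewrite -!mulmxA (mulmxA P (imx K N)) -!mulmxA.
move=> /matrixP/(_ j j').
rewrite !mulmxA -/Nt mul_mx_diag -(mulmxA _ P) -(mulmxA _ _ (invmx P)) -/Nt mul_diag_mx.
move: (Nt) nz => M nz; rewrite !mxE mulrC -mulrBl => /(mulIf nz) /eqP; rewrite subr_eq => /eqP ->.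
by rewrite addrC rmorphD.
Qed.

Lemma diag_op_weight f f' : (forall j j', weight j' = weight j + b -> f j = f' j') ->
  diag_op f * imx K N = imx K N * diag_op f'.
Proof.
move=> e.
have : diag_mx (\row_j f j) *m Nt = Nt *m diag_mx (\row_j f' j).
  have := @Nt_entry; move: (Nt) => M he; apply/matrixP => j j'.
  rewrite mul_diag_mx mul_mx_diag !mxE mulrC.
  case: (eqVneq (M j j') 0) => [->|nz]; first by rewrite !mul0r.
  by rewrite (e _ _ (he _ _ nz)).
have -> : imx K N = invmx P *m Nt *m P.
  by rewrite /Nt !mulmxA mulVmx // mul1mx mulmxKV.
move: (Nt) => M key; rewrite /diag_op -!mulmxE !mulmxA !mulmxK //.
by rewrite -(mulmxA (invmx P)) key !mulmxA.
Qed.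

Lemma weight_proj_comm c : Pi c * N = N * Pi (c + b).
Proof.
apply: (imx_inj char_K); rewrite !imxM !(PiP _).2; apply: diag_op_weight => j j' ->.
by rewrite (inj_eq (addIr b)).
Qed.

(** The sum of compressions between weights at distance b' keeps exactly the part of weight b'. It
    serves in [N_dual] to separate one root from the others inside a trace. *)
Lemma weight_component b' :
  \sum_(c <- weights) Pi c * N * Pi (c + b') = if b == b' then N else 0.
Proof.
have e c : Pi c * N * Pi (c + b') = if b == b' then Pi c * N else 0.
  rewrite weight_proj_comm -mulrA weight_projM (inj_eq (addrI c)).
  by case: eqP; rewrite ?mulr0.
under eq_bigr do rewrite e.
case: eqP => _; last by rewrite big1.
by rewrite -mulr_suml weight_proj_sum mul1r.
Qed.

(** A nonzero entry of the d-th power would provide d + 1 basis vectors whose weights are successive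
    translates by b, hence distinct in characteristic zero; there are only d basis vectors. *)
Lemma weight_nilpotent : b != 0 -> N ^+ d = 0.
Proof.
move=> nb.
have chain n j j' : ((Nt : 'M[K]_d) ^+ n) j j' != 0 -> exists r : seq 'I_d,
    map weight r = [seq weight j' - b *+ m | m <- iota 0 n.+1].
  elim: n j' => [|n IH] j' nz; first by exists [:: j'] => /=; rewrite mulr0n subr0.
  have [i nzi] : exists i, (Nt ^+ n) j i * Nt i j' != 0.
    apply/existsP; apply: contraNT nz; rewrite negb_exists => /forallP h.
    by rewrite exprSr mxE big1 // => i _; apply/eqP; rewrite -[_ == _]negbK h.
  move: nzi; rewrite mulf_eq0 negb_or => /andP[/IH[r er] /Nt_entry ej].
  exists (j' :: r); have -> : iota 0 n.+2 = 0%N :: [seq m.+1 | m <- iota 0 n.+1].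
    by rewrite -[RHS]/(_ :: map (addn 1) _) -iotaDl.
  rewrite 2![map _ (_ :: _)]map_cons er mulr0n subr0; congr (_ :: _).
  rewrite -map_comp; apply: eq_map => m /=.
  by rewrite ej mulrS opprD addrA addrK.
have Nt0 : (Nt : 'M[K]_d) ^+ d = 0.
  apply/eqP; apply: contraT => nz.
  have [j [j' nzj]] : exists j j', (Nt ^+ d) j j' != 0.
    have [/existsP[j /existsP[j' h]]|] := boolP [exists j, exists j', (Nt ^+ d) j j' != 0].
      by exists j, j'.
    rewrite negb_exists => /forallP h; case/eqP: nz; apply/matrixP => j j'.
    have := h j; rewrite negb_exists => /forallP/(_ j'); rewrite negbK => /eqP->.
    by rewrite mxE.
  have [r er] := chain _ _ _ nzj.
  have ur : uniq r.
    apply: (@map_uniq _ _ weight); rewrite er map_inj_in_uniq ?iota_uniq //.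
    move=> m m' _ _ /addrI/oppr_inj e; apply/eqP; move: nb; apply: contraNT => ne.
    apply/eqP/ffunP => i; move/ffunP/(_ i): e; rewrite !ffunMnE ffunE => e.
    apply/eqP; move/eqP: e; rewrite -[X in X == _]mulr_natr -[X in _ == X]mulr_natr -subr_eq0 -mulrBr mulf_eq0.
    by rewrite subr_eq0 eqr_nat (negbTE ne) orbF.
  have := card_uniqP ur; have := congr1 size er; rewrite !size_map size_iota => ->.
  by move=> cr; have := max_card (mem r); rewrite cr card_ord ltnn.
apply: (imx_inj char_K).
have eN n : imx K (N ^+ n) = invmx P *m ((Nt : 'M[K]_d) ^+ n) *m P.
  elim: n => [|n IH]; first by rewrite !expr0 imx1 mulmx1 mulVmx.
  by rewrite !exprSr imxM IH -!mulmxE /Nt !mulmxA mulmxKV.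
by rewrite eN Nt0 mulmx0 mul0mx imx0.
Qed.

End WeightProjections.

(** * Matrices of a supermodule *)

Section ModuleMatrices.
Variables (K : fieldType) (g : lieSuperalg K) (V : lieSupermod g).
Variables (d : nat) (e : d.-tuple V).
Hypothesis e_basis : basis_of fullv e.
Implicit Types (u : 'End(V)) (x y : g) (m : 'rV[K]_d).

Definition lfun_mx (u : 'End(V)) : 'M[K]_d := \matrix_(i, j) coord e j (u (tnth e i)).
Definition vec (m : 'rV[K]_d) : V := \sum_j m 0 j *: tnth e j.

Lemma coordE v : v = \sum_j coord e j v *: tnth e j.
Proof.
rewrite {1}(coord_basis e_basis (memvf v)); apply: eq_bigr => j _.
by rewrite (tnth_nth 0).
Qed.

Lemma coord_sum (k : 'I_d -> K) j : coord e j (\sum_i k i *: tnth e i) = k j.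
Proof.
rewrite -[RHS](coord_sum_free k j (basis_free e_basis)); congr (coord e j _).
by apply: eq_bigr => i _; rewrite (tnth_nth 0).
Qed.

Lemma vec_inj : injective vec.
Proof. by move=> m m' /(congr1 (fun v => coord e ^~ v)) E; apply/rowP => j; 
  rewrite -(coord_sum (m 0)) -(coord_sum (m' 0)); apply: (congr1 (@^~ j) E). Qed.

Lemma vec_coord v : vec (\row_j coord e j v) = v.
Proof. by rewrite [RHS]coordE; apply: eq_bigr => j _; rewrite mxE. Qed.

Lemma lfun_mxE u i : u (tnth e i) = \sum_j lfun_mx u i j *: tnth e j.
Proof. by rewrite [LHS]coordE; apply: eq_bigr => j _; rewrite mxE. Qed.

Lemma lfun_vec u m : u (vec m) = vec (m *m lfun_mx u).
Proof.
rewrite /vec linear_sum /=; under eq_bigr do rewrite linearZ /= lfun_mxE scaler_sumr.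
rewrite exchange_big; apply: eq_bigr => j _; rewrite mxE scaler_suml.
by apply: eq_bigr => i _; rewrite scalerA.
Qed.

Lemma lfun_mx_inj : injective lfun_mx.
Proof.
move=> u u' E; apply/lfunP => v; by rewrite -(vec_coord v) !lfun_vec E.
Qed.

Lemma lfun_mxP u (M : 'M[K]_d) : (forall m, u (vec m) = vec (m *m M)) -> lfun_mx u = M.
Proof.
move=> h; apply/row_matrixP => i; apply: vec_inj.
by rewrite !rowE -lfun_vec h.
Qed.

Lemma vecD m m' : vec (m + m') = vec m + vec m'.
Proof. by rewrite /vec -big_split; apply: eq_bigr => j _; rewrite mxE scalerDl. Qed.

Lemma vecZ c m : vec (c *: m) = c *: vec m.
Proof. by rewrite /vec scaler_sumr; apply: eq_bigr => j _; rewrite mxE scalerA. Qed.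

Lemma vec_sum (I : Type) (r : seq I) (F : I -> 'rV[K]_d) :
  vec (\sum_(i <- r) F i) = \sum_(i <- r) vec (F i).
Proof.
elim: r => [|i r IH]; last by rewrite !big_cons vecD IH.
by rewrite !big_nil /vec big1 // => j _; rewrite mxE scale0r.
Qed.

Lemma lfun_mx_comp u u' : lfun_mx (u \o u')%VF = lfun_mx u' * lfun_mx u.
Proof. by apply: lfun_mxP => m; rewrite comp_lfunE !lfun_vec mulmxA. Qed.

Lemma lfun_mx1 : lfun_mx \1%VF = 1.
Proof. by apply: lfun_mxP => m; rewrite id_lfunE mulmx1. Qed.

Lemma lfun_mxD u u' : lfun_mx (u + u') = lfun_mx u + lfun_mx u'.
Proof. by apply: lfun_mxP => m; rewrite add_lfunE !lfun_vec mulmxDr vecD. Qed.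

Lemma lfun_mxZ c u : lfun_mx (c *: u) = c *: lfun_mx u.
Proof. by apply: lfun_mxP => m; rewrite scale_lfunE lfun_vec -scalemxAr vecZ. Qed.

Lemma lfun_mxN u : lfun_mx (- u) = - lfun_mx u.
Proof. by rewrite -scaleN1r lfun_mxZ scaleN1r. Qed.

Lemma lfun_mxB u u' : lfun_mx (u - u') = lfun_mx u - lfun_mx u'.
Proof. by rewrite lfun_mxD lfun_mxN. Qed.

Lemma lfun_mx0 : lfun_mx 0 = 0.
Proof. by rewrite -(scale0r (0 : 'End(V))) lfun_mxZ scale0r. Qed.

Lemma int_mxP u N : int_mx e u N <-> lfun_mx u = imx K N.
Proof.
have E i : \sum_j tnth e j *~ N i j = \sum_j imx K N i j *: tnth e j.
  by apply: eq_bigr => j _; rewrite mxE -scaler_int.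
split=> [h|h i]; last by rewrite E -h lfun_mxE.
apply/matrixP => i j; have := h i; rewrite E => hi.
by rewrite mxE hi coord_sum.
Qed.

Lemma lfun_mx_power u n : lfun_mx (power u n) = lfun_mx u ^+ n.
Proof.
elim: n => [|n IH]; first exact: lfun_mx1.
by rewrite /power iterS lfun_mx_comp -/(power _ _) IH exprSr.
Qed.

Definition rmx (x : g) : 'M[K]_d := lfun_mx (rho V x).

Lemma rhoD x y : rho V (x + y) = rho V x + rho V y.
Proof. by have := rho_lin V 1 x y; rewrite !scale1r. Qed.

Lemma rho0 : rho V 0 = 0.
Proof.
by have := rho_lin V (-1) 0 0; rewrite scaler0 addr0 scaleN1r addNr.
Qed.

Lemma rhoZ c x : rho V (c *: x) = c *: rho V x.
Proof. by have := rho_lin V c x 0; rewrite !addr0 rho0 addr0. Qed.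

Lemma rmxD x y : rmx (x + y) = rmx x + rmx y.
Proof. by rewrite /rmx rhoD lfun_mxD. Qed.

Lemma rmxZ c x : rmx (c *: x) = c *: rmx x.
Proof. by rewrite /rmx rhoZ lfun_mxZ. Qed.

Lemma rmx0 : rmx 0 = 0.
Proof. by rewrite /rmx rho0 lfun_mx0. Qed.

Lemma rmxN x : rmx (- x) = - rmx x.
Proof. by rewrite -scaleN1r rmxZ scaleN1r. Qed.

Lemma rmx_sum (I : Type) (r : seq I) (F : I -> g) :
  rmx (\sum_(i <- r) F i) = \sum_(i <- r) rmx (F i).
Proof. by elim/big_rec2: _ => [|i x y _ <-]; rewrite ?rmx0 ?rmxD. Qed.

(** Matrices act on rows from the right, so [rmx] reverses products and the leading term is the one
    with y first. *)
Lemma rmx_br i j x y : x \in part g i -> y \in part g j ->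
  rmx (br x y) = rmx y * rmx x - (-1) ^+ (i && j) *: (rmx x * rmx y).
Proof.
move=> hx hy; rewrite /rmx -!lfun_mx_comp -lfun_mxZ -lfun_mxB; congr lfun_mx.
apply/lfunP => v; rewrite (rho_br v hx hy) add_lfunE opp_lfunE scale_lfunE.
by rewrite !comp_lfunE.
Qed.

Lemma faithful_rmx_inj : faithful V -> forall x, rmx x = 0 -> x = 0.
Proof.
move=> V_faithful x; rewrite -lfun_mx0 => /lfun_mx_inj; exact: V_faithful.
Qed.

Variable p : 'I_d -> bool.
Hypothesis e_part : forall i, tnth e i \in mpart V (p i).

(** The part of v carried by basis vectors of the other parity lies in both homogeneous components,
    hence is zero. *)
Lemma mpart_coord b v j : v \in mpart V b -> p j != b -> coord e j v = 0.
Proof.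
move=> hv nj.
pose w := \sum_(i | p i != b) coord e i v *: tnth e i.
have hw : w \in mpart V (~~ b).
  apply: memv_suml => i ni; apply: memvZ.
  by have := e_part i; move: ni; case: (p i); case: b {hv nj w}.
have hw' : w \in mpart V b.
  have -> : w = v - \sum_(i | p i == b) coord e i v *: tnth e i.
    by rewrite [v in v - _]coordE (bigID (fun i => p i == b)) /= [X in X - _]addrC addrK.
  apply: memvB => //; apply: memv_suml => i /eqP <-; exact: memvZ.
have w0 : w = 0.
  apply/eqP; rewrite -memv0 -(mpart_cap V) memv_cap.
  by move: hw hw'; case: (b) => /= -> ->.
have := coord_sum (fun i => if p i != b then coord e i v else 0) j.
rewrite nj => <-; rewrite -[RHS](linear0 (coord e j)); congr (coord e j _).
rewrite -[RHS]w0 /w [RHS]big_mkcond /=; apply: eq_bigr => i _.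
by case: ifP; rewrite ?scale0r.
Qed.

Lemma rmx_part i x a b : x \in part g i -> p a (+) p b != i -> rmx x a b = 0.
Proof.
move=> hx ne; rewrite mxE; apply: (@mpart_coord (i (+) p a)).
  exact: rho_part.
by apply: contraNneq ne => ->; rewrite addbCA addbb addbF.
Qed.

Lemma rmx_block_diag x : x \in part g false -> block_diag p (rmx x).
Proof. by move=> hx i j ne; apply: (rmx_part hx); rewrite addbC; case: (p i) (p j) ne => [] []. Qed.

End ModuleMatrices.

(** Finite choice along a list, by recursion and hence without an axiom; b0 is the value off the
    list. *)
Lemma seq_choice (I : eqType) (B : Type) (b0 : B) (s : seq I) (Q : I -> B -> Prop) :
  (forall a, a \in s -> exists b, Q a b) -> exists f, forall a, a \in s -> Q a (f a).
Proof.
elim: s => [|a s IH] h; first by exists (fun=> b0).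
have [f hf] := IH (fun a sa => h a (mem_behead (s := _ :: _) sa)).
have [b hb] := h a (mem_head _ _).
exists (fun x => if x == a then b else f x) => x; rewrite inE.
by case: eqP => [->|_] //= /hf.
Qed.

(** * Weight bases of V and integrality of the Kostant form *)

Section WeightBasis.
Variables (K : fieldType) (char_K : [pchar K] =i pred0).
Variables (g : lieSuperalg K) (c : chevData g) (V : lieSupermod g).
Variables (d : nat) (e : d.-tuple V) (p : 'I_d -> bool).
Local Notation h := (cd_h c).
Local Notation H := (cd_H c).
Local Notation l := (\dim h).
Hypothesis h_even : (h <= part g false)%VS.
Hypothesis H_basis : basis_of h H.
Hypothesis V_rational : rational c V.
Hypothesis M_admissible : admissible c e p.

Let e_basis : basis_of fullv e. Proof. by case: M_admissible. Qed.
Let e_part i : tnth e i \in mpart V (p i). Proof. by case: M_admissible. Qed.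
Local Notation rm := (rmx e).

Lemma H_in i : tnth H i \in h.
Proof. by apply: (basis_mem H_basis); apply: mem_tnth. Qed.

Lemma evD (mu : hdual h) x y : x \in h -> y \in h -> ev mu (x + y) = ev mu x + ev mu y.
Proof. by move=> hx hy; rewrite /ev linearD /= linearD. Qed.

Lemma evZ (mu : hdual h) a x : ev mu (a *: x) = a * ev mu x.
Proof. by rewrite /ev linearZ /= linearZ. Qed.

Lemma ev_sum (mu : hdual h) n (F : 'I_n -> g) : ev mu (\sum_i F i) = \sum_i ev mu (F i).
Proof. by rewrite /ev linear_sum /= linear_sum. Qed.

Lemma h_coord x : x \in h -> x = \sum_i coord H i x *: tnth H i.
Proof.
move=> hx; rewrite {1}(coord_basis H_basis hx).
by apply: eq_bigr => i _; rewrite (tnth_nth 0).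
Qed.

Lemma ev_coord (mu : hdual h) x : x \in h ->
  ev mu x = \sum_i coord H i x * ev mu (tnth H i).
Proof.
by move=> hx; rewrite {1}(h_coord hx) ev_sum; apply: eq_bigr => i _; rewrite evZ.
Qed.

Lemma kostant_int u : kostant c u -> exists N : 'M[int]_d, lfun_mx e u = imx K N.
Proof.
move=> hu; have [_ _ stab] := M_admissible.
have /fin_all_exists[N hN] : forall i, exists a : int ^ d, u (tnth e i) = \sum_(j < d) e`_j *~ a j.
  move=> i; apply: stab => //; exists [ffun j => (j == i)%:R].
  rewrite (bigD1 i) //= ffunE eqxx mulr1z big1 ?addr0 ?(tnth_nth 0) // => j ji.
  by rewrite ffunE (negbTE ji).
exists (\matrix_(i, j) N i j); apply/int_mxP => // i; rewrite hN.
by apply: eq_bigr => j _; rewrite mxE (tnth_nth 0).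
Qed.

(** The weight components of all the e_i together span V, so their coordinate rows form a matrix of
    full rank, and d independent rows are extracted from it. *)
Lemma weight_basis_exists : exists (P : 'M[K]_d) (mu : 'I_d -> hdual h) (z : 'I_d -> 'I_l -> int),
  [/\ P \in unitmx, forall j, in_weight (mu j) (vec e (row j P)) &
      forall j i, ev (mu j) (tnth H i) = (z j i)%:~R].
Proof.
have [dec int_wt] := V_rational.
have /fin_all_exists[ws hws] := fun i => dec (tnth e i).
pose W := flatten [seq ws i | i <- enum 'I_d].
pose M := \matrix_(k < size W, j < d) coord e j (nth 0 W k).
have M_full : row_full M.
  rewrite -sub1mx; apply/row_subP => i.
  have -> : row i (1%:M : 'M[K]_d) = \sum_(w <- ws i) \row_j coord e j w.
    apply: (vec_inj e_basis); rewrite vec_sum.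
    under eq_bigr do rewrite vec_coord //.
    rewrite -(hws i).1 -(vec_coord e_basis (tnth e i)); congr vec.
    apply/rowP => j; rewrite !mxE -[LHS](coord_sum e_basis (fun j => (i == j)%:R)).
    congr (coord e j _); rewrite (bigD1 i) //= eqxx scale1r big1 ?addr0 // => a.
    by rewrite eq_sym => /negbTE->; rewrite scale0r.
  rewrite big_seq; apply: summx_sub => w hw.
  have Ww : w \in W by apply/flattenP; exists (ws i) => //; apply: map_f; rewrite mem_enum.
  have ltW : (index w W < size W)%N by rewrite index_mem.
  rewrite (_ : \row_j _ = row (Ordinal ltW) M) ?row_sub //.
  by apply/rowP => j; rewrite !mxE /= nth_index.
pose P := rowsub (fullrankfun M_full) M.
have P_unit : P \in unitmx by apply: fullrowsub_unit.
have /fin_all_exists[mu hmu] : forall j, exists mu : hdual h, in_weight mu (vec e (row j P)).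
  move=> j; have /flattenP[r /mapP[i _ ->] hr] : nth 0 W (fullrankfun M_full j) \in W by apply: mem_nth.
  have [mu hmu] := (hws i).2 _ hr; exists mu.
  rewrite (_ : row j P = \row_j' coord e j' (nth 0 W (fullrankfun M_full j))) ?vec_coord //.
  by apply/rowP => j'; rewrite !mxE.
have /fin_all_exists[z hz] : forall j, exists z : 'I_l -> int,
    forall i, ev (mu j) (tnth H i) = (z i)%:~R.
  move=> j; have nz : vec e (row j P) != 0; last first.
    have /fin_all_exists[f hf] := int_wt _ _ nz (hmu j); by exists f.
  apply/eqP => v0; have : row j P = 0.
    apply: (vec_inj e_basis); rewrite v0 /vec big1 // => i _.
    by rewrite mxE scale0r.
  rewrite rowE => /(congr1 (mulmx^~ (invmx P))); rewrite mulmxK // mul0mx.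
  by move/rowP/(_ j)/eqP; rewrite !mxE !eqxx oner_eq0.
by exists P, mu, z.
Qed.

Variables (P : 'M[K]_d) (mu : 'I_d -> hdual h) (z : 'I_d -> 'I_l -> int).
Hypothesis P_unit : P \in unitmx.
Hypothesis P_weight : forall j, in_weight (mu j) (vec e (row j P)).
Hypothesis mu_int : forall j i, ev (mu j) (tnth H i) = (z j i)%:~R.

Lemma rmx_diag x : x \in h -> rm x = diag_op P (fun j => ev (mu j) x).
Proof.
move=> hx; rewrite /diag_op -mulmxA.
suff <- : P *m rm x = diag_mx (\row_j ev (mu j) x) *m P by rewrite mulKmx.
apply/row_matrixP => j; apply: (vec_inj e_basis).
rewrite row_mul -(lfun_vec e_basis) P_weight // -vecZ; congr vec.
by rewrite row_mul row_diag_mx -scalemxAl -rowE mxE.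
Qed.

Lemma T_exists : exists T : 'I_l -> 'M[int]_d, forall i, imx K (T i) = rm (tnth H i).
Proof.
suff /fin_all_exists[T hT] : forall i, exists N : 'M[int]_d, imx K N = rm (tnth H i) by exists T.
move=> i; have [N hN] := kostant_int (kostant_H V i 1); exists N; rewrite -hN; congr lfun_mx; rewrite /div_binom /= invr1 scale1r scale0r subr0.
by rewrite comp_lfun1r.
Qed.

Lemma binom_exists i n : exists2 B : 'M[int]_d, block_diag p B &
  imx K B = diag_op P (fun j => bin_poly (z j i)%:~R n).
Proof.
have [N hN] := kostant_int (kostant_H V i n).
set u := rho V (tnth H i) in hN.
have hu : lfun_mx e u = diag_op P (fun j => (z j i)%:~R).
  rewrite -[LHS]/(rm _) rmx_diag ?H_in //; apply: eq_diag_op => j; exact: mu_int.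
have bu : block_diag p (lfun_mx e u).
  apply: (rmx_block_diag e_basis e_part); exact: (subvP h_even _ (H_in i)).
have bs a (M : 'M[K]_d) : block_diag p M -> block_diag p (a *: M).
  by move=> hM j j' ne; rewrite mxE hM // mulr0.
have E (r : seq nat) : 
    lfun_mx e (foldr (@comp_lfun K V V V) \1%VF [seq u - j%:R *: \1%VF | j <- r]) =
    diag_op P (fun j => \prod_(i0 <- r) ((z j i)%:~R - i0%:R)) /\
    block_diag p (lfun_mx e (foldr (@comp_lfun K V V V) \1%VF [seq u - j%:R *: \1%VF | j <- r])).
  elim: r => [|a r [IH1 IH2]] /=.
    rewrite lfun_mx1 //; split; last exact: block_diag1.
    by rewrite -(diag_op1 P_unit); apply: eq_diag_op => j; rewrite big_nil.
  rewrite lfun_mx_comp // lfun_mxB // lfun_mxZ // lfun_mx1 //; split.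
    rewrite IH1 hu -(diag_op1 P_unit).
    have -> : a%:R *: diag_op P (fun=> 1) = diag_op P (fun=> a%:R).
      rewrite /diag_op scalemxAl scalemxAr; congr (_ *m _ *m _).
      by apply/matrixP => j j'; rewrite !mxE mulrnAr mulr1.
    rewrite diag_opB // diag_opM //; apply: eq_diag_op => j.
    by rewrite big_cons mulrC.
  apply: block_diagM => //; apply: block_diagB => //; apply: bs.
  exact: block_diag1.
have [E1 E2] := E (iota 0 n).
have eN : imx K N = diag_op P (fun j => bin_poly (z j i)%:~R n).
  rewrite -hN /div_binom lfun_mxZ // E1 /diag_op scalemxAl scalemxAr; congr (_ *m _ *m _).
  by apply/matrixP => j j'; rewrite !mxE mulrnAr.
exists N => // j j' ne; apply: (intK_inj char_K).
have := congr1 (fun M : 'M[K]_d => M j j') hN; rewrite [X in _ = X]mxE => <-.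
by rewrite /div_binom lfun_mxZ // mxE E2 // mulr0.
Qed.

End WeightBasis.

(** * Roots and Chevalley bases *)

Section Brackets.
Variables (K : fieldType) (g : lieSuperalg K).
Implicit Types x y : g.

Lemma brDl x x' y : br (x + x') y = br x y + br x' y.
Proof. by have := br_linl y 1 x x'; rewrite !scale1r. Qed.

Lemma brDr x y y' : br x (y + y') = br x y + br x y'.
Proof. by have := br_linr x 1 y y'; rewrite !scale1r. Qed.

Lemma br0l y : br (0 : g) y = 0.
Proof. by have := br_linl y (-1) 0 0; rewrite scaler0 addr0 scaleN1r addNr. Qed.

Lemma br0r x : br x (0 : g) = 0.
Proof. by have := br_linr x (-1) 0 0; rewrite scaler0 addr0 scaleN1r addNr. Qed.

Lemma brZl a x y : br (a *: x) y = a *: br x y.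
Proof. by have := br_linl y a x 0; rewrite !addr0 br0l addr0. Qed.

Lemma brZr a x y : br x (a *: y) = a *: br x y.
Proof. by have := br_linr x a y 0; rewrite !addr0 br0r addr0. Qed.

Lemma br_suml (I : Type) (r : seq I) (F : I -> g) y :
  br (\sum_(i <- r) F i) y = \sum_(i <- r) br (F i) y.
Proof. by elim/big_rec2: _ => [|i u v _ <-]; rewrite ?br0l ?brDl. Qed.

Lemma br_sumr (I : Type) (r : seq I) (F : I -> g) x :
  br x (\sum_(i <- r) F i) = \sum_(i <- r) br x (F i).
Proof. by elim/big_rec2: _ => [|i u v _ <-]; rewrite ?br0r ?brDr. Qed.

Lemma br_even_anti i x y : x \in part g false -> y \in part g i -> br x y = - br y x.
Proof. by move=> hx hy; rewrite (br_anti hx hy) expr0 scale1r. Qed.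

Lemma part_disjoint i x : x \in part g i -> x \in part g (~~ i) -> x = 0.
Proof.
move=> h1 h2; apply/eqP; rewrite -memv0 -(part_cap g) memv_cap.
by move: h1 h2; case: i => /= -> ->.
Qed.

Lemma part_split x : exists x0 x1, [/\ x0 \in part g false, x1 \in part g true & x = x0 + x1].
Proof.
have := memvf x; rewrite -(part_sum g) => /memv_addP[x0 h0 [x1 h1 ->]].
by exists x0, x1.
Qed.
End Brackets.

Section RootBasis.
Variables (K : fieldType) (char_K : [pchar K] =i pred0).
Variables (g : lieSuperalg K) (c : chevData g).
Hypothesis c_ok : chev_ok c.
Local Notation h := (cd_h c).
Local Notation H := (cd_H c).
Local Notation X := (cd_X c).
Local Notation Hc := (cd_coroot c).
Local Notation L := (lat (cd_h c) (cd_kind c)).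
Local Notation roots_c := (Defs.roots c).
Implicit Types a b : L.

Lemma cd_h_even : (h <= part g false)%VS.
Proof. by case: c_ok => -[]. Qed.

Lemma cd_H_basis : basis_of h H.
Proof. by case: c_ok => _ _ _ _ [_ [_ []]]. Qed.

Lemma cd_basis : basis_of fullv (H ++ [seq X a | a <- roots_c]).
Proof. by case: c_ok => _ _ _ _ [_ [[]]]. Qed.

Lemma H_even i : tnth H i \in part g false.
Proof. exact: (subvP cd_h_even _ (H_in cd_H_basis i)). Qed.

Lemma h_even_in x : x \in h -> x \in part g false.
Proof. exact: (subvP cd_h_even). Qed.

Lemma X_homogeneous a : a \in roots_c -> exists i, X a \in part g i.
Proof. by case: c_ok => _ _ _ _ [_ [[_ hX]]] _ _ _ _; apply: hX. Qed.

Lemma X_neq0 a : a \in roots_c -> X a != 0.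
Proof.
move=> ra; apply: (free_not0 (basis_free cd_basis)).
by rewrite mem_cat map_f ?orbT.
Qed.

Lemma wtD a x y : x \in h -> y \in h -> wt a (x + y) = wt a x + wt a y.
Proof.
rewrite /wt; move: a; case: (cd_kind c) => [B|n f] a hx hy; first exact: evD.
rewrite -big_split; apply: eq_bigr => i _.
by rewrite linearD /= mxE mulrDr.
Qed.

Lemma wtZ a k x : wt a (k *: x) = k * wt a x.
Proof.
rewrite /wt; move: a; case: (cd_kind c) => [B|n f] a; first exact: evZ.
rewrite mulr_sumr; apply: eq_bigr => i _.
by rewrite linearZ /= mxE mulrCA.
Qed.

Lemma wt0 a : wt a 0 = 0.
Proof. by rewrite -(scale0r (0 : g)) wtZ mul0r. Qed.

Lemma wt_sum a n (F : 'I_n -> g) : (forall i, F i \in h) ->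
  wt a (\sum_i F i) = \sum_i wt a (F i).
Proof.
move=> hF; suff [] : (\sum_i F i \in h) /\ wt a (\sum_i F i) = \sum_i wt a (F i) by [].
elim/big_rec2: _ => [|i x y _ [h1 <-]]; first by rewrite mem0v wt0.
by rewrite wtD // memvD.
Qed.

Lemma wt_coord a x : x \in h -> wt a x = \sum_i coord H i x * wt a (tnth H i).
Proof.
move=> hx; rewrite {1}(h_coord cd_H_basis hx) wt_sum => [|i].
  by apply: eq_bigr => i _; rewrite wtZ.
by apply: memvZ; apply: (H_in cd_H_basis).
Qed.

Lemma wt_addl a b x : wt (a + b) x = wt a x + wt b x.
Proof.
rewrite /wt; move: a b; case: (cd_kind c) => [B|n f] a b; first by rewrite /ev add_lfunE.
rewrite -big_split; apply: eq_bigr => i _.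
by rewrite mxE rmorphD /= mulrDl.
Qed.

Lemma wt_zero x : wt (0 : L) x = 0.
Proof.
by apply: (@addrI _ (wt (0 : L) x)); rewrite -wt_addl !addr0.
Qed.

Lemma wt_oppl a x : wt (- a) x = - wt a x.
Proof. by apply: (@addrI _ (wt a x)); rewrite -wt_addl !subrr wt_zero. Qed.

Lemma br_h_X a x : a \in roots_c -> x \in h -> br x (X a) = wt a x *: X a.
Proof.
move=> ra hx; have [_ _ _ _ [_ [_ _ [_ hX] _ _]]] := c_ok.
rewrite (wt_coord a hx) {1}(h_coord cd_H_basis hx) br_suml scaler_suml.
by apply: eq_bigr => i _; rewrite brZl hX // scalerA.
Qed.

Lemma br_h_h x y : x \in h -> y \in h -> br x y = 0.
Proof.
move=> hx hy; have [_ _ _ _ [_ [_ _ [hH _] _ _]]] := c_ok.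
rewrite (h_coord cd_H_basis hx) (h_coord cd_H_basis hy) br_suml big1 // => i _.
by rewrite br_sumr big1 // => j _; rewrite brZl brZr hH !scaler0.
Qed.

(** The last clause says that a weight vector only involves basis elements of the same weight; it
    follows by comparing the coordinates of [z, x] and w(z) x. *)
Lemma expand x : exists (y : g) (k : L -> K), [/\ y \in h,
  x = y + \sum_(a <- roots_c) k a *: X a &
  forall w : g -> K, (forall z, z \in h -> br z x = w z *: x) ->
    (y != 0 -> forall z, z \in h -> w z = 0) /\
    (forall a, a \in roots_c -> k a != 0 -> forall z, z \in h -> w z = wt a z)].
Proof.
pose r := roots_c.
have := memvf x; rewrite -(span_basis cd_basis) span_cat => /memv_addP[y].
rewrite (span_basis cd_H_basis) => hy [y' hy' ex].
have ur : uniq r by apply: undup_uniq.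
have comb (r' : seq L) v : uniq r' -> v \in <<[seq X a | a <- r']>>%VS ->
    exists k : L -> K, v = \sum_(a <- r') k a *: X a.
  elim: r' v => [|a r' IH] v /=.
    by rewrite span_nil memv0 => _ /eqP->; exists (fun=> 0); rewrite big_nil.
  case/andP=> nar ur'; rewrite span_cons => /memv_addP[_ /vlineP[k0 ->] [v' hv' ->]].
  have [k ->] := IH v' ur' hv'.
  exists (fun b => if b == a then k0 else k b); rewrite big_cons eqxx; congr (_ + _).
  rewrite !big_seq; apply: eq_bigr => b br'.
  by case: eqP br' nar => // -> ->.
have [k ek] := comb r y' ur hy'.
exists y, k; split=> //; first by rewrite ex ek.
have free_r : forall y0 (k0 : L -> K), y0 \in h -> y0 + \sum_(a <- r) k0 a *: X a = 0 ->
    y0 = 0 /\ forall a, a \in r -> k0 a = 0.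
  move=> y0 k0 hy0 e0; have := basis_free cd_basis.
  rewrite cat_free => /and3P[_ fX dH].
  have sum_in : \sum_(a <- r) k0 a *: X a \in <<[seq X a | a <- r]>>%VS.
    rewrite big_seq; apply: memv_suml => a ra; apply: memvZ; apply: memv_span.
    exact: map_f.
  have y00 : y0 = 0.
    apply/eqP; rewrite -memv0 -(directv_addP dH) memv_cap (span_basis cd_H_basis) hy0 /=.
    by rewrite (_ : y0 = - \sum_(a <- r) k0 a *: X a) ?rpredN //; apply/eqP; rewrite -addr_eq0 e0.
  split=> // a ra; move: e0; rewrite y00 add0r => e0.
  have ltr : (index a r < size r)%N by rewrite index_mem.
  pose t := in_tuple [seq X a | a <- r].
  have sz : size [seq X a | a <- r] = size r by rewrite size_map.
  have := (freeP (X := t)) fX (fun i => k0 (nth 0 r i)).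
  have -> : \sum_(i < size [seq X a | a <- r]) k0 (nth 0 r i) *: t`_i = 0.
    rewrite -(big_mkord xpredT (fun i => k0 (nth 0 r i) *: nth 0 [seq X a | a <- r] i)).
    rewrite sz -[RHS]e0 [RHS](big_nth 0); apply: eq_big_nat => i /andP[_ lti].
    by rewrite (nth_map 0).
  move=> /(_ erefl); have lts : (index a r < size [seq X a | a <- r])%N by rewrite sz.
  by move=> /(_ (Ordinal lts)); rewrite /= nth_index.
move=> w hw.
have key z : z \in h -> (w z) *: y = 0 /\ forall a, a \in r -> w z * k a - wt a z * k a = 0.
  move=> hz; have := hw z hz; rewrite {1}ex ek brDr (br_h_h hz hy) add0r br_sumr.
  rewrite ex ek scalerDr => e1.
  apply: (free_r _ (fun a => w z * k a - wt a z * k a)); first exact: memvZ.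
  have -> : \sum_(a <- r) (w z * k a - wt a z * k a) *: X a =
     w z *: (\sum_(a <- r) k a *: X a) - \sum_(a <- r) br z (k a *: X a).
    rewrite scaler_sumr -sumrB !big_seq; apply: eq_bigr => a ra.
    by rewrite scalerBl scalerA brZr br_h_X // !scalerA [k a * _]mulrC.
  by rewrite addrA -e1 subrr.
split=> [ny z hz|a ra nk z hz].
  have [/eqP] := key z hz; rewrite scaler_eq0 (negbTE ny) orbF => /eqP //.
have [_ /(_ a ra) /eqP] := key z hz.
by rewrite -mulrBl mulf_eq0 (negbTE nk) orbF subr_eq0 => /eqP.
Qed.

Lemma coroot_int a : a \in roots_c -> - a \in roots_c ->
  exists z : 'I_(\dim h) -> int, Hc a = \sum_i tnth H i *~ z i.
Proof.
move=> ra rna; have [_ _ _ _ [_ [_ [_ hH] _ _ _]]] := c_ok.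
have [z hz] : inIntSpan H (Hc a).
  apply/hH; have sa : a \in [seq a <- roots_c | - a \in roots_c] by rewrite mem_filter rna.
  have lt : (index a [seq a <- roots_c | - a \in roots_c] <
     size [seq Hc a | a <- [seq a <- roots_c | - a \in roots_c]])%N by rewrite size_map index_mem.
  exists [ffun j => (j == Ordinal lt)%:R]; rewrite (bigD1 (Ordinal lt)) //= ffunE eqxx mulr1z.
  rewrite (nth_map 0) ?index_mem // nth_index // big1 ?addr0 // => j nj.
  by rewrite ffunE (negbTE nj).
by exists z; rewrite hz; apply: eq_bigr => i _; rewrite (tnth_nth 0).
Qed.

Lemma coroot_in a : a \in roots_c -> - a \in roots_c -> Hc a \in h.
Proof.
move=> ra rna; have [z ->] := coroot_int ra rna; apply: memv_suml => i _.
by rewrite -scaler_int; apply: memvZ; apply: (H_in cd_H_basis).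
Qed.

End RootBasis.

Definition is_P (K : fieldType) (g : lieSuperalg K) (c : chevData g) : bool :=
  if cd_kind c is TypeP _ _ then true else false.

(** * Roots in the presence of an invariant form: all types except P(n) *)

Section NotP.
Variables (K : fieldType) (char_K : [pchar K] =i pred0).
Variables (g : lieSuperalg K) (c : chevData g).
Hypothesis c_ok : chev_ok c.
Hypothesis notP : ~~ is_P c.
Local Notation h := (cd_h c).
Local Notation H := (cd_H c).
Local Notation X := (cd_X c).
Local Notation Hc := (cd_coroot c).
Local Notation L := (lat (cd_h c) (cd_kind c)).
Local Notation roots_c := (Defs.roots c).
Implicit Types a b : L.

(** The type of roots depends on [cd_kind c], so the record is destructed to reach the form. This
    lemma and its neighbours export what is seen there. *)
Lemma notP_form : exists B, inv_form B /\
  forall a, isotropic a <-> exists t, [/\ t \in h, forall x, x \in h -> B t x = wt a x & wt a t = 0].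
Proof.
move: c_ok notP; case: c => h0 [B|n f] rt m si co cr H0 X0 //=.
by move=> [_ [_ hB] _ _ _] _; exists B; split.
Qed.

Lemma notP_wt_inj a b : (forall x, x \in h -> wt a x = wt b x) -> a = b.
Proof.
move: notP a b; clear c_ok; case: c => h0 [B|n f] rt m si co cr H0 X0 //= _ a b e.
apply/lfunP => v; have := e (vsval v) (subvsP v).
by rewrite /ev vsvalK.
Qed.

Lemma notP_root i a : a \in cd_root c i ->
  exists x, [/\ x != 0, x \in part g i & forall y, y \in h -> br y x = wt a y *: x].
Proof.
move: c_ok notP a; case: c => h0 [B|n f] rt m si co cr H0 X0 //=.
move=> [_ _ hr _ _] _ a /(hr i).2 /= [_ [x [h1 h2 h3]]].
by exists x.
Qed.

Lemma notP_coroot a : a \in roots_c ->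
  [/\ ~ isotropic a -> wt a (Hc a) = 2,
      isotropic a -> inIntSpan (in_tuple [seq wt b (Hc a) | b <- roots_c]) (1 : K),
      isotropic a -> forall x : K, inIntSpan (in_tuple [seq wt b (Hc a) | b <- roots_c]) x ->
        exists z : int, x = z%:~R
    & Hc (- a) = - Hc a].
Proof.
move: c_ok notP a; case: c => h0 [B|n f] rt m si co cr H0 X0 //=.
move=> [_ _ _ _ [hc _]] _ a ra; have [h1 h2 h3 h4] := hc a ra; split=> // iso.
  by apply/(h3 iso); exists 1; rewrite mulr1z.
by move=> x hx; apply/(h3 iso).
Qed.

Lemma notP_special a b : ~ special_pair a b.
Proof. by move: notP a b; clear c_ok; case: c => h0 [B|n f] rt m si co cr H0 X0 //= _ a b []. Qed.

Let two_neq0 : (2 : K) != 0. Proof. by rewrite natK_eq0. Qed.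

(** The definition of odd roots does not exclude 0. If 0 were a root, its coroot would be its own
    opposite, hence zero; but 0 is isotropic, and the zero values of the roots on that coroot would
    have to generate 1. *)
Lemma notP_root0 a : a \in roots_c -> a != 0.
Proof.
move=> ra; apply/eqP => a0; rewrite {}a0 in ra.
have [_ h1 _ h2] := notP_coroot ra.
have H00 : Hc 0 = 0.
  apply/eqP; have /eqP := h2; rewrite oppr0 -addr_eq0 -mulr2n -scaler_nat scaler_eq0.
  by rewrite (negbTE two_neq0).
have iso0 : isotropic (0 : L).
  have [B [[[hB _] _ _ _ _] hi]] := notP_form; apply/hi.
  exists 0; split; [exact: mem0v | | exact: wt_zero].
  move=> x _; rewrite wt_zero; have := hB x (-1) 0 0.
  by rewrite scaler0 addr0 /= mulN1r addNr.
have gen n : (n < size roots_c)%N -> [seq wt b (Hc 0) | b <- roots_c]`_n = 0.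
  by move=> lt; rewrite (nth_map 0) // H00 wt0.
have [z] := h1 iso0; rewrite big1 => [/eqP|i _]; first by rewrite oner_eq0.
rewrite /= gen ?mul0rz // -(size_map (fun b => wt b (Hc 0))).
exact: ltn_ord.
Qed.

Lemma notP_wt_neq0 a : a != 0 -> exists2 x, x \in h & wt a x != 0.
Proof.
move=> na; have [x hx nx] : exists2 x, x \in vbasis h & wt a x != 0.
  apply/hasP; apply: contraNT na => /hasPn hb; apply/eqP; apply: notP_wt_inj => x hx.
  rewrite (coord_vbasis hx) wt_sum => [|i]; last first.
    by apply: memvZ; apply: vbasis_mem; apply: mem_nth; rewrite size_tuple.
  rewrite wt_zero big1 // => i _; rewrite wtZ.
  have := hb (vbasis h)`_i; rewrite mem_nth ?size_tuple // negbK => /(_ isT)/eqP->.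
  by rewrite mulr0.
by exists x => //; apply: vbasis_mem.
Qed.

Lemma mem_roots a : (a \in roots_c) = (a \in cd_root c false) || (a \in cd_root c true).
Proof. by rewrite mem_undup mem_cat. Qed.

Lemma cd_rootW i a : a \in cd_root c i -> a \in roots_c.
Proof. by rewrite mem_roots; case: i => ->; rewrite ?orbT. Qed.

(** Some vector of parity i has weight a by definition of the roots; since h separates the roots,
    its expansion reduces to a multiple of X a. *)
Lemma notP_X_part i a : a \in cd_root c i -> X a \in part g i.
Proof.
move=> ra; have rra := cd_rootW ra.
have [x [nx px hx]] := notP_root ra.
have [y [k [hy ex hw]]] := expand c_ok x.
have [wy wk] := hw _ hx.
have y0 : y = 0.
  apply/eqP; apply: contraT => /wy w0.
  by have [z hz] := notP_wt_neq0 (notP_root0 rra); rewrite w0 ?eqxx.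
have k0 b : b \in roots_c -> b != a -> k b = 0.
  move=> rb nba; apply/eqP; apply: contraT => /(wk b rb) e.
  by case/eqP: nba; apply: notP_wt_inj => z hz; rewrite e.
have ex' : x = k a *: X a.
  rewrite ex y0 add0r (bigD1_seq a) ?undup_uniq //= big_seq_cond big1 ?addr0 //.
  by move=> b /andP[rb nb]; rewrite k0 // scale0r.
have nk : k a != 0 by apply: contraNneq nx => k0'; rewrite ex' k0' scale0r.
have -> : X a = (k a)^-1 *: x by rewrite ex' scalerA mulVf // scale1r.
exact: memvZ.
Qed.

(** By invariance X a is orthogonal to all weights other than -a; if -a were not a root, X a would
    lie in the radical of the form. *)
Lemma notP_opp_root a : a \in roots_c -> - a \in roots_c.
Proof.
move=> ra; have [B [[[hBl hBr] hB01 hBs hBi hBn] _]] := notP_form.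
have BDl u v y : B (u + v) y = B u y + B v y by have := hBl y 1 u v; rewrite scale1r mul1r.
have BDr u v y : B y (u + v) = B y u + B y v by have := hBr y 1 u v; rewrite scale1r mul1r.
have B0r y : B y 0 = 0 by have := hBr y (-1) 0 0; rewrite scaler0 addr0 mulN1r addNr.
have B0l y : B 0 y = 0 by have := hBl y (-1) 0 0; rewrite scaler0 addr0 mulN1r addNr.
have BZr k u y : B y (k *: u) = k * B y u by have := hBr y k u 0; rewrite !addr0 B0r addr0.
have BZl k u y : B (k *: u) y = k * B u y by have := hBl y k u 0; rewrite !addr0 B0l addr0.
have Bsum (r : seq L) (F : L -> g) y : B y (\sum_(b <- r) F b) = \sum_(b <- r) B y (F b).
  by elim/big_rec2: _ => [|b u v _ <-]; rewrite ?B0r ?BDr.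
have [i pX] := X_homogeneous c_ok ra.
have inv z y : z \in h -> wt a z * B (X a) y = - B (X a) (br z y).
  move=> hz; rewrite -BZl -(br_h_X c_ok ra hz).
  rewrite (br_even_anti (h_even_in c_ok hz) pX) -[- br _ _]scaleN1r BZl mulN1r.
  by rewrite hBi.
apply: contraT => nr; case/eqP: (X_neq0 c_ok ra); apply: hBn => x.
have [y [k [hy -> _]]] := expand c_ok x.
have [z hz nz] := notP_wt_neq0 (notP_root0 ra).
rewrite BDr Bsum.
have -> : B (X a) y = 0.
  apply: (mulfI nz); rewrite inv // mulr0.
  by rewrite (br_h_h c_ok hz hy) B0r oppr0.
rewrite add0r big_seq big1 // => b rb; rewrite BZr.
have [-> |/eqP/eqP nb] := eqVneq (B (X a) (X b)) 0; first by rewrite mulr0.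
case/negP: nr; have -> : - a = b; last by [].
apply: notP_wt_inj => z' hz'; rewrite wt_oppl; apply: (mulIf nb).
rewrite mulNr inv // opprK (br_h_X c_ok rb hz') BZr.
by [].
Qed.

Lemma isotropic_double a : isotropic (a + a) -> isotropic a.
Proof.
have [B [[[hBl _] _ _ _ _] hi]] := notP_form.
have B0l y : B 0 y = 0 by have := hBl y (-1) 0 0; rewrite scaler0 addr0 /= mulN1r addNr.
have BZl k u y : B (k *: u) y = k * B u y by have := hBl y k u 0; rewrite !addr0 B0l addr0.
move=> /hi[t [ht e0 e1]]; apply/hi; exists (2^-1 *: t); split; first exact: memvZ.
  by move=> x hx; rewrite BZl e0 // wt_addl -mulr2n -[wt a x *+ 2]mulr_natl mulKf.
rewrite wtZ; move/eqP: e1; rewrite wt_addl -mulr2n -[_ *+ 2]mulr_natl mulf_eq0 (negbTE two_neq0).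
by move=> /eqP->; rewrite mulr0.
Qed.

End NotP.

(** * Roots of P(n) *)

(** Here t stands for the difference of the coordinate sums of two weights equal on h. Among the n
    at least 2, only n = 3 makes n + 1 a divisor of 4. *)
Lemma small_multiple (n : nat) (k t : int) : (2 <= n)%N -> n != 3 ->
  t = n.+1%:Z * k -> t = 4 \/ t = -4 \/ (`|t| <= 2)%N -> t = 0.
Proof.
move=> n2 n3 e ht; have nt : (n.+1 %| `|t|)%N by rewrite e abszM dvdn_mulr.
case: (eqVneq t 0) => // t0; have le := dvdn_leq _ nt.
have {}le : (n.+1 <= `|t|)%N by apply: le; rewrite absz_gt0.
have [t4|t2] : `|t|%N = 4 \/ (`|t| <= 2)%N by lia.
  move: nt le; rewrite t4; move: n2 n3; clear; case: n => [|[|[|[|n]]]] //.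
by move: le t2 n2; clear; lia.
Qed.

(** This bound separates parities: coordinate sums of an even and an odd root differ by 2 or -2, and
    n + 1 is at least 3. *)
Lemma small_multiple2 (n : nat) (k t : int) : (2 <= n)%N ->
  t = n.+1%:Z * k -> (`|t| <= 2)%N -> t = 0.
Proof.
move=> n2 e ht; have nt : (n.+1 %| `|t|)%N by rewrite e abszM dvdn_mulr.
case: (eqVneq t 0) => // t0; have le := dvdn_leq _ nt.
have {}le : (n.+1 <= `|t|)%N by apply: le; rewrite absz_gt0.
by move: le ht n2; clear; lia.
Qed.

Section TypePWeights.
Variables (K : fieldType) (char_K : [pchar K] =i pred0).
Variables (g : lieSuperalg K) (h : {vspace g}) (n : nat).
Variable f : 'Hom(g, 'M[K]_(n.+1 + n.+1)).
Hypothesis n_gt1 : (2 <= n)%N.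
Hypothesis f_iso : P_iso f.
Hypothesis f_h : forall x, (x \in h) = is_diag_mx (f x).

Local Notation kd := (TypeP f).
Local Notation diag x k := (f x (lshift n.+1 k) (lshift n.+1 k)).
Implicit Types a b : 'rV[int]_n.+1.
Local Notation wtP a x := (@wt K g h (TypeP f) a x).

(** Weights that agree on h differ by a constant vector, and this sum detects the constant. *)
Definition coord_sum_row a : int := \sum_k a 0 k.
Local Notation rsum := coord_sum_row.

Lemma rsumD a b : rsum (a + b) = rsum a + rsum b.
Proof. by rewrite /rsum -big_split; apply: eq_bigr => k _; rewrite mxE. Qed.

Lemma rsumN a : rsum (- a) = - rsum a.
Proof. by rewrite /rsum -sumrN; apply: eq_bigr => k _; rewrite mxE. Qed.

Lemma rsum_eps i : rsum (@eps n.+1 i) = 1.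
Proof.
rewrite /rsum (bigD1 i) //= mxE !eqxx big1 ?addr0 // => j nj.
by rewrite mxE (negbTE nj) andbF.
Qed.

Lemma rsum_root i a : is_root (h := h) (kd := kd) i a ->
  if i then rsum a = 2 \/ rsum a = -2 else rsum a = 0.
Proof.
case: i => /=.
  case=> [[j [l [_ [->|->]]]]|[j ->]].
  - by left; rewrite rsumD !rsum_eps.
  - by right; rewrite rsumN rsumD !rsum_eps.
  - by left; rewrite mulr2n rsumD !rsum_eps.
by move=> [j [l [_ ->]]]; rewrite rsumD rsumN !rsum_eps.
Qed.

Lemma h_diff i j : i != j -> exists2 x, x \in h & forall k, diag x k = (k == i)%:R - (k == j)%:R.
Proof.
move=> nij; have [_ f_im _ _] := f_iso.
pose A : 'M[K]_n.+1 := delta_mx i i - delta_mx j j.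
have [x ex] : exists x, f x = block_mx A 0 0 (- A^T).
  apply/f_im; exists A, 0, 0; split=> //; rewrite ?trmx0 ?oppr0 //.
  rewrite /A raddfB /= /mxtrace (bigD1 i) //= big1 => [|k /negbTE nk]; last by rewrite mxE nk.
  rewrite (bigD1 j) //= big1 => [|k /negbTE nk]; last by rewrite mxE nk.
  by rewrite !mxE !eqxx !addr0 subrr.
have dA k : A k k = (k == i)%:R - (k == j)%:R by rewrite !mxE !andbb.
exists x => [|k]; last by rewrite ex block_mxEul dA.
rewrite f_h ex; apply/is_diag_mxP => u v.
have offA s t : s != t -> A s t = 0.
  move=> nst; have z q : (s == q) && (t == q) = false.
    by apply: contraNF nst => /andP[/eqP-> /eqP->].
  by rewrite !mxE !z subrr.
case: (split_ordP u) => s ->; case: (split_ordP v) => t -> nst.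
- by rewrite block_mxEul offA //; apply: contraNneq nst => ->.
- by rewrite block_mxEur mxE.
- by rewrite block_mxEdl mxE.
- by rewrite block_mxEdr 2!mxE offA ?oppr0 //; apply: contraNneq nst => ->.
Qed.

Lemma wt_const a b : (forall x, x \in h -> wtP a x = wtP b x) ->
  exists k : int, a = b + const_mx k.
Proof.
move=> e; exists (a 0 0 - b 0 0); apply/rowP => i; rewrite !mxE.
case: (eqVneq i 0) => [->|ni]; first by rewrite addrC subrK.
have [x hx dx] := h_diff ni; have := e x hx.
have wE (q : 'rV[int]_n.+1) : wtP q x = (q 0 i - q 0 0)%:~R.
  rewrite /wt; under eq_bigr do rewrite dx mulrBr.
  rewrite sumrB rmorphB /=; congr (_ - _).
    by rewrite (bigD1 i) //= eqxx mulr1 big1 ?addr0 // => k /negbTE->; rewrite mulr0.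
  by rewrite (bigD1 0) //= mulr1 big1 ?addr0 // => k /negbTE->; rewrite mulr0.
rewrite !wE => /(intK_inj char_K) E.
have lin (s t u v : int) : s - t = u - v -> s = u + (t - v) by lia.
exact: lin.
Qed.

Lemma rsum_const a b k : a = b + const_mx k -> rsum a - rsum b = n.+1%:Z * k.
Proof.
move=> ->; rewrite rsumD addrC addKr /rsum; under eq_bigr do rewrite mxE.
by rewrite sumr_const card_ord -mulr_natl natz.
Qed.

(** A nonzero entry of the matrix of x gives its weight as a difference of two diagonal entries of
    h. The lower diagonal block of h is the opposite of the upper one, so the block of the entry
    decides between differences and signed sums of two eps, and parity decides the block. *)
Lemma weight_vec_sum i a x : x != 0 -> x \in part g i ->
  (forall y, y \in h -> br y x = wtP a y *: x) ->
  exists2 b, forall y, y \in h -> wtP a y = wtP b y &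
    if i then rsum b = 2 \/ rsum b = -2 else rsum b = 0.
Proof.
move=> nx px hx; have [f_ker f_im f_hom f_br] := f_iso.
(* A diagonal matrix has no off-diagonal blocks, and these carry the odd component. *)
have h_even y : y \in h -> y \in part g false.
  move=> hy; have [y0 [y1 [p0 p1 ey]]] := part_split y.
  suff -> : y = y0 by [].
  rewrite ey; suff -> : y1 = 0 by rewrite addr0.
  apply/eqP; rewrite -memv0 -f_ker memv_ker; apply/eqP.
  have [u0 d0] := f_hom true _ p1; have [a1 b0] := f_hom false _ p0.
  move: hy; rewrite f_h ey linearD /= => /is_diag_mxP dg.
  rewrite -[f y1]submxK u0 d0.
  have off s t : (f y0 + f y1) (lshift n.+1 s) (rshift n.+1 t) = 0 /\
    (f y0 + f y1) (rshift n.+1 s) (lshift n.+1 t) = 0.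
    by split; apply: dg; rewrite /= neq_ltn ltn_addr ?ltn_ord ?orbT.
  have -> : ursubmx (f y1) = 0.
    apply/matrixP => s t; have /matrixP/(_ s t) := a1; have := (off s t).1.
    by rewrite !mxE => e1 e2; rewrite e2 add0r in e1.
  have -> : dlsubmx (f y1) = 0.
    apply/matrixP => s t; have /matrixP/(_ s t) := b0; have := (off s t).2.
    by rewrite !mxE => e1 e2; rewrite e2 add0r in e1.
  exact: block_mx0.
have nfx : f x != 0.
  by apply: contra_neq nx => e; apply/eqP; rewrite -memv0 -f_ker memv_ker e.
have [r [s nrs]] : exists r s, f x r s != 0.
  have [/existsP[r /existsP[s hrs]]|] := boolP [exists r, exists s, f x r s != 0].
    by exists r, s.
  rewrite negb_exists => /forallP hn; case/eqP: nfx; apply/matrixP => r s.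
  by have := hn r; rewrite negb_exists => /forallP/(_ s); rewrite negbK mxE => /eqP.
have key y : y \in h -> f y r r - f y s s = wtP a y.
  move=> hy; have := f_br false i y x (h_even y hy) px.
  rewrite hx //; move: (wtP a y) => w; rewrite linearZ /= /mx_sbr /= expr0 scale1r => /matrixP/(_ r s).
  have /is_diag_mxP dg : is_diag_mx (f y) by rewrite -f_h.
  rewrite !mxE (bigD1 r) //= big1 => [|t nt]; last by rewrite dg ?mul0r //; apply: contraNneq nt => /val_inj->.
  rewrite (bigD1 s) //= [X in _ - (_ + X)]big1 => [|t nt]; last by rewrite dg ?mulr0.
  rewrite !addr0 [f x r s * _]mulrC -mulrBl => /(mulIf nrs) e.
  by rewrite e.
have neg_diag y k : y \in h -> f y (rshift n.+1 k) (rshift n.+1 k) = - diag y k.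
  move=> hy; have [|A [B [C [_ _ _ ->]]]] := (f_im (f y)).1; first by exists y.
  by rewrite block_mxEul block_mxEdr !mxE.
have wt_eps y k : wtP (eps k) y = diag y k.
  rewrite /wt (bigD1 k) //= mxE !eqxx mul1r big1 ?addr0 // => j nj.
  by rewrite mxE (negbTE nj) andbF mul0r.
have wtPD b b' y : wtP (b + b') y = wtP b y + wtP b' y.
  by rewrite /wt -big_split; apply: eq_bigr => k _; rewrite mxE rmorphD mulrDl.
have wtPN b y : wtP (- b) y = - wtP b y.
  by rewrite /wt -sumrN; apply: eq_bigr => k _; rewrite mxE rmorphN mulNr.
have := f_hom i x px; move: nrs key.
case: (split_ordP r) => u ->; case: (split_ordP s) => v -> nuv key.
- case: i px => px hom; last exists (eps u - eps v).
  + by case: hom => e _; case/eqP: nuv; have /matrixP/(_ u v) := e; rewrite !mxE.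
  + by move=> y hy; rewrite -key // wtPD wtPN !wt_eps.
  + by rewrite rsumD rsumN !rsum_eps.
- case: i px => px hom; first exists (eps u + eps v).
  + by move=> y hy; rewrite -key // wtPD !wt_eps neg_diag // opprK.
  + by left; rewrite rsumD !rsum_eps.
  + by case: hom => e _; case/eqP: nuv; have /matrixP/(_ u v) := e; rewrite !mxE.
- case: i px => px hom; first exists (- (eps u + eps v)).
  + by move=> y hy; rewrite -key // wtPN wtPD !wt_eps neg_diag // opprD.
  + by right; rewrite rsumN rsumD !rsum_eps.
  + by case: hom => _ e; case/eqP: nuv; have /matrixP/(_ u v) := e; rewrite !mxE.
- case: i px => px hom; last exists (eps v - eps u).
  + by case: hom => _ e; case/eqP: nuv; have /matrixP/(_ u v) := e; rewrite !mxE.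
  + by move=> y hy; rewrite -key // wtPD wtPN !wt_eps !neg_diag // opprK addrC.
  + by rewrite rsumD rsumN !rsum_eps.
Qed.

Lemma P_parity i j a x : x != 0 -> x \in part g i ->
  (forall y, y \in h -> br y x = wtP a y *: x) -> is_root (h := h) (kd := kd) j a -> i = j.
Proof.
move=> nx px hx /rsum_root ra; have [b e sb] := weight_vec_sum nx px hx.
have [k /rsum_const hk] := wt_const e.
case: i j ra sb {px} => [] [] //= ra sb; exfalso.
  by have := small_multiple2 n_gt1 hk; lia.
by have := small_multiple2 n_gt1 hk; lia.
Qed.

Lemma P_wt_sep i a b : n != 3%N -> is_root (h := h) (kd := kd) i a ->
  is_root (h := h) (kd := kd) i b ->
  (forall x, x \in h -> wtP a x = wtP b x) -> a = b.
Proof.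
move=> n3 /rsum_root ra /rsum_root rb /wt_const[k hk]; have e := rsum_const hk.
have z : rsum a - rsum b = 0.
  by apply: (small_multiple n_gt1 n3 e); move: ra rb; clear; case: i; lia.
move: e; rewrite z => /esym/eqP; rewrite mulf_eq0 /= => /eqP k0.
by rewrite hk k0; apply/rowP => j; rewrite !mxE addr0.
Qed.

Lemma P_root_neq0 i a : is_root (h := h) (kd := kd) i a -> a != 0.
Proof.
case: i => ra; apply: contraPneq ra => ->.
  by move/rsum_root; rewrite /rsum big1 => [|k _]; [lia | rewrite mxE].
move=> [j [l [njl /rowP/(_ j)]]]; rewrite !mxE !eqxx (negbTE njl) /=.
by [].
Qed.

Lemma P_wt_neq0 a : is_root (h := h) (kd := kd) false a -> exists2 x, x \in h & wtP a x != 0.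
Proof.
move=> [i [j [nij ->]]]; have [x hx dx] := h_diff nij; exists x => //.
have -> : wtP (eps i - eps j) x = 2%:R; last by rewrite natK_eq0.
rewrite /wt (bigD1 i) //= (bigD1 j) ?(eq_sym j) //= big1 => [|k /andP[ki kj]]; last first.
  by rewrite !mxE !eqxx (negbTE ki) (negbTE kj) /= subrr mul0r.
rewrite !dx !mxE !eqxx (negbTE nij) eq_sym (negbTE nij) /= addr0 subr0 sub0r mulr1 sub0r.
by rewrite rmorphN /= mulrNN mulr1 addr0 !mulr1z.
Qed.

End TypePWeights.

(** Isotropy is a mere proposition; a boolean goal still allows the case analysis, by double
    negation. *)
Lemma or_not_ind (P Q : Prop) (b : bool) : (~ P \/ ~ Q -> b) -> (P /\ Q -> b) -> b.
Proof.
case: b => // h1 h2; exfalso.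
have nnP : ~ ~ P by move=> nP; have := h1 (or_introl nP).
have nnQ : ~ ~ Q by move=> nQ; have := h1 (or_intror nQ).
by apply: nnP => hP; apply: nnQ => hQ; have := h2 (conj hP hQ).
Qed.

Lemma string_bound_uniq (K : fieldType) (g : lieSuperalg K) (c : chevData g)
    (a b : lat (cd_h c) (cd_kind c)) r r' :
  string_bound a b r -> string_bound a b r' -> r = r'.
Proof.
suff le s t : string_bound a b s -> string_bound a b t -> (s <= t)%N.
  by move=> h1 h2; apply/eqP; rewrite eqn_leq !le.
move=> [h1 _] [_ h2]; rewrite leqNgt; apply: contraNN h2 => lt.
exact: h1.
Qed.

Section TypePRoots.
Variables (K : fieldType) (char_K : [pchar K] =i pred0).
Variables (g : lieSuperalg K) (h : {vspace g}) (n : nat).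
Variable f : 'Hom(g, 'M[K]_(n.+1 + n.+1)).
Local Notation L := (lat h (TypeP f)).
Variables (rt : bool -> seq L) (m : nat) (si : m.-tuple L) (co : L -> 'I_m -> int).
Variables (cr : L -> g) (H0 : (\dim h).-tuple g) (X0 : L -> g).
Local Notation c := (ChevData rt si co cr H0 X0).
Hypothesis c_ok : chev_ok c.
Local Notation rsum := (@coord_sum_row n).
Local Notation E i := (@eps n.+1 i : L).

Let n_gt1 : (2 <= n)%N. Proof. by case: c_ok => _ []. Qed.
Let f_iso : P_iso f. Proof. by case: c_ok => _ []. Qed.
Let f_h x : (x \in h) = is_diag_mx (f x). Proof. by case: c_ok => _ []. Qed.
Let mem_rt i a : a \in rt i <-> is_root i a. Proof. by case: c_ok => _ _ hr _ _; apply: (hr i).2. Qed.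

Lemma rsum_roots (a : L) : a \in Defs.roots c -> rsum a = 0 \/ rsum a = 2 \/ rsum a = -2.
Proof.
rewrite mem_undup mem_cat => /orP[] /mem_rt /rsum_root => [->|]; by [left|right].
Qed.

Lemma coord_roots (a : L) k : a \in Defs.roots c -> -1 <= (a : 'rV[int]_n.+1) 0 k.
Proof.
rewrite mem_undup mem_cat => /orP[] /mem_rt /=.
  move=> [j [l [_ ->]]]; rewrite !mxE !eqxx /=.
  by case: (k == j); case: (k == l).
case=> [[j [l [jl [->|->]]]]|[j ->]].
- by rewrite !mxE !eqxx /=; case: (k == j); case: (k == l).
- rewrite !mxE !eqxx /=; case: eqP => [->|_]; case: eqP => // e.
  by move: jl; rewrite e ltnn.
- by rewrite mulr2n !mxE !eqxx /=; case: (k == j).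
Qed.

Lemma string0 (a b : L) r : b - a \notin Defs.roots c -> b != a -> string_bound (c := c) a b r -> r = 0%N.
Proof.
move=> nr nab [hr _]; case: r hr => // r /(_ 1%N isT).
by rewrite mulr1n subr_eq0 (negbTE nab) (negbTE nr).
Qed.

Let E_inj i j : i != j -> exists k : 'I_n.+1, k != i /\ k != j.
Proof.
move=> nij; have : (0 < #|~: [set i; j]|)%N.
  by rewrite cardsCs setCK cards2 nij card_ord subn_gt0.
by case/card_gt0P => k; rewrite !inE negb_or => /andP[]; exists k.
Qed.

Lemma P_coroot_wt (b : L) i j : i != j ->
  wt b (cr (E i - E j)) = ((b : 'rV[int]_n.+1) 0 i - (b : 'rV[int]_n.+1) 0 j)%:~R.
Proof.
have [_ _ _ _ [[hc _] _]] := c_ok; move=> nij; rewrite /wt hc //.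
under eq_bigr do rewrite block_mxEul !mxE !andbb mulrBr.
rewrite sumrB rmorphB /=; congr (_ - _).
  rewrite (bigD1 i) //= eqxx mulr1 big1 ?addr0 // => k /negbTE->; by rewrite mulr0.
rewrite (bigD1 j) //= eqxx mulr1 big1 ?addr0 // => k /negbTE->; by rewrite mulr0.
Qed.

Lemma P_even_root a : a \in rt false -> - a \in rt false /\ wt a (cr a) = 2.
Proof.
move=> /mem_rt[i [j [nij ->]]]; split.
  by apply/mem_rt; exists j, i; rewrite eq_sym nij opprB.
rewrite P_coroot_wt //= !mxE !eqxx (negbTE nij) eq_sym (negbTE nij) /=.
by rewrite subr0 sub0r opprK.
Qed.

Let trE (i : 'I_n.+1) (T : 'M[K]_n.+1) : \tr (delta_mx i i *m T) = T i i.
Proof.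
rewrite /mxtrace (bigD1 i) //= big1 => [|k nk].
  rewrite addr0 mxE (bigD1 i) //= mxE !eqxx mul1r big1 ?addr0 // => k nk.
  by rewrite mxE (negbTE nk) andbF mul0r.
by rewrite mxE big1 // => l _; rewrite mxE (negbTE nk) mul0r.
Qed.

(** Pairing the element t dual to the root with the coroot gives the value 2 of the root on the
    coroot, but also the value of the root on t, assumed to be 0. *)
Lemma P_even_aniso i j : i != j -> ~ isotropic (E i - E j).
Proof.
move=> nij [t [ht ft wt0]]; have [_ _ _ _ [[hc _] _]] := c_ok.
have hH : cr (E i - E j) \in h.
  rewrite f_h hc //; apply/is_diag_mxP => u v.
  have offA s q : s != q -> (delta_mx i i - delta_mx j j : 'M[K]_n.+1) s q = 0.
    move=> nst; have z k : (s == k) && (q == k) = false.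
      by apply: contraNF nst => /andP[/eqP-> /eqP->].
    by rewrite !mxE !z subrr.
  case: (split_ordP u) => s ->; case: (split_ordP v) => q -> nst.
  - by rewrite block_mxEul offA //; apply: contraNneq nst => ->.
  - by rewrite block_mxEur mxE.
  - by rewrite block_mxEdl mxE.
  - by rewrite block_mxEdr mxE offA ?oppr0 //; apply: contraNneq nst => ->.
have := ft _ hH; rewrite P_coroot_wt //= hc // block_mxKul mxtrace_mulC mulmxBl linearB /= !trE.
move: wt0; rewrite /wt (bigD1 i) //= (bigD1 j) 1?eq_sym //= big1 => [|k /andP[ki kj]].
  rewrite !mxE !eqxx (negbTE nij) eq_sym (negbTE nij) /= !subr0 !sub0r.
  rewrite addr0 mulrN1z mulr1z mulN1r mul1r => -> /eqP; rewrite eq_sym.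
  by rewrite -[_%:~R]/(2%:R) natK_eq0.
by rewrite !mxE !eqxx (negbTE ki) (negbTE kj) /= subrr mul0r.
Qed.

(** For a = eps_i + eps_j up to sign, b is the odd root of opposite sign on j and a third index l,
    so that a + b is the difference of eps_i and eps_l up to sign. *)
Lemma P_odd_step a : a \in rt true -> - a \in Defs.roots c ->
  exists b, [/\ b \in rt true, a + b \in rt false, a != - b &
    forall z, chev_const (c := c) a b z -> z = 1 \/ z = -1].
Proof.
have [_ _ _ _ [[_ hc] _]] := c_ok.
(* A vector of coordinate sum 4 or -4 is not a root, so the string has r = 0 and the constant is a
   sign. When both roots are isotropic, the constant is b(H_a') up to sign, which is also a sign. *)
have finish (a' b : L) (z : K) i : a' + b \in Defs.roots c -> (rsum b - rsum a' = 4 \/ rsum b - rsum a' = -4) ->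
    rsum b = 2 \/ rsum b = -2 ->
    (wt b (cr a') = i \/ wt b (cr a') = - i) -> i = 1 ->
    chev_const (c := c) a' b z -> z = 1 \/ z = -1.
  move=> rab hs hb hw i1; rewrite /chev_const rab => -[h1 h2].
  have nr : b - a' \notin Defs.roots c.
    by apply/negP => /rsum_roots; rewrite rsumD rsumN; lia.
  have nba : b != a' by apply/eqP => e; move: hs; rewrite e subrr; lia.
  have nsp : ~ special_pair a' b.
    by move=> [u [v [_ _ e]]]; move: hb; rewrite e rsumD rsumN !rsum_eps; lia.
  have : (z == 1) || (z == -1).
    apply: (@or_not_ind (isotropic a') (isotropic b)) => hi.
      have [r [/(string0 nr nba) -> [_ /(_ nsp)]]] := h1 hi.
      by case=> ->; rewrite eqxx ?orbT.
    by have := h2 hi; move: hw; rewrite i1; case=> ->; case=> ->; rewrite ?opprK eqxx ?orbT.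
  by case/orP => /eqP; [left|right].
move=> /mem_rt[[i [j [ij [->|->]]]]|[i ->]] nra; last first.
- by have := coord_roots i nra; rewrite mulr2n !mxE !eqxx.
- have nij : i != j by rewrite neq_ltn ij.
  have [l [li lj]] := E_inj nij.
  have rab : - (E i + E j) + (E j + E l) \in rt false.
    by apply/mem_rt; exists l, i; split=> //; rewrite opprD addrA addrNK addrC.
  have rb : E j + E l \in rt true.
    apply/mem_rt; left; have [jl|lj'|e] := ltngtP j l.
    - by exists j, l; split=> //; left.
    - by exists l, j; split=> //; left; rewrite addrC.
    - by case/eqP: lj; apply/val_inj.
  exists (E j + E l); split=> //.
    rewrite eqr_opp; apply/eqP => /rowP/(_ i); rewrite !mxE !eqxx (negbTE nij).
    by rewrite (eq_sym i l) (negbTE li).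
  move=> z; apply: (@finish _ _ _ 1) => //.
  + by rewrite mem_undup mem_cat rab.
  + by left; rewrite rsumN !rsumD !rsum_eps.
  + by left; rewrite rsumD !rsum_eps.
  left; have -> : cr (- (E i + E j)) = - cr (E i - E j) by have [] := hc i j ij.
  rewrite -scaleN1r (wtZ (c := c)) P_coroot_wt // !mxE !eqxx (negbTE nij) /= (eq_sym i l) (negbTE li).
  by rewrite (eq_sym j l) (negbTE lj) /= addr0 sub0r mulrN1z mulrNN mulr1.
have nij : i != j by rewrite neq_ltn ij.
have [l [li lj]] := E_inj nij.
have rab : (E i + E j) - (E j + E l) \in rt false.
  apply/mem_rt; exists i, l; split; first by rewrite eq_sym.
  by rewrite opprD addrA addrK.
have rb : - (E j + E l) \in rt true.
  apply/mem_rt; left; have [jl|lj'|e] := ltngtP j l.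
  - by exists j, l; split=> //; right.
  - by exists l, j; split=> //; right; rewrite [E j + E l]addrC.
  - by case/eqP: lj; apply/val_inj.
exists (- (E j + E l)); split=> //.
  rewrite opprK; apply/eqP => /rowP/(_ i); rewrite !mxE !eqxx (negbTE nij).
  by rewrite (eq_sym i l) (negbTE li).
move=> z; apply: (@finish _ _ _ 1) => //.
+ by rewrite mem_undup mem_cat rab.
+ by right; rewrite rsumN !rsumD !rsum_eps.
+ by right; rewrite rsumN rsumD !rsum_eps.
left; have -> : cr (E i + E j) = cr (E i - E j) by have [] := hc i j ij.
rewrite P_coroot_wt // !mxE !eqxx (negbTE nij) /= (eq_sym i l) (negbTE li).
by rewrite (eq_sym j l) (negbTE lj) /= addr0 sub0r opprK.
Qed.

(** Only a = 2 eps_i has no opposite root. Adding b = eps_j - eps_i leads to eps_i + eps_j; b - a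
    has the coordinate -3 and is not a root, and b is not isotropic, so the constant is a sign. *)
Lemma P_gamma_step a : a \in rt true -> - a \notin Defs.roots c ->
  exists b, [/\ b \in Defs.roots c, a + b \in rt true, - (a + b) \in Defs.roots c, a != - b &
    forall z, chev_const (c := c) a b z -> z = 1 \/ z = -1].
Proof.
move=> /mem_rt[[i [j [ij [->|->]]]]|[i ->]] nra.
- case/negP: nra; rewrite mem_undup mem_cat; apply/orP; right; apply/mem_rt; left.
  by exists i, j; split=> //; right.
- case/negP: nra; rewrite opprK mem_undup mem_cat; apply/orP; right; apply/mem_rt; left.
  by exists i, j; split=> //; left.
have [j nj] : exists j, j != i.
  have [ni|ni] := eqVneq i ord0; last by exists ord0; rewrite eq_sym.
  by exists ord_max; rewrite ni -val_eqE /=; lia.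
have rb : E j - E i \in Defs.roots c.
  by rewrite mem_undup mem_cat; apply/orP; left; apply/mem_rt; exists j, i.
have eab : E i *+ 2 + (E j - E i) = E i + E j by rewrite mulr2n addrC addrA subrK addrC.
have rE : E i + E j \in rt true /\ - (E i + E j) \in rt true.
  split; apply/mem_rt; left; have [jl|lj'|e] := ltngtP i j.
  - by exists i, j; split=> //; left.
  - by exists j, i; split=> //; left; rewrite addrC.
  - by case/eqP: nj; apply/val_inj.
  - by exists i, j; split=> //; right.
  - by exists j, i; split=> //; right; rewrite [E i + E j]addrC.
  - by case/eqP: nj; apply/val_inj.
exists (E j - E i); rewrite eab; split=> //; first by case: rE.
- by rewrite mem_undup mem_cat; apply/orP; right; case: rE.
- apply/eqP => /rowP/(_ j); rewrite mulr2n !mxE !eqxx (negbTE nj) /=.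
  by [].
move=> z; rewrite /chev_const eab mem_undup mem_cat rE.1 orbT => -[h1 _].
have nr : (E j - E i) - E i *+ 2 \notin Defs.roots c.
  apply/negP => /(coord_roots i); rewrite mulr2n !mxE !eqxx /= eq_sym (negbTE nj).
  by [].
have nba : E j - E i != E i *+ 2.
  apply/eqP => /rowP/(_ j); rewrite mulr2n !mxE !eqxx (negbTE nj) /=.
  by [].
have nsp : ~ special_pair (kd := TypeP f) (h := h) (E i *+ 2) (E j - E i).
  move=> [u [v [nuv e _]]]; move/rowP/(_ u): e; rewrite mulr2n !mxE !eqxx (negbTE nuv) /=.
  by case: (u == i).
have [r [/(string0 nr nba) -> [_ /(_ nsp)]]] := h1 (or_intror (P_even_aniso nj)).
by [].
Qed.

End TypePRoots.

(** * Primitivity of the root vectors *)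

Lemma unit_of_sq (m z t : int) : m * m * z = t -> `|t|%N = 2%N -> m = 1 \/ m = -1.
Proof.
move=> <-; rewrite !abszM => e; have m3 : (`|m| < 2)%N.
  have : (`|m| * `|m| %| 2)%N by rewrite -e dvdn_mulr.
  move/dvdn_leq => /(_ isT); case: (`|m|%N) => [|[|q]] //; rewrite !mulnS; lia.
have m0 : `|m|%N != 0%N by apply: contra_eq_neq e => ->.
lia.
Qed.

Lemma unit_of_mul (m z t : int) : m * z = t -> `|t|%N = 1%N -> m = 1 \/ m = -1.
Proof.
move=> <-; rewrite abszM => /eqP; rewrite muln_eq1 => /andP[/eqP e _]; lia.
Qed.

Lemma bool_by_cases (P : Prop) (b : bool) : (P -> b) -> (~ P -> b) -> b.
Proof.
case: b => // h1 h2; exfalso; have nP : ~ P by move=> hP; have := h1 hP.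
by have := h2 nP.
Qed.

Section Roots.
Variables (K : fieldType) (char_K : [pchar K] =i pred0).
Variables (g : lieSuperalg K) (c : chevData g).
Hypothesis c_ok : chev_ok c.
Local Notation h := (cd_h c).
Local Notation H := (cd_H c).
Local Notation X := (cd_X c).
Local Notation Hc := (cd_coroot c).
Local Notation L := (lat (cd_h c) (cd_kind c)).
Local Notation roots_c := (Defs.roots c).
Implicit Types a b : L.

Let P_facts : is_P c ->
  [/\ forall i j a x, x != 0 -> x \in part g i ->
        (forall y, y \in h -> br y x = wt a y *: x) -> a \in cd_root c j -> i = j,
      ~ type_P g 3 -> forall i a b, a \in cd_root c i -> b \in cd_root c i ->
        (forall x, x \in h -> wt a x = wt b x) -> a = b,
      forall a, a \in cd_root c false -> exists2 x, x \in h & wt a x != 0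
    & forall a, a \in roots_c -> a != 0].
Proof.
move: c_ok; case: c => h0 [B|n f] rt m si co cr H0 X0 //= [_ [n2 fi fh] hr _ _] _.
have mem_rt i (a : lat h0 (TypeP f)) : a \in rt i -> is_root i a by move/((hr i).2 a).
split.
- move=> i j a x nx px hx /mem_rt; exact: (P_parity char_K n2 fi fh nx px hx).
- move=> nP i a b /mem_rt ra /mem_rt rb; apply: (P_wt_sep char_K n2 fi fh _ ra rb).
  by apply/eqP => n3; apply: nP; rewrite -n3; split=> //; exists f.
- by move=> a /mem_rt /(P_wt_neq0 char_K fi fh).
- by move=> a; rewrite mem_undup mem_cat => /orP[] /mem_rt ra; exact: (P_root_neq0 n2 ra).
Qed.

Lemma root_neq0 a : a \in roots_c -> a != 0.
Proof.
move=> ra; have [/P_facts[_ _ _ hp]|notP] := boolP (is_P c); first exact: hp.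
exact: notP_root0 ra.
Qed.

Lemma X_part i a : a \in cd_root c i -> X a \in part g i.
Proof.
move=> ra; have [/P_facts[hp _ _ _]|notP] := boolP (is_P c); last exact: notP_X_part ra.
have rra := cd_rootW ra; have [j pj] := X_homogeneous c_ok rra.
have e := hp j i a _ (X_neq0 c_ok rra) pj _ ra.
by rewrite -e // => y hy; apply: br_h_X.
Qed.

Lemma cd_root_part i a : a \in roots_c -> X a \in part g i -> a \in cd_root c i.
Proof.
move=> ra pa; have : exists j, a \in cd_root c j.
  by move: ra; rewrite mem_roots => /orP[] r; [exists false|exists true].
case=> j rj; have pj := X_part rj; have [<-//|ij] := eqVneq j i.
have pj' : X a \in part g (~~ i) by move: pj ij; case: (i) (j) => [] [].
by have := X_neq0 c_ok ra; rewrite (part_disjoint pa pj') eqxx.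
Qed.

Lemma cd_root_disjoint a : a \in cd_root c false -> a \in cd_root c true -> False.
Proof.
move=> r0 r1; have := X_neq0 c_ok (cd_rootW r0).
by rewrite (part_disjoint (i := false) (X_part r0) (X_part r1)) eqxx.
Qed.

Lemma even_wt_neq0 a : a \in cd_root c false -> exists2 x, x \in h & wt a x != 0.
Proof.
move=> ra; have [/P_facts[_ _ hp _]|notP] := boolP (is_P c); first exact: hp.
exact: (notP_wt_neq0 notP (notP_root0 char_K c_ok notP (cd_rootW ra))).
Qed.

Lemma root_wt_inj i a b : ~ type_P g 3 -> a \in cd_root c i -> b \in cd_root c i ->
  (forall x, x \in h -> wt a x = wt b x) -> a = b.
Proof.
move=> nP ra rb e; have [/P_facts[_ hp _ _]|notP] := boolP (is_P c); first exact: hp ra rb e.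
exact: notP_wt_inj.
Qed.

Lemma chev_signE a : exists s : int, chev_sign a = s%:~R /\ s * s = 1.
Proof. by rewrite /chev_sign; case: ifP => _; [exists (-1) | exists 1]. Qed.

Lemma even_chev_sign a : a \in cd_root c false -> chev_sign a = 1.
Proof.
move=> ra; rewrite /chev_sign; case: (boolP (a \in cd_root c true)) => // r1.
by have := cd_root_disjoint ra r1.
Qed.

Lemma br_opp a : a \in roots_c -> - a \in roots_c ->
  br (X a) (X (- a)) = chev_sign a *: Hc a.
Proof. by have [_ _ _ _ [_ [_ _ _ hb _]]] := c_ok; apply: hb. Qed.

Lemma br_roots a b : a \in roots_c -> b \in roots_c -> a != - b ->
  exists2 z, chev_const a b z & br (X a) (X b) = z *: X (a + b).
Proof. by have [_ _ _ _ [_ [_ _ _ _ hb]]] := c_ok; apply: hb. Qed.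

(** With different parities the bracket of X a and X (- a) would be odd, while it is H_a up to sign,
    which is even and nonzero. *)
Lemma cd_root_opp i a : a \in cd_root c i -> - a \in roots_c -> wt a (Hc a) = 2 ->
  - a \in cd_root c i.
Proof.
move=> ra rna w2; apply: cd_root_part => //.
have pa := X_part ra; have [j pj] := X_homogeneous c_ok rna.
have [<-//|ij] := eqVneq j i.
have p1 : br (X a) (X (- a)) \in part g true.
  by have := br_part pa pj; move: ij; case: (i) (j) => [] [].
move: p1; rewrite (br_opp (cd_rootW ra) rna) => p1.
have [s [es ss]] := chev_signE a.
have pH := h_even_in c_ok (coroot_in c_ok (cd_rootW ra) rna).
have : Hc a = 0.
  apply: (part_disjoint (i := true)) => //.
  have -> : Hc a = s%:~R *: (chev_sign a *: Hc a) by rewrite es scalerA -rmorphM ss scale1r.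
  exact: memvZ.
move=> e0; move: w2; rewrite e0 wt0 => /eqP.
by rewrite eq_sym natK_eq0.
Qed.

Variables (V : lieSupermod g) (V_faithful : faithful V) (d : nat) (e : d.-tuple V).
Variable p : 'I_d -> bool.
Hypothesis M_admissible : admissible c e p.
Let e_basis : basis_of fullv e. Proof. by case: M_admissible. Qed.
Local Notation rm := (rmx e).
Local Notation im := (@imx K d).

Lemma X_int_exists : exists N : L -> 'M[int]_d, forall a, a \in roots_c -> im (N a) = rm (X a).
Proof.
apply: (@seq_choice _ _ (0 : 'M[int]_d) _ (fun a M => im M = rm (X a))) => a; rewrite mem_roots => /orP[] ra.
  have [N hN] := kostant_int M_admissible (kostant_X V 1 ra); exists N; rewrite -hN.
  by rewrite /div_power /power /= invr1 scale1r comp_lfun1r.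
by have [N hN] := kostant_int M_admissible (kostant_Xodd V ra); exists N.
Qed.

Variable N : L -> 'M[int]_d.
Hypothesis hN : forall a, a \in roots_c -> im (N a) = rm (X a).

Lemma primitive_of_units (M : 'M[int]_d) :
  (forall (m : int) (M' : 'M[int]_d), M = m *: M' -> m = 1 \/ m = -1) -> primitive M.
Proof.
move=> hm; have [m [B [M' [/hm[] m1 eB]]]] := bezout_mx M; first by exists B; rewrite eB.
by exists (- B); rewrite mulNmx linearN /= eB m1 opprK.
Qed.

Lemma N_neq0 a : a \in roots_c -> N a != 0.
Proof.
move=> ra; apply: contraTneq (X_neq0 c_ok ra) => e0; rewrite negbK; apply/eqP.
apply: (faithful_rmx_inj e_basis V_faithful); rewrite -hN // e0 imx0.
by [].
Qed.

(** The relation [y, X_b] = b(y) X_b is divided by the content of N b and then paired with a Bezout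
    matrix, which shows the factor m of y in b(y). *)
Lemma wt_content y m Y b : y \in h -> rm y = im (m *: Y) -> b \in roots_c ->
  exists z : int, wt b y = (m * z)%:~R.
Proof.
move=> hy ey rb; have [q [B [M [eN eB]]]] := bezout_mx (N b).
have nq : q != 0 by apply: contraNneq (N_neq0 rb) => q0; rewrite eN q0 scale0r.
have trM : \tr (B *m M) = 1.
  by apply: (mulfI nq); rewrite mulr1 -[RHS]eB eN -scalemxAr linearZ.
have [i pi] := X_homogeneous c_ok rb.
exists (\tr (B *m (M * Y - Y * M))).
have := congr1 rm (br_h_X c_ok rb hy).
rewrite (rmx_br e_basis (h_even_in c_ok hy) pi) rmxZ // expr0 scale1r -hN // ey.
rewrite -!imxM -imxB eN !sqmx_scalel !sqmx_scaler !scalerA [m * q]mulrC -scalerBr !imxZ.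
move=> /(congr1 (fun R => \tr (im B *m R))).
rewrite -!scalemxAr !linearZ /= !imx_trace trM rmorphM /= mulr1 mulrC => E.
apply: (@mulIf _ (q%:~R : K)); first by rewrite intK_eq0.
by rewrite -E rmorphM /= mulrCA mulrC [m%:~R * _]mulrC.
Qed.

Lemma coroot_content a m m' M M' : a \in roots_c -> - a \in roots_c ->
  N a = m *: M -> N (- a) = m' *: M' -> exists Y, rm (Hc a) = im ((m * m') *: Y).
Proof.
move=> ra rna ea ena; have [i pi] := X_homogeneous c_ok ra.
have [j pj] := X_homogeneous c_ok rna; have [s [es ss]] := chev_signE a.
exists (s *: (M' * M - (-1) ^+ (i && j) *: (M * M'))).
have : rm (chev_sign a *: Hc a) = im (N (- a) * N a - (-1) ^+ (i && j) *: (N a * N (- a))).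
  rewrite -br_opp // (rmx_br e_basis pi pj) imxB imxZ !imxM !hN //.
  by rewrite rmorphXn rmorphN1.
rewrite rmxZ // es => E.
have -> : rm (Hc a) = s%:~R *: (s%:~R *: rm (Hc a)) by rewrite scalerA -rmorphM ss scale1r.
have e1 : N (- a) * N a = (m * m') *: (M' * M).
  by rewrite ena ea sqmx_scalel sqmx_scaler scalerA mulrC.
have e2 : N a * N (- a) = (m * m') *: (M * M').
  by rewrite ena ea sqmx_scalel sqmx_scaler scalerA.
rewrite E -imxZ; congr im; rewrite {}e1 {}e2; move: (m * m') => q.
rewrite [_ ^+ _ *: (_ *: _)]scalerA [_ ^+ _ * _]mulrC -scalerA -scalerBr.
by rewrite !scalerA mulrC.
Qed.

Lemma coroot_wt a m m' M M' b : a \in roots_c -> - a \in roots_c ->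
  N a = m *: M -> N (- a) = m' *: M' -> b \in roots_c ->
  exists z : int, wt b (Hc a) = (m * m' * z)%:~R.
Proof.
move=> ra rna ea ena rb; have [Y eY] := coroot_content ra rna ea ena.
exact: wt_content (coroot_in c_ok ra rna) eY rb.
Qed.

(* [ad(Y)^2/2] maps X to -Y, where X, Y span the nilpotent parts of sl_2:
   hence Y is divisible by m when X is, and H by m^2. *)
Lemma primitive_even a : a \in cd_root c false -> - a \in roots_c -> wt a (Hc a) = 2 ->
  primitive (N a).
Proof.
move=> ra rna w2; have rra := cd_rootW ra; have rna' := cd_root_opp ra rna w2.
apply: primitive_of_units => m M ea.
have [Y2] := kostant_int M_admissible (kostant_X V 2 rna').
rewrite /div_power lfun_mxZ // lfun_mx_power // -/(rm _) -hN // => eY2.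
set y := N (- a) in eY2; set x := N a in ea.
have pa := X_part ra; have pna := X_part rna'.
have hH := coroot_in c_ok rra rna.
have e1 : rm (Hc a) = im (y * x - x * y).
  have := congr1 rm (br_opp rra rna); rewrite even_chev_sign // scale1r => <-.
  by rewrite (rmx_br e_basis pa pna) expr0 scale1r imxB !imxM !hN.
have e2 : y * (y * x - x * y) - (y * x - x * y) * y = - (2 *: y).
  apply: (imx_inj char_K); rewrite imxB !(imxM _ y) !(imxM _ _ y) -e1 imxN imxZ.
  have := congr1 rm (br_h_X c_ok rna hH).
  rewrite (rmx_br e_basis (h_even_in c_ok hH) pna) expr0 scale1r rmxZ // wt_oppl w2 -!hN //.
  by rewrite scaleNr.
have e3 : y * y = 2 *: Y2.
  apply: (imx_inj char_K); rewrite imxM imxZ -eY2 expr2 scalerA divff ?scale1r //.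
  by rewrite natK_eq0.
(* Since y * y = 2 *: Y2, every term of the expansion of e2 is even; halving it exhibits in y the
   factor m of x. *)
have e4 : y = m *: (- (M * Y2) + y * M * y - Y2 * M).
  apply: (@scale_intmx_inj _ 2) => //.
  rewrite -[2 *: y]opprK -e2 mulrBr mulrBl !mulrA e3 -(mulrA x) e3 ea.
  rewrite !(sqmx_scalel, sqmx_scaler).
  move: (Y2 * M) (y * M * y) (M * Y2) => P Q R.
  by apply/matrixP => i j; rewrite !mxE; ring.
(* Both root vectors are divisible by m, so m * m divides a(H_a) = 2. *)
have [z] := coroot_wt rra rna ea e4 rra; rewrite w2 => /esym/eqP.
rewrite -subr_eq0 -[2%:R]/((2%:Z)%:~R) -rmorphB intK_eq0 // subr_eq0 => /eqP.
by move=> e2z; apply: (unit_of_sq e2z).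
Qed.

(** A divisor of N a divides its bracket with N b, which is N (a + b) up to sign. *)
Lemma primitive_chain a b : a \in roots_c -> b \in roots_c -> a != - b ->
  a + b \in roots_c -> primitive (N (a + b)) ->
  (forall z, chev_const a b z -> z = 1 \/ z = -1) -> primitive (N a).
Proof.
move=> ra rb nab rab [B hB] hz; apply: primitive_of_units => m M ea.
have [i pi] := X_homogeneous c_ok ra; have [j pj] := X_homogeneous c_ok rb.
have [z /hz z1 ebr] := br_roots ra rb nab.
have [t [et zt]] : exists t : int, `|t|%N = 1%N /\ z = t%:~R.
  by case: z1 => ->; [exists 1 | exists (-1)].
have := congr1 rm ebr; rewrite (rmx_br e_basis pi pj) rmxZ // -!hN // zt -imxZ.
have -> : (-1) ^+ (i && j) = ((-1) ^+ (i && j))%:~R :> K by rewrite rmorphXn rmorphN1.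
rewrite -!imxM -imxZ -imxB => /(imx_inj char_K); rewrite ea.
move=> /(congr1 (fun R => \tr (B *m R))).
rewrite !sqmx_scalel !sqmx_scaler [(-1) ^+ _ *: (_ *: _)]scalerA [(-1) ^+ _ * m]mulrC.
rewrite -[(m * _) *: _]scalerA -scalerBr -!scalemxAr !linearZ /= hB mulr1 => E.
exact: (unit_of_mul E et).
Qed.

Section NotTypeP.
Hypothesis notP : ~~ is_P c.

Lemma primitive_isotropic a : a \in roots_c -> isotropic a -> primitive (N a).
Proof.
move=> ra iso; have rna := notP_opp_root char_K c_ok notP ra.
apply: primitive_of_units => m M ea.
have [_ /(_ iso)[z hz] _ _] := notP_coroot c_ok notP ra.
have cont b : b \in roots_c -> exists t : int, wt b (Hc a) = (m * t)%:~R.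
  move=> rb; have [t ->] := coroot_wt (m' := 1) (M' := N (- a)) ra rna ea (esym (scale1r _)) rb.
  by exists t; rewrite mulr1.
have : exists t : int, (1 : K) = (m * t)%:~R.
  rewrite {1}hz; elim/big_ind: _ => [|x y [t1 ->] [t2 ->]|i _].
  - by exists 0; rewrite mulr0.
  - by exists (t1 + t2); rewrite mulrDr mulrzDr.
  have lti : (i < size roots_c)%N by rewrite -(size_map (fun b => wt b (Hc a))) ltn_ord.
  have [t ht] := cont _ (mem_nth 0 lti); exists (t * z i).
  by rewrite /= (nth_map 0) // ht mulrA [RHS]rmorphM /= mulrzr.
move=> [t /(intK_inj char_K (x1 := 1))/esym e1].
exact: (unit_of_mul e1).
Qed.

(** Negation exchanges the strings through a and through -a because the set of roots is symmetric,
    so both have the same length r. *)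
Lemma notP_chev_const_sym a z z' : a \in roots_c -> ~ isotropic a -> a + a \in roots_c ->
  chev_const a a z -> chev_const (- a) (- a) z' ->
  exists r : nat, (z = r%:R \/ z = - r%:R) /\ (z' = r%:R \/ z' = - r%:R).
Proof.
move=> ra niso raa; have opp b : (- b \in roots_c) = (b \in roots_c).
  apply/idP/idP => [/(notP_opp_root char_K c_ok notP)|]; first by rewrite opprK.
  exact: notP_opp_root.
have nison : ~ isotropic (- a).
  move=> iso; apply: niso; have [B [[[hBl _] _ _ _ _] hi]] := notP_form c_ok notP.
  have B0l y : B 0 y = 0 by have := hBl y (-1) 0 0; rewrite scaler0 addr0 /= mulN1r addNr.
  have BZl q u y : B (q *: u) y = q * B u y by have := hBl y q u 0; rewrite !addr0 B0l addr0.
  have [t [ht e0 e1]] := (hi _).1 iso; apply/hi; exists (-1 *: t); split.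
  - exact: memvZ.
  - by move=> x hx; rewrite BZl e0 // wt_oppl mulrNN mul1r.
  - by rewrite wtZ; move: e1; rewrite wt_oppl => /eqP; rewrite oppr_eq0 => /eqP->; rewrite mulr0.
rewrite /chev_const raa -opprD opp raa => -[/(_ (or_introl niso))[r [hr [_ hz]]] _].
move=> [/(_ (or_introl nison))[r' [hr' [_ hz']]] _].
have er : r = r'.
  have eN j : - a - (- a) *+ j = - (a - a *+ j) by rewrite mulNrn opprD.
  apply: (string_bound_uniq hr); case: hr' => h1 h2; split=> [j /h1|].
    by rewrite eN oppr_eq0 opp.
  by move: h2; rewrite eN oppr_eq0 opp.
exists (r + 1)%N; split; first exact: hz (@notP_special _ _ _ notP _ _).
by rewrite er; apply: hz' (@notP_special _ _ _ notP _ _).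
Qed.

End NotTypeP.

Lemma odd_square a : a \in cd_root c true -> a != - a -> exists z : K,
  [/\ chev_const a a z, br (X a) (X a) = z *: X (a + a) &
      2 *: im (N a * N a) = z *: rm (X (a + a))].
Proof.
move=> ra na; have rra := cd_rootW ra; have pa := X_part ra.
have [z hz ez] := br_roots rra rra na; exists z; split=> //.
rewrite -rmxZ // -ez (rmx_br e_basis pa pa) /= expr1 scaleN1r opprK -hN // imxM.
by rewrite scaler_nat mulr2n.
Qed.

(* With X^2 and Y^2 multiples z/2 and z'/2 of the root vectors of sl_2, the
   relation [X^2, Y^2] = -2H (up to sign) yields z z' = -16, while z and z'
   have the same absolute value because the roots are symmetric. *)
Lemma primitive_odd a : ~~ is_P c -> a \in cd_root c true -> ~ isotropic a -> primitive (N a).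
Proof.
move=> notP ra niso; have rra := cd_rootW ra.
have rrna := notP_opp_root char_K c_ok notP rra.
have w2 : wt a (Hc a) = 2 by have [hw _ _ _] := notP_coroot c_ok notP rra; apply: hw.
have rna : - a \in cd_root c true by apply: cd_root_opp.
have na : a != - a.
  apply/eqP => ea; have [x hx] := notP_wt_neq0 notP (notP_root0 char_K c_ok notP rra).
  case/eqP; have /eqP := wt_oppl a x; rewrite -ea -addr_eq0 -mulr2n -mulr_natl mulf_eq0.
  by rewrite natK_eq0 //= => /eqP.
set x := N a; set y := N (- a).
have hH := coroot_in c_ok rra rrna.
have [s [es ss]] := chev_signE a.
have pa := X_part ra; have pna := X_part rna.
pose hm := y * x + x * y.
have ehm : im hm = s%:~R *: rm (Hc a).
  rewrite -es -rmxZ // -(br_opp rra rrna) (rmx_br e_basis pa pna) /= expr1 scaleN1r opprK.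
  by rewrite -!hN // imxD !imxM.
have eHm : rm (Hc a) = im (s *: hm) by rewrite imxZ ehm scalerA -rmorphM ss scale1r.
have eyh : y * hm - hm * y = - (2 * s *: y).
  apply: (imx_inj char_K); rewrite imxB !imxM ehm imxN imxZ.
  have := congr1 rm (br_h_X c_ok rrna hH).
  rewrite (rmx_br e_basis (h_even_in c_ok hH) pna) expr0 scale1r rmxZ // wt_oppl w2 -!hN //.
  rewrite -/y -!mulmxE -scalemxAl -scalemxAr -scalerBr => ->.
  by rewrite scaleNr scalerN scalerA rmorphM /= mulrC.
have eyx : (y * y) * x - x * (y * y) = - (2 * s *: y).
  by rewrite -eyh /hm mulrDr mulrDl !mulrA [X in _ = _ - X]addrC opprD addrACA subrr addr0.
have eyyxx : (y * y) * (x * x) - (x * x) * (y * y) = - (2 * s *: hm).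
  have -> : (y * y) * (x * x) - (x * x) * (y * y) =
     ((y * y) * x - x * (y * y)) * x + x * ((y * y) * x - x * (y * y)).
    by rewrite mulrBl mulrBr !mulrA addrA subrK.
  by rewrite eyx mulNr mulrN sqmx_scalel sqmx_scaler -opprD -scalerDr.
have hm0 : hm != 0.
  apply/eqP => hm0; have H0 : Hc a = 0.
    by apply: (faithful_rmx_inj e_basis V_faithful); rewrite eHm hm0 scaler0 imx0.
  by move: w2; rewrite H0 wt0 => /eqP; rewrite eq_sym natK_eq0.
have s0 : s != 0 by apply: contra_eq_neq ss => ->; rewrite mul0r.
have xx0 : x * x != 0.
  apply: contraNneq hm0 => xx0; move: eyyxx; rewrite xx0 mulr0 mul0r subrr.
  move/esym/eqP; rewrite oppr_eq0 => /eqP e0; apply/eqP.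
  apply: (@scale_intmx_inj _ (2 * s)); first by rewrite mulf_neq0.
  by rewrite e0 scaler0.
have [z [hz ebr ez]] := odd_square ra na.
have nna : - a != - - a by rewrite opprK eq_sym.
have [z' [hz' _ ez']] := odd_square rna nna.
have z0 : z != 0.
  apply: contraNneq xx0 => z0; apply/eqP; apply: (imx_inj char_K); rewrite imx0.
  apply/eqP; have /eqP := ez; rewrite z0 scale0r scaler_eq0 natK_eq0 //.
have raa : a + a \in roots_c.
  by apply: contraT => nr; case/eqP: z0; move: hz; rewrite /chev_const (negbTE nr).
have [r [hzr hzr']] := notP_chev_const_sym notP rra niso raa hz hz'.
have niso2 : ~ isotropic (a + a) by move/(isotropic_double char_K c_ok notP).
have rraa := notP_opp_root char_K c_ok notP raa.
have w22 : wt (a + a) (Hc (a + a)) = 2.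
  by have [hw _ _ _] := notP_coroot c_ok notP raa; apply: hw.
have paa : X (a + a) \in part g false.
  have := memvZ z^-1 (br_part pa pa); rewrite ebr scalerA mulVf // scale1r.
  by [].
have raa0 : a + a \in cd_root c false by apply: cd_root_part.
have [B hB] : primitive (N (a + a)).
  exact: (primitive_even raa0 rraa w22).
set E := N (a + a) in hB; set F := N (- (a + a)).
have [t [ht ezt]] : exists t : int, `|t|%N = r /\ z = t%:~R.
  by case: hzr => ->; [exists r%:Z | exists (- r%:Z); rewrite abszN rmorphN].
have [t' [ht' ezt']] : exists t : int, `|t|%N = r /\ z' = t%:~R.
  by case: hzr' => ->; [exists r%:Z | exists (- r%:Z); rewrite abszN rmorphN].
have exx : 2 *: (x * x) = t *: E.
  by apply: (imx_inj char_K); rewrite !imxZ -ezt hN.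
have eyy : 2 *: (y * y) = t' *: F.
  by apply: (imx_inj char_K); rewrite !imxZ -ezt' hN // -opprD in ez' *.
have eFE : im (F * E - E * F) = rm (Hc (a + a)).
  have rna0 := cd_root_opp raa0 rraa w22.
  have := congr1 rm (br_opp raa rraa); rewrite (even_chev_sign raa0) scale1r => <-.
  rewrite (rmx_br e_basis (X_part raa0) (X_part rna0)) expr0 scale1r.
  by rewrite imxB !imxM !hN.
have eHH : (t * t') *: (F * E - E * F) = - (8 * s *: hm).
  have -> : 8 * s *: hm = (2 * 2) *: (2 * s *: hm) by rewrite scalerA !mulrA.
  rewrite -scalerN -eyyxx.
  have sq (P Q : 'M[int]_d) : (2 * 2) *: (P * Q) = (2 *: P) * (2 *: Q).
    by rewrite sqmx_scalel sqmx_scaler scalerA.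
  rewrite [in RHS]scalerBr !sq exx eyy !(sqmx_scalel, sqmx_scaler) !scalerA.
  by rewrite [t' * t]mulrC scalerBr.
(* The root a + a takes the value 2 on its own coroot and 4 on H_a, so eHH yields 2 t t' + 32 =
   0. *)
have tt' : t * t' = -16.
  have eH : (t * t')%:~R *: Hc (a + a) + 8%:R *: Hc a = 0.
    apply: (faithful_rmx_inj e_basis V_faithful); rewrite rmxD // !rmxZ // -eFE -imxZ eHH.
    rewrite imxN imxZ ehm scalerA -rmorphM -mulrA ss mulr1.
    by rewrite addNr.
  have := wtD (a + a) (memvZ (t * t')%:~R (coroot_in c_ok raa rraa)) (memvZ 8%:R hH).
  rewrite eH wt0 !wtZ w22 wt_addl w2 -[2%:R]/(2%:Z%:~R) -[8%:R]/(8%:Z%:~R).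
  rewrite -rmorphD -!rmorphM -rmorphD /= => /esym/eqP; rewrite intK_eq0 // => /eqP.
  by clear; lia.
have r4 : r = 4.
  have : (r * r)%N = 16 by rewrite -{1}ht -ht' -abszM tt'.
  clear; nia.
apply: primitive_of_units => m M ea.
(* Now 2 x x is 4 E up to sign. Pairing with the Bezout matrix of E and halving shows that m * m
   divides 2. *)
have := congr1 (fun R => \tr (B *m R)) exx.
rewrite ea !sqmx_scalel !sqmx_scaler -!scalemxAr !linearZ /= hB mulr1 => E2.
have [t4|t4] : t = 4 \/ t = -4 by move: ht; rewrite r4; clear; lia.
  apply: (@unit_of_sq m (\tr (B *m (M * M))) 2) => //; move: E2; rewrite t4 [m * (m * _)]mulrA; move: (m * m * _) => q; clear; lia.
by apply: (@unit_of_sq m (\tr (B *m (M * M))) (-2)) => //; move: E2; rewrite t4 [m * (m * _)]mulrA; move: (m * m * _) => q; clear; lia.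
Qed.

Lemma primitive_root a : a \in roots_c -> primitive (N a).
Proof.
have prim_even b : is_P c -> b \in cd_root c false -> primitive (N b).
  move=> isP rb; have [rnb w2] : - b \in cd_root c false /\ wt b (Hc b) = 2.
    move: c_ok isP b rb; clear; case: c => h0 [B|n f] rt m si co cr H0 X0 //= c_ok _ b.
    exact: (P_even_root c_ok).
  exact: (primitive_even rb (cd_rootW rnb) w2).
move=> ra; have [isP|notP] := boolP (is_P c).
  have odd_step b : b \in cd_root c true -> - b \in roots_c -> primitive (N b).
    move=> rb rnb; have [b' [rb' rbb nb hz]] : exists b', [/\ b' \in cd_root c true,
        b + b' \in cd_root c false, b != - b' & forall z, chev_const b b' z -> z = 1 \/ z = -1].
      move: c_ok isP b rb rnb; clear; case: c => h0 [B|n f] rt m si co cr H0 X0 //= c_ok _ b.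
      exact: (P_odd_step c_ok).
    apply: (primitive_chain (cd_rootW rb) (cd_rootW rb') nb) => //.
      exact: cd_rootW rbb.
    exact: prim_even.
  move: ra; rewrite mem_roots => /orP[] ra; first exact: prim_even.
  have [rna|rna] := boolP (- a \in roots_c); first exact: odd_step.
  have [b [rb rab rnab nb hz]] : exists b, [/\ b \in roots_c, a + b \in cd_root c true,
      - (a + b) \in roots_c, a != - b & forall z, chev_const a b z -> z = 1 \/ z = -1].
    move: char_K c_ok isP a ra rna; clear; case: c => h0 [B|n f] rt m si co cr H0 X0 //= char_K c_ok _ a.
    exact: (P_gamma_step char_K c_ok).
  apply: (primitive_chain (cd_rootW ra) rb nb) => //.
    exact: cd_rootW rab.
  exact: odd_step.
apply: primitive_of_units => m M ea.
(* The goal is made boolean so that [bool_by_cases] can distinguish the isotropic roots. *)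
suff : (m == 1) || (m == -1) by case/orP => /eqP; [left | right].
have units : primitive (N a) -> (m == 1) || (m == -1).
  move=> [B]; rewrite ea -scalemxAr linearZ /= => /unit_of_mul[] // ->; by rewrite ?eqxx ?orbT.
apply: (@bool_by_cases (isotropic a)) => iso; apply: units.
  exact: (primitive_isotropic notP ra iso).
move: (ra); rewrite mem_roots => /orP[] ra'; last exact: primitive_odd.
have rna := notP_opp_root char_K c_ok notP ra.
have [w2 _ _ _] := notP_coroot c_ok notP ra.
exact: (primitive_even ra' rna (w2 iso)).
Qed.

End Roots.

(** * The integral form of the Lie superalgebra *)

Lemma lat_opp_eq (K : fieldType) (g : lieSuperalg K) (c : chevData g)
    (a : lat (cd_h c) (cd_kind c)) : [pchar K] =i pred0 -> a = - a -> a = 0.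
Proof.
move=> char_K; case: c a => h0 [B|n f] rt m si co cr H0 X0 /= a /eqP.
  rewrite -addr_eq0 -mulr2n -scaler_nat scaler_eq0 => /orP[|/eqP //].
  by rewrite -[2%:R]/((2%:R : K) : K^o) natK_eq0.
rewrite -addr_eq0 -mulr2n => /eqP/rowP e; apply/rowP => i; have := e i.
by rewrite mulmxnE !mxE => /eqP; rewrite mulrn_eq0 => /eqP.
Qed.

Lemma subrBB (Z : zmodType) (x y u v : Z) : (x - y) - (u - v) = (x - u) - (y - v).
Proof. by rewrite !opprB addrACA [RHS]addrACA [- u - y]addrC. Qed.

Section IntegralForm.
Variables (K : fieldType) (char_K : [pchar K] =i pred0).
Variables (g : lieSuperalg K) (c : chevData g).
Hypothesis c_ok : chev_ok c.
Hypothesis not_P3 : ~ type_P g 3.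
Local Notation h := (cd_h c).
Local Notation H := (cd_H c).
Local Notation l := (\dim h).
Local Notation X := (cd_X c).
Local Notation Hc := (cd_coroot c).
Local Notation L := (lat (cd_h c) (cd_kind c)).
Local Notation roots_c := (Defs.roots c).
Implicit Types a b : L.
Variables (V : lieSupermod g) (V_faithful : faithful V) (d : nat) (e : d.-tuple V).
Variable p : 'I_d -> bool.
Hypothesis M_admissible : admissible c e p.
Let e_basis : basis_of fullv e. Proof. by case: M_admissible. Qed.
Let e_part i : tnth e i \in mpart V (p i). Proof. by case: M_admissible. Qed.
Local Notation rm := (rmx e).
Local Notation im := (@imx K d).
Variables (N : L -> 'M[int]_d) (T : 'I_l -> 'M[int]_d).
Hypothesis hN : forall a, a \in roots_c -> im (N a) = rm (X a).
Hypothesis hT : forall i, im (T i) = rm (tnth H i).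

Lemma root_weight_exists : exists be : L -> {ffun 'I_l -> int}, forall a, a \in roots_c ->
  forall i, wt a (tnth H i) = (be a i)%:~R.
Proof.
have [a ra|f hf] := @seq_choice L {ffun 'I_l -> int} 0 roots_c
    (fun a q => forall i, wt a (tnth H i) = (q i)%:~R); last by exists f.
have /fin_all_exists[z hz] : forall i, exists z : int, wt a (tnth H i) = z%:~R.
  move=> i; have e1 : rm (tnth H i) = im (1 *: T i) by rewrite scale1r hT.
  have [z ->] := wt_content char_K c_ok V_faithful M_admissible hN (H_in (cd_H_basis c_ok) i) e1 ra.
  by exists z; rewrite mul1r.
by exists [ffun i => z i] => i; rewrite ffunE.
Qed.

Variable be : L -> {ffun 'I_l -> int}.
Hypothesis hbe : forall a, a \in roots_c -> forall i, wt a (tnth H i) = (be a i)%:~R.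

Lemma N_weight a i : a \in roots_c -> N a * T i - T i * N a = be a i *: N a.
Proof.
move=> ra; have [j pj] := X_homogeneous c_ok ra; apply: (imx_inj char_K).
rewrite imxB !imxM imxZ hT hN // -hbe // -rmxZ //.
rewrite -(br_h_X c_ok ra (H_in (cd_H_basis c_ok) i)).
by rewrite (rmx_br e_basis (H_even c_ok i) pj) expr0 scale1r.
Qed.

Lemma be_inj i a b : a \in cd_root c i -> b \in cd_root c i -> be a = be b -> a = b.
Proof.
move=> ra rb E; apply: (root_wt_inj char_K c_ok not_P3 ra rb) => x hx.
rewrite !(wt_coord c_ok _ hx); apply: eq_bigr => j _.
by rewrite !hbe ?E // (cd_rootW ra, cd_rootW rb).
Qed.

Lemma be_neq0 a : a \in cd_root c false -> be a != 0.
Proof.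
move=> ra; have [x hx] := even_wt_neq0 char_K c_ok ra; apply: contraNneq => b0.
rewrite (wt_coord c_ok _ hx) big1 // => i _.
by rewrite hbe ?(cd_rootW ra) // b0 ffunE mulr0.
Qed.

Lemma N_odd a i j : a \in cd_root c true -> p i = p j -> N a i j = 0.
Proof.
move=> ra pij; apply: (intK_inj char_K).
have := congr1 (fun M : 'M[K]_d => M i j) (hN (cd_rootW ra)); rewrite mxE => ->.
by apply: (rmx_part e_basis e_part (X_part char_K c_ok ra)); rewrite pij addbb.
Qed.

Lemma N_even a : a \in cd_root c false -> block_diag p (N a).
Proof.
move=> ra i j pij; apply: (intK_inj char_K).
have := congr1 (fun M : 'M[K]_d => M i j) (hN (cd_rootW ra)); rewrite mxE => ->.
exact: (rmx_block_diag e_basis e_part (X_part char_K c_ok ra)).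
Qed.

(** The bracket acts on M by an integer matrix and N (a + b) is primitive, which settles all the
    cases of [chev_const] at once. *)
Lemma br_int a b : a \in roots_c -> b \in roots_c -> a != - b ->
  exists z : int, (z = 0 \/ a + b \in roots_c) /\ br (X a) (X b) = z%:~R *: X (a + b).
Proof.
move=> ra rb nab; have [z hz ez] := br_roots c_ok ra rb nab.
have [rab|rab] := boolP (a + b \in roots_c); last first.
  by exists 0; split; [left | move: hz; rewrite /chev_const (negbTE rab) ez => ->].
have [i pi] := X_homogeneous c_ok ra; have [j pj] := X_homogeneous c_ok rb.
have [t et] : exists t : int, z = t%:~R.
  apply: (primitive_int (M := N b * N a - (-1) ^+ (i && j) *: (N a * N b))
    (primitive_root char_K c_ok V_faithful M_admissible hN rab)).
  rewrite hN // -rmxZ // -ez (rmx_br e_basis pi pj) imxB imxZ !imxM !hN //.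
  by rewrite rmorphXn rmorphN1.
by exists t; split; [right | rewrite ez et].
Qed.

(** The Z-span of the H_i and of the even X_a acting on M. Presented by generators and differences,
    it allows inductions such as [G0_dual]. *)
Inductive even_lattice : 'M[int]_d -> Prop :=
| EvenLattice0 : even_lattice 0
| EvenLatticeT i : even_lattice (T i)
| EvenLatticeN a of a \in cd_root c false : even_lattice (N a)
| EvenLatticeB Y Y' of even_lattice Y & even_lattice Y' : even_lattice (Y - Y').
Local Notation ev := even_lattice.

Lemma even_latticeN Y : ev Y -> ev (- Y).
Proof. by move=> hY; rewrite -sub0r; apply: EvenLatticeB hY; apply: EvenLattice0. Qed.

Lemma even_latticeD Y Y' : ev Y -> ev Y' -> ev (Y + Y').
Proof. by move=> hY hY'; rewrite -[Y']opprK; apply: EvenLatticeB => //; apply: even_latticeN. Qed.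

Lemma even_latticeZ z Y : ev Y -> ev (z *: Y).
Proof.
move=> hY; have nat n : ev (n%:Z *: Y).
  elim: n => [|n IH]; first by rewrite scale0r; apply: EvenLattice0.
  by rewrite -addn1 PoszD scalerDl scale1r; apply: even_latticeD.
by case: z => n //; rewrite NegzE scaleNr; apply: even_latticeN.
Qed.

Lemma even_lattice_sum (I : Type) (r : seq I) (F : I -> 'M[int]_d) :
  (forall i, ev (F i)) -> ev (\sum_(i <- r) F i).
Proof.
by move=> hF; elim/big_ind: _ => //; [apply: EvenLattice0 | apply: even_latticeD].
Qed.

Lemma ev_rmx Y : ev Y -> exists2 x, x \in part g false & rm x = im Y.
Proof.
elim=> [|i|a ra|Z Z' _ [x hx ex] _ [x' hx' ex']].
- by exists 0; [exact: mem0v | rewrite rmx0 // imx0].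
- by exists (tnth H i); [exact: H_even | rewrite hT].
- by exists (X a); [exact: X_part | rewrite hN // (cd_rootW ra)].
by exists (x - x'); [exact: memvB | rewrite rmxD // rmxN // ex ex' imxB].
Qed.

Lemma ev_of_br a b i M : a \in cd_root c i -> b \in cd_root c i ->
  rm (br (X a) (X b)) = im M -> ev M.
Proof.
move=> ra rb eM; have rra := cd_rootW ra; have rrb := cd_rootW rb.
have pbr : br (X a) (X b) \in part g false.
  have := br_part (X_part char_K c_ok ra) (X_part char_K c_ok rb).
  by rewrite addbb.
have [eab|nab] := eqVneq a (- b).
  have eb : b = - a by rewrite eab opprK.
  rewrite {}eb in rb rrb eM {eab pbr}.
  have [s [es ss]] := chev_signE a.
  have [z hz] := coroot_int c_ok rra rrb.
  suff -> : M = s *: \sum_i z i *: T i.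
    by apply: even_latticeZ; apply: even_lattice_sum => j; apply: even_latticeZ; apply: EvenLatticeT.
  apply: (imx_inj char_K); rewrite -eM (br_opp c_ok rra rrb) es rmxZ // imxZ hz.
  congr (_ *: _); rewrite rmx_sum // imx_sum; apply: eq_bigr => j _.
  by rewrite imxZ hT -rmxZ // scaler_int.
have [z [hz ez]] := br_int rra rrb nab.
have [z0|nz] := eqVneq z 0.
  suff -> : M = 0 by apply: EvenLattice0.
  by apply: (imx_inj char_K); rewrite -eM ez z0 scale0r rmx0 // imx0.
case: hz => [z0|rab]; first by rewrite z0 eqxx in nz.
have rab0 : a + b \in cd_root c false.
  apply: (cd_root_part char_K c_ok rab); move: (memvZ (z%:~R)^-1 pbr).
  by rewrite ez scalerA mulVf ?scale1r // intK_eq0.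
suff -> : M = z *: N (a + b) by apply: even_latticeZ; apply: EvenLatticeN.
by apply: (imx_inj char_K); rewrite -eM ez rmxZ // imxZ hN.
Qed.

Lemma ev_br Y Y' : ev Y -> ev Y' -> ev (Y * Y' - Y' * Y).
Proof.
have sym Z Z' : ev (Z * Z' - Z' * Z) -> ev (Z' * Z - Z * Z') by move/even_latticeN; rewrite opprB.
have TN i a : a \in roots_c -> ev (N a) -> ev (N a * T i - T i * N a).
  by move=> ra eN; rewrite N_weight //; apply: even_latticeZ.
elim=> [hY'|i|a ra|Z Z' _ IH _ IH' hY'].
- by rewrite mul0r mulr0 subrr; apply: EvenLattice0.
- elim=> [|j|b rb|Z Z' _ IH _ IH'].
  + by rewrite mul0r mulr0 subrr; apply: EvenLattice0.
  + suff -> : T i * T j - T j * T i = 0 by apply: EvenLattice0.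
    apply: (imx_inj char_K); rewrite imxB !imxM imx0 !hT.
    have := congr1 rm (br_h_h c_ok (H_in (cd_H_basis c_ok) j) (H_in (cd_H_basis c_ok) i)).
    by rewrite rmx0 // (rmx_br e_basis (H_even c_ok j) (H_even c_ok i)) expr0 scale1r.
  + by apply: sym; apply: TN; [exact: cd_rootW rb | exact: EvenLatticeN].
  + by rewrite mulrBr mulrBl subrBB; apply: EvenLatticeB.
- elim=> [|j|b rb|Z Z' _ IH _ IH'].
  + by rewrite mul0r mulr0 subrr; apply: EvenLattice0.
  + by apply: TN; [exact: cd_rootW ra | exact: EvenLatticeN].
  + apply: (ev_of_br rb ra); rewrite (rmx_br e_basis (X_part char_K c_ok rb) (X_part char_K c_ok ra)).
    by rewrite expr0 scale1r imxB !imxM !hN // (cd_rootW ra, cd_rootW rb).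
  + by rewrite mulrBr mulrBl subrBB; apply: EvenLatticeB.
have -> : (Z - Z') * Y' - Y' * (Z - Z') = (Z * Y' - Y' * Z) - (Z' * Y' - Y' * Z').
  by rewrite mulrBr mulrBl subrBB.
by apply: EvenLatticeB; [exact: IH | exact: IH'].
Qed.

Lemma odd_odd a b : a \in cd_root c true -> b \in cd_root c true -> ev (N a * N b + N b * N a).
Proof.
move=> ra rb; apply: (ev_of_br ra rb).
rewrite (rmx_br e_basis (X_part char_K c_ok ra) (X_part char_K c_ok rb)) /= expr1 scaleN1r opprK.
by rewrite imxD !imxM !hN ?(cd_rootW ra, cd_rootW rb) // addrC.
Qed.

(** The square of X_a is half of its self-bracket; although the structure constant is halved, the
    coefficient on N (a + a) is an integer because N (a + a) is primitive. *)
Lemma odd_sq_int a : a \in cd_root c true ->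
  N a * N a = 0 \/ (a + a \in cd_root c false /\ exists t : int, N a * N a = t *: N (a + a)).
Proof.
move=> ra; have rra := cd_rootW ra.
have na : a != - a.
  by apply: contra_neqN (root_neq0 char_K c_ok rra) => /eqP; apply: lat_opp_eq.
have [z [hz ez e2]] := odd_square char_K c_ok M_admissible hN ra na.
have [->|nz] := eqVneq (N a * N a) 0; first by left.
right; have z0 : z != 0.
  apply: contraNneq nz => z0; apply/eqP; apply: (imx_inj char_K); rewrite imx0.
  by apply/eqP; have /eqP := e2; rewrite z0 scale0r scaler_eq0 natK_eq0.
have raa : a + a \in roots_c.
  by apply: contraT => nr; case/eqP: z0; move: hz; rewrite /chev_const (negbTE nr).
split.
  apply: (cd_root_part char_K c_ok raa).
  have := memvZ z^-1 (br_part (X_part char_K c_ok ra) (X_part char_K c_ok ra)).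
  by rewrite ez scalerA mulVf // scale1r.
have [t et] : exists t : int, 2^-1 * z = t%:~R.
  apply: (primitive_int (M := N a * N a) (primitive_root char_K c_ok V_faithful M_admissible hN raa)).
  by rewrite -scalerA hN // -e2 scalerA mulVf ?scale1r // natK_eq0.
exists t; apply: (imx_inj char_K); rewrite imxZ -et -scalerA hN // -e2 scalerA mulVf ?scale1r //.
by rewrite natK_eq0.
Qed.

Lemma odd_sq a : a \in cd_root c true -> ev (N a * N a).
Proof.
move=> /odd_sq_int[->|[raa [t ->]]]; first exact: EvenLattice0.
by apply: even_latticeZ; apply: EvenLatticeN.
Qed.

Variables (P : 'M[K]_d) (z : 'I_d -> 'I_l -> int) (Pi : {ffun 'I_l -> int} -> 'M[int]_d).
Hypothesis P_unit : P \in unitmx.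
Hypothesis T_diag : forall i, im (T i) = diag_op P (fun j => (z j i)%:~R).
Hypothesis PiP : weight_proj p P z Pi.

Variable s : seq L.
Hypothesis s_uniq : uniq s.
Hypothesis s_odd : s =i cd_root c true.

(** A Bezout matrix of N b already pairs to 1 with N b. Compressing it by the weight projections to
    the weight of b kills the pairing with the other odd roots, whose weights differ. *)
Lemma N_dual b : b \in s -> exists C : 'M[int]_d,
  forall a, a \in s -> \tr (C *m N a) = (a == b)%:R.
Proof.
rewrite s_odd => rb.
have [B hB] := primitive_root char_K c_ok V_faithful M_admissible hN (cd_rootW rb).
exists (\sum_(q <- weights z) Pi (q + be b) * B * Pi q) => a; rewrite s_odd => ra.
have E : \tr (B *m (\sum_(q <- weights z) Pi q * N a * Pi (q + be b))) = (a == b)%:R.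
  rewrite (weight_component char_K P_unit T_diag PiP (b := be a)) => [|i]; last first.
    by rewrite N_weight ?(cd_rootW ra).
  case: eqP => [/(be_inj ra rb) ->|ne]; first by rewrite eqxx.
  by case: eqP => [ab|_]; [case: ne; rewrite ab | rewrite mulmx0 linear0].
rewrite -E mulmx_sumr mulmx_suml !linear_sum; apply: eq_bigr => q _ /=.
by rewrite -!mulmxE -!mulmxA mxtrace_mulC !mulmxA.
Qed.

(** The coordinates of x over K are traces of the integer matrix M against the dual matrices, hence
    integers. *)
Lemma saturation x M : x \in part g true -> rm x = im M ->
  exists w : L -> int, M = \sum_(b <- s) w b *: N b.
Proof.
move=> px eM; have [y [k [hy ex _]]] := expand c_ok x.
have ex' : x = \sum_(b <- s) k b *: X b.
  have eS : \sum_(b <- roots_c | b \in cd_root c true) k b *: X b = \sum_(b <- s) k b *: X b.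
    rewrite -big_filter; apply: perm_big; apply: uniq_perm => //.
      by rewrite filter_uniq ?undup_uniq.
    move=> b; rewrite mem_filter s_odd; case: (boolP (b \in cd_root c true)) => //= rb.
    by rewrite (cd_rootW rb).
  pose x0 := y + \sum_(b <- roots_c | b \notin cd_root c true) k b *: X b.
  have e0 : x = x0 + \sum_(b <- s) k b *: X b.
    by rewrite ex -eS (bigID (fun b => b \in cd_root c true)) /= [X in y + X]addrC addrA.
  have h0 : x0 \in part g false.
    apply: memvD; first exact: h_even_in hy.
    rewrite big_seq_cond; apply: memv_suml => b /andP[rb nb]; apply: memvZ.
    apply: X_part => //; by move: rb; rewrite mem_roots (negbTE nb) orbF.
  have h1 : x0 \in part g true.
    have -> : x0 = x - \sum_(b <- s) k b *: X b by rewrite e0 addrK.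
    apply: memvB => //; rewrite big_seq; apply: memv_suml => b sb; apply: memvZ.
    by apply: X_part; rewrite // -s_odd.
  by rewrite e0 (part_disjoint h0 h1) add0r.
have rs b : b \in s -> b \in roots_c by rewrite s_odd; apply: cd_rootW.
have eM' : im M = \sum_(b <- s) k b *: im (N b).
  rewrite -eM ex' rmx_sum // !big_seq; apply: eq_bigr => b sb.
  by rewrite rmxZ // hN // rs.
have [w hw] : exists w : L -> int, forall b, b \in s -> k b = (w b)%:~R.
  have [b sb|f hf] := @seq_choice L int 0 s (fun b q => k b = q%:~R); last by exists f.
  have [C hC] := N_dual sb; exists (\tr (C *m M)).
  rewrite -imx_trace eM' mulmx_sumr linear_sum /= (bigD1_seq b) //= big_seq_cond big1 => [|a].
    by rewrite addr0 -scalemxAr linearZ /= imx_trace hC // eqxx mulr1.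
  by case/andP=> sa nab; rewrite -scalemxAr linearZ /= imx_trace hC // (negbTE nab) mulr0.
exists w; apply: (imx_inj char_K); rewrite imx_sum eM' !big_seq.
by apply: eq_bigr => b sb; rewrite imxZ hw.
Qed.

Lemma ev_odd Y a : ev Y -> a \in s -> exists w : L -> int,
  Y * N a - N a * Y = \sum_(b <- s) w b *: N b.
Proof.
move=> /ev_rmx[x hx ex]; rewrite s_odd => ra.
have pa := X_part char_K c_ok ra.
apply: (saturation (x := br (X a) x)).
  exact: (br_part (i := true) (j := false)).
by rewrite (rmx_br e_basis pa hx) andbF expr0 scale1r imxB !imxM ex hN // (cd_rootW ra).
Qed.

End IntegralForm.

(** * Divided powers *)

(** The Cauchy product of two truncated exponentials, summed by total degree; the terms outside the
    square vanish, so total degrees below D + D suffice. *)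
Lemma sum_antidiagonal (Z : zmodType) (D : nat) (F : nat -> nat -> Z) :
  (forall n m, (D <= n)%N || (D <= m)%N -> F n m = 0) ->
  \sum_(n < D) \sum_(m < D) F n m = \sum_(k < D + D) \sum_(n < k.+1) F n (k - n)%N.
Proof.
move=> F0; pose G n k := if (n <= k)%N then F n (k - n)%N else 0.
have sum0 a b (f : nat -> Z) : (forall i, (a <= i < b)%N -> f i = 0) -> \sum_(a <= i < b) f i = 0.
  by move=> f0; rewrite big_nat big1.
have eR k : (k < D + D)%N -> \sum_(n < k.+1) F n (k - n)%N = \sum_(0 <= n < D + D) G n k.
  move=> lk; rewrite (big_cat_nat _ _ (n := k.+1)) //= [X in _ = _ + X]sum0 ?addr0.
    by rewrite big_mkord; apply: eq_bigr => n _; rewrite /G -ltnS ltn_ord.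
  by move=> n /andP[ln _]; rewrite /G leqNgt ln.
rewrite [RHS](eq_bigr (fun k : 'I_(D + D) => \sum_(0 <= n < D + D) G n k)) => [|k _]; last exact: eR.
rewrite -(big_mkord xpredT (fun k => \sum_(0 <= n < D + D) G n k)) [RHS]exchange_big /=.
rewrite [RHS](big_cat_nat _ _ (n := D)) ?leq_addr //= [X in _ = _ + X]sum0 ?addr0; last first.
  by move=> n /andP[Dn _]; apply: big1 => k _; rewrite /G; case: ifP => // _; rewrite F0 // Dn.
rewrite big_mkord; apply: eq_bigr => n _.
have ln := ltn_ord n.
rewrite [RHS](big_cat_nat _ _ (n := n)) //=; last by rewrite ltnW // ltn_addr.
rewrite [X in _ = X + _]sum0 ?add0r => [|k /andP[_ kn]]; last by rewrite /G leqNgt kn.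
rewrite -[X in \sum_(X <= _ < _) _]add0n big_addn.
rewrite [RHS](big_cat_nat _ _ (n := D)) //=; last by rewrite -addnBA ?leq_addr // ltnW.
rewrite [X in _ = _ + X]sum0 ?addr0 => [|m /andP[Dm _]].
  by rewrite big_mkord; apply: eq_bigr => m _; rewrite /G leq_addl addnK.
by rewrite /G leq_addl addnK F0 // Dm orbT.
Qed.

Section Zpow.
Variables (k : comPzRingType) (A : comSuperalg k) (t s : A).
Hypothesis (t_even : sa_part false t) (s_even : sa_part false s).
Hypothesis (ts : t * s = 1) (st : s * t = 1).

Lemma zpow_even z : sa_part false (zpow t s z).
Proof. by case: z => n; apply: sa_partX. Qed.

Lemma zpowS z : zpow t s (z + 1) = t * zpow t s z.
Proof.
case: z => [n|[|n]]; first by rewrite -PoszD addn1 /= exprS.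
  by rewrite NegzE addNr /= expr0 expr1 ts.
have -> : Negz n.+1 + 1 = Negz n by rewrite !NegzE; lia.
by rewrite /= [s ^+ n.+2]exprS mulrA ts mul1r.
Qed.

Lemma zpowD z z' : zpow t s (z + z') = zpow t s z * zpow t s z'.
Proof.
elim: z => [|n IH|n IH].
- by rewrite add0r /= expr0 mul1r.
- by rewrite -addn1 PoszD addrAC zpowS IH zpowS mulrA.
have e (w : int) : zpow t s (w - 1) = s * zpow t s w.
  by rewrite -{2}[w](subrK 1) zpowS mulrA st mul1r.
have -> : - n.+1%:Z = - n%:Z - 1 by lia.
by rewrite addrAC e IH e mulrA.
Qed.

Lemma zpowK z : zpow t s z * zpow s t z = 1.
Proof.
have ks n : t ^+ n * s ^+ n = 1 /\ s ^+ n * t ^+ n = 1.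
  have c : GRing.comm t s by rewrite /GRing.comm ts st.
  have c' : GRing.comm s t by rewrite /GRing.comm ts st.
  by rewrite -(exprMn_comm _ c) -(exprMn_comm _ c') ts st !expr1n.
by case: z => n; rewrite /=; case: (ks n); case: (ks n.+1).
Qed.
End Zpow.

Section DividedPowers.
Variables (d : nat) (p : 'I_d -> bool) (X : 'M[int]_d) (D : nat -> 'M[int]_d).
Hypothesis D_fact : forall n, (n`!%:Z) *: D n = X ^+ n.
Hypothesis X_nil : X ^+ d = 0.

Let fact_neq0 n : (n`!%:Z) != 0. Proof. by rewrite -lt0n fact_gt0. Qed.

Lemma dp0 : D 0 = 1.
Proof. by have := D_fact 0; rewrite fact0 scale1r. Qed.

Lemma dp_mull n : X * D n = n.+1%:Z *: D n.+1.
Proof.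
apply: (scale_intmx_inj (fact_neq0 n)); rewrite -sqmx_scaler D_fact -exprS -D_fact.
by rewrite factS PoszM scalerA mulrC.
Qed.

Lemma dp_mulr n : D n * X = n.+1%:Z *: D n.+1.
Proof.
apply: (scale_intmx_inj (fact_neq0 n)); rewrite -sqmx_scalel D_fact -exprSr -D_fact.
by rewrite factS PoszM scalerA mulrC.
Qed.

Lemma dp_big n : (d <= n)%N -> D n = 0.
Proof.
move=> le; apply: (scale_intmx_inj (fact_neq0 n)); rewrite D_fact scaler0.
by rewrite -(subnKC le) exprD X_nil mul0r.
Qed.

Lemma dp_block_diag n : block_diag p X -> block_diag p (D n).
Proof.
move=> hX; have hXn : block_diag p (X ^+ n).
  elim: n => [|n IH]; first exact: block_diag1.
  by rewrite exprS; apply: block_diagM.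
move=> i j ne; apply: (mulfI (fact_neq0 n)).
have := congr1 (fun M : 'M[int]_d => M i j) (D_fact n); rewrite mxE => ->.
by rewrite hXn // mulr0.
Qed.

(** The k-th divided power of ad X applied to M, expanded so that no denominator appears. *)
Definition dp_ad (M : 'M[int]_d) k : 'M[int]_d :=
  \sum_(n < k.+1) (-1) ^+ (k - n) *: (D n * M * D (k - n)%N).

(** Left and right multiplication by X give the term of index n the coefficients n and k + 1 - n,
    which add up to k + 1. *)
Lemma dp_adS M k : k.+1%:Z *: dp_ad M k.+1 = X * dp_ad M k - dp_ad M k * X.
Proof.
pose F n := (-1) ^+ (k.+1 - n) *: (D n * M * D (k.+1 - n)%N).
have e1 : X * dp_ad M k = \sum_(n < k.+2) n%:Z *: F n.
  rewrite big_ord_recl scale0r add0r mulr_sumr; apply: eq_bigr => n _.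
  rewrite /F /= subSS sqmx_scaler !mulrA dp_mull !sqmx_scalel.
  by rewrite !scalerA mulrC.
have e2 : dp_ad M k * X = - \sum_(n < k.+2) (k.+1 - n)%:Z *: F n.
  rewrite big_ord_recr /= subnn scale0r addr0 mulr_suml -sumrN; apply: eq_bigr => n _.
  have le : (n <= k)%N by rewrite -ltnS.
  rewrite /F sqmx_scalel -(mulrA _ _ X) dp_mulr sqmx_scaler subSn // exprS !scalerA -scaleNr.
  by congr (_ *: _); rewrite mulN1r mulrN opprK mulrC.
rewrite e1 e2 opprK -big_split /dp_ad scaler_sumr; apply: eq_bigr => n _ /=.
rewrite -scalerDl -PoszD subnKC //.
by rewrite -ltnS.
Qed.

Lemma dp_ad0 M : dp_ad M 0 = M.
Proof. by rewrite /dp_ad big_ord_recl big_ord0 addr0 /= expr0 scale1r dp0 mul1r mulr1. Qed.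

(** The identity commutes with X. With [dp_exp_conj] this makes exp(tX) and exp(-tX) inverse to each
    other. *)
Lemma dp_ad1 k : dp_ad 1 k = if k is 0 then 1 else 0.
Proof.
case: k => [|k]; first exact: dp_ad0.
elim: k => [|k IH].
  apply: (@scale_intmx_inj _ 1%:Z) => //; rewrite dp_adS.
  by rewrite dp_ad0 mulr1 mul1r subrr scaler0.
apply: (@scale_intmx_inj _ k.+2%:Z) => //; rewrite dp_adS.
by rewrite IH mulr0 mul0r subrr scaler0.
Qed.

Variables (k : comPzRingType) (A : comSuperalg k).
Local Notation sc := (@scaled_mx k A d).

Definition dp_exp (t : A) : 'M[A]_d := \sum_(n < d.+1) sc (t ^+ n) (D n).

Lemma dp_exp_conj (t : A) M : dp_exp t * sc 1 M * dp_exp (- t) =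
  \sum_(j < d.+1 + d.+1) sc (t ^+ j) (dp_ad M j).
Proof.
pose F n m := sc (t ^+ (n + m)) ((-1) ^+ m *: (D n * M * D m)).
have -> : dp_exp t * sc 1 M * dp_exp (- t) = \sum_(n < d.+1) \sum_(m < d.+1) F n m.
  rewrite /dp_exp !mulr_suml; apply: eq_bigr => n _; rewrite mulr_sumr.
  apply: eq_bigr => m _; rewrite !scM mulr1 /F scZr; congr (sc _ _).
  have -> : ((-1 : int) ^+ m)%:~R = (-1) ^+ m :> A by rewrite rmorphXn rmorphN1.
  by rewrite (exprNn t) exprD -mulrA (commr_sign (t ^+ m) m).
rewrite sum_antidiagonal => [|n m].
  apply: eq_bigr => j _; rewrite sc_sumr; apply: eq_bigr => n _.
  by rewrite /F subnKC // -ltnS.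
case/orP=> le; rewrite /F.
  by rewrite (dp_big (ltnW le)) !mul0r scaler0 /scaled_mx map_mx0 scaler0.
by rewrite (dp_big (ltnW le)) !mulr0 scaler0 /scaled_mx map_mx0 scaler0.
Qed.

Lemma dp_expV (t : A) : dp_exp t * dp_exp (- t) = 1.
Proof.
have := dp_exp_conj t 1; rewrite -[in LHS]/(1%:M : 'M[int]_d) sc11 mulr1 => ->.
rewrite addSn big_ord_recl big1 ?addr0 => [|j _]; last first.
  by rewrite dp_ad1 /scaled_mx map_mx0 scaler0.
by rewrite dp_ad1 expr0 -[1 : 'M[int]_d]/(1%:M) sc11.
Qed.

End DividedPowers.

(** * The Chevalley supergroup *)

Section ChevalleyGroup.
Variables (K : fieldType) (char_K : [pchar K] =i pred0).
Variables (g : lieSuperalg K) (c : chevData g).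
Hypothesis c_ok : chev_ok c.
Hypothesis not_P3 : ~ type_P g 3.
Local Notation h := (cd_h c).
Local Notation H := (cd_H c).
Local Notation l := (\dim h).
Local Notation X := (cd_X c).
Local Notation L := (lat (cd_h c) (cd_kind c)).
Local Notation roots_c := (Defs.roots c).
Implicit Types a b : L.
Variables (V : lieSupermod g) (V_faithful : faithful V) (d : nat) (e : d.-tuple V).
Variable p : 'I_d -> bool.
Hypothesis M_admissible : admissible c e p.
Let e_basis : basis_of fullv e. Proof. by case: M_admissible. Qed.
Let e_part i : tnth e i \in mpart V (p i). Proof. by case: M_admissible. Qed.
Local Notation rm := (rmx e).
Local Notation im := (@imx K d).
Variables (N : L -> 'M[int]_d) (T : 'I_l -> 'M[int]_d).
Hypothesis hN : forall a, a \in roots_c -> im (N a) = rm (X a).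
Hypothesis hT : forall i, im (T i) = rm (tnth H i).
Variable be : L -> {ffun 'I_l -> int}.
Hypothesis hbe : forall a, a \in roots_c -> forall i, wt a (tnth H i) = (be a i)%:~R.
Variables (P : 'M[K]_d) (mu : 'I_d -> hdual h) (z : 'I_d -> 'I_l -> int).
Variable Pi : {ffun 'I_l -> int} -> 'M[int]_d.
Hypothesis P_unit : P \in unitmx.
Hypothesis P_weight : forall j, in_weight (mu j) (vec e (row j P)).
Hypothesis mu_int : forall j i, ev (mu j) (tnth H i) = (z j i)%:~R.
Hypothesis PiP : weight_proj p P z Pi.

Lemma T_diag_op i : im (T i) = diag_op P (fun j => (z j i)%:~R).
Proof.
rewrite hT (rmx_diag M_admissible P_unit P_weight (H_in (cd_H_basis c_ok) i)).
by apply: eq_diag_op => j; apply: mu_int.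
Qed.

Variables (k : comPzRingType) (A : comSuperalg k) (tf2 : torsionfree A 2).
Local Notation part i x := (@sa_part k A i x).
Local Notation sc := (@scaled_mx k A d).
Local Notation E := 'M[A]_d.
Variable s : seq L.
Hypothesis s_uniq : uniq s.
Hypothesis s_odd : s =i cd_root c true.

Lemma sc_suml (I : Type) (r : seq I) (F : I -> A) M :
  sc (\sum_(q <- r) F q) M = \sum_(q <- r) sc (F q) M.
Proof. by rewrite /scaled_mx scaler_suml. Qed.

Definition even_mx (x : E) : Prop := (forall i j, part false (x i j)) /\ block_diag p x.

Definition odd_stable (x y : E) : Prop := forall a, a \in s ->
  exists2 al : L -> A, (forall b, part false (al b)) &
    x * map_mx intr (N a) * y = \sum_(b <- s) sc (al b) (N b).

(** The inverse is carried along, with the stability of the odd span under both conjugations, to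
    make the property closed under inversion. *)
Definition even_pair (x y : E) : Prop :=
  [/\ x * y = 1, y * x = 1, even_mx x /\ even_mx y & odd_stable x y /\ odd_stable y x].

Lemma even_mx1 : even_mx 1.
Proof.
split; last exact: block_diag1.
by move=> i j; rewrite !mxE; apply: sa_partMn; apply: sa_part1.
Qed.

Lemma even_mxM x y : even_mx x -> even_mx y -> even_mx (x * y).
Proof.
move=> [h1 h2] [h3 h4]; split; last exact: block_diagM.
move=> i j; rewrite mxE; apply: sa_part_sum => q _.
exact: (@sa_partM _ _ false false).
Qed.

Lemma even_mx_sc u M : part false u -> block_diag p M -> even_mx (sc u M).
Proof.
move=> hu hM; split=> i j; first by rewrite !mxE mulrzr; apply: sa_partMz.
by move=> ne; rewrite !mxE hM // mulr0.
Qed.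

Lemma even_mx_sum (I : Type) (r : seq I) (F : I -> E) :
  (forall q, even_mx (F q)) -> even_mx (\sum_(q <- r) F q).
Proof.
move=> hF; split; last by apply: block_diag_sum => q; case: (hF q).
by move=> i j; rewrite summxE; apply: sa_part_sum => q _; case: (hF q).
Qed.

Lemma even_mx_scale (u : A) (x M : E) : even_mx x -> x * (u *: M) = u *: (x * M).
Proof.
move=> [hx _]; apply/matrixP => i j; rewrite !mxE mulr_sumr; apply: eq_bigr => q _.
by rewrite !mxE !mulrA (even_central u (hx i q)).
Qed.

Lemma sum_single (u : A) a : a \in s -> \sum_(b <- s) sc (if b == a then u else 0) (N b) = sc u (N a).
Proof.
move=> sa; rewrite (bigD1_seq a) //= eqxx big1 ?addr0 // => b /negbTE->.
exact: sc0l.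
Qed.

Lemma odd_stable1 : odd_stable 1 1.
Proof.
move=> a sa; exists (fun b => if b == a then 1 else 0).
  by move=> b; case: ifP => _; [apply: sa_part1 | apply: sa_part0].
by rewrite mul1r mulr1 sum_single // /scaled_mx scale1r.
Qed.

Lemma odd_stableM x y x' y' : even_mx x -> odd_stable x y -> odd_stable x' y' ->
  odd_stable (x * x') (y' * y).
Proof.
move=> hx hxy hxy' a sa; have [al hal e1] := hxy' a sa.
have [be' hbe'] := @seq_choice L (L -> A) (fun=> 0) s (fun b al => 
  (forall b, part false (al b)) /\ x * map_mx intr (N b) * y = \sum_(b <- s) sc (al b) (N b)) 
  (fun b sb => let: ex_intro2 al h1 h2 := hxy b sb in ex_intro _ al (conj h1 h2)).
(* The chosen coefficients are known to be even only along s, whence the guard. *)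
exists (fun q => \sum_(b <- s) if b \in s then al b * be' b q else 0).
  move=> q; apply: sa_part_sum => b _; case: ifP => sb; last exact: sa_part0.
  by apply: (@sa_partM _ _ false false) => //; apply: (hbe' b sb).1.
have -> : x * x' * map_mx intr (N a) * (y' * y) = x * (x' * map_mx intr (N a) * y') * y.
  by rewrite !mulrA.
rewrite e1 mulr_sumr mulr_suml.
rewrite [RHS](eq_bigr _ (fun q _ => sc_suml _ _ (N q))).
rewrite exchange_big !big_seq; apply: eq_bigr => b sb /=; rewrite sb.
rewrite even_mx_scale // sqmx_scalel (hbe' b sb).2 scaler_sumr.
by apply: eq_bigr => q _; rewrite /scaled_mx scalerA.
Qed.

Lemma even_pair1 : even_pair 1 1.
Proof. by split; rewrite ?mulr1 //; split; (exact: even_mx1 || exact: odd_stable1). Qed.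

Lemma even_pairM x y x' y' : even_pair x y -> even_pair x' y' -> even_pair (x * x') (y' * y).
Proof.
move=> [h1 h2 [h3 h4] [h5 h6]] [h1' h2' [h3' h4'] [h5' h6']]; split.
- by rewrite mulrA -(mulrA x) h1' mulr1.
- by rewrite mulrA -(mulrA y') h2 mulr1.
- by split; apply: even_mxM.
- by split; apply: odd_stableM.
Qed.

Lemma even_pair_sym x y : even_pair x y -> even_pair y x.
Proof. by move=> [h1 h2 [h3 h4] [h5 h6]]; split. Qed.

Lemma even_mx_GL x i j : even_mx x -> sa_part (p i (+) p j) (x i j).
Proof.
move=> [h1 h2]; case: (eqVneq (p i) (p j)) => [->|ne]; first by rewrite addbb.
by rewrite h2 //; apply: sa_part0.
Qed.

Lemma inv_uniq (x y y' : E) : x * y = 1 -> y' * x = 1 -> y = y'.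
Proof. by move=> h1 h2; rewrite -[y]mul1r -h2 -mulrA h1 mulr1. Qed.

Lemma even_pair_subgroup : subgroup_GL p (fun x => exists y, even_pair x y).
Proof.
split.
- move=> x [y [h1 h2 [h3 _] _]]; split; first by move=> i j; apply: even_mx_GL.
  by exists y.
- by exists 1; apply: even_pair1.
- move=> x y [x' hx] [y' hy]; exists (x' * y').
  exact: (even_pairM hy hx).
- move=> x y [x' hx] xy yx; have [h1 h2 _ _] := hx.
  by exists x; rewrite (inv_uniq yx h2); apply: even_pair_sym.
Qed.

(** The element h_i(u), with u' the inverse of u, decomposed along the integral weight
    projections. *)
Definition torus_elt (u u' : A) i : E := \sum_(q <- weights z) sc (zpow u u' (q i)) (Pi q).

(** Only the blocks of M from q to q + w are nonzero, and the powers of t attached to both ends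
    leave the exponent - w i, the same for all q. *)
Lemma torus_conj (t t' : A) i (M : 'M[int]_d) (w : {ffun 'I_l -> int}) :
  part false t -> part false t' -> t * t' = 1 -> t' * t = 1 ->
  (forall q, Pi q * M = M * Pi (q + w)) ->
  torus_elt t t' i * sc 1 M * torus_elt t' t i = sc (zpow t' t (w i)) M.
Proof.
move=> ht ht' e1 e2 hM; rewrite /torus_elt mulr_suml mulr_suml.
have sumPi := weight_proj_sum char_K P_unit PiP.
have term (q q' : {ffun 'I_l -> int}) : sc (zpow t t' (q i)) (Pi q) * sc 1 M * sc (zpow t' t (q' i)) (Pi q') =
    sc (zpow t' t (w i)) (Pi q * M * Pi q').
  rewrite !scM mulr1; have eq0 : Pi q * M * Pi q' = if q + w == q' then Pi q * M else 0.
    rewrite hM -mulrA (weight_projM char_K P_unit PiP).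
    by case: eqP => [->|]; rewrite ?mulr0.
  rewrite eq0; case: eqP => [<-|_]; last by rewrite /scaled_mx map_mx0 !scaler0.
  by rewrite ffunE (zpowD e2 e1) mulrA zpowK // mul1r.
transitivity (\sum_(q <- weights z) sc (zpow t' t (w i)) (Pi q * M)).
  apply: eq_bigr => q _; rewrite mulr_sumr (eq_bigr _ (fun q' _ => term q q')).
  by rewrite -sc_sumr -mulr_sumr sumPi mulr1.
by rewrite -sc_sumr -mulr_suml sumPi mul1r.
Qed.

Lemma torus_even_pair (t t' : A) i : part false t -> part false t' -> t * t' = 1 -> t' * t = 1 ->
  even_pair (torus_elt t t' i) (torus_elt t' t i).
Proof.
move=> ht ht' e1 e2.
have sc1 : sc 1 1 = 1 by apply: sc11.
have mul1 u u' : part false u -> part false u' -> u * u' = 1 -> u' * u = 1 ->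
    torus_elt u u' i * torus_elt u' u i = 1.
  move=> hu hu' e3 e4; have := @torus_conj u u' i 1 0 hu hu' e3 e4.
  rewrite sc1 mulr1 ffunE /= expr0 sc1; apply=> q.
  by rewrite addr0 mul1r mulr1.
have good u u' : part false u -> part false u' -> even_mx (torus_elt u u' i).
  move=> hu hu'; apply: even_mx_sum => q; apply: even_mx_sc.
    exact: zpow_even.
  exact: (PiP q).1.
have stab u u' : part false u -> part false u' -> u * u' = 1 -> u' * u = 1 ->
    odd_stable (torus_elt u u' i) (torus_elt u' u i).
  move=> hu hu' e3 e4 a sa; have ra := cd_rootW (etrans (esym (s_odd a)) sa : a \in cd_root c true).
  exists (fun b => if b == a then zpow u' u (be a i) else 0).
    by move=> b; case: ifP => _; [exact: zpow_even | exact: sa_part0].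
  rewrite sum_single // -(@torus_conj u u') //; first by rewrite /scaled_mx scale1r.
  move=> q; apply: (weight_proj_comm char_K P_unit T_diag_op PiP) => j.
  exact: (N_weight char_K c_ok M_admissible hN hT hbe j ra).
by split; [exact: mul1 | exact: mul1 | split; exact: good | split; exact: stab].
Qed.

Lemma int_vec (m : 'rV[int]_d) : \sum_j tnth e j *~ m 0 j = vec e (map_mx intr m).
Proof. by rewrite /vec; apply: eq_bigr => j _; rewrite mxE -scaler_int. Qed.

(** The rows of a weight projection are weight vectors of M, on which x acts by the prescribed power
    of t; as the projections add up to 1, this determines x. *)
Lemma h_set_torus i (x : E) : h_set (c := c) e i x -> exists t t',
  [/\ part false t, part false t', t * t' = 1, t' * t = 1 & x = torus_elt t t' i].
Proof.
move=> [t [t' [ht ht' e1 e2 hx]]]; exists t, t'; split=> //.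
have key (q : {ffun 'I_l -> int}) : q \in weights z -> map_mx intr (Pi q) * x = sc (zpow t t' (q i)) (Pi q).
  rewrite mem_undup => /mapP[j _ eq]; apply/row_matrixP => r.
  have := hx (mu j) (q i) (row r (Pi q)); rewrite /amx map_row -row_mul => ->.
  - by rewrite /scaled_mx linearZ.
  - move=> y hy; rewrite int_vec map_row (lfun_vec e_basis) -vecZ; congr vec.
    rewrite -row_mul -[map_mx _ _]/(im (Pi q)) (PiP q).2 -/(rm y) (rmx_diag M_admissible P_unit P_weight hy) mulmxE.
    rewrite (diag_opM P_unit).
    have -> : diag_op P (fun j0 => (weight z j0 == q)%:R * ev (mu j0) y) =
        ev (mu j) y *: diag_op P (fun j0 => (weight z j0 == q)%:R).
      rewrite /diag_op scalemxAl scalemxAr; congr (_ *m _ *m _).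
      apply/matrixP => r1 r2; rewrite !mxE mulrnAr; congr (_ *+ _).
      case: eqP => [e0|_]; last by rewrite mul0r mulr0.
      rewrite mul1r mulr1 !(ev_coord (cd_H_basis c_ok) _ hy); apply: eq_bigr => j1 _.
      rewrite !mu_int; congr (_ * _%:~R).
      by have /ffunP/(_ j1) := etrans e0 eq; rewrite !ffunE.
    by rewrite linearZ.
  by rewrite mu_int eq ffunE.
rewrite -[x]mul1r -(@sc11 _ A d) -[1%:M]/(1 : 'M[int]_d).
rewrite -(weight_proj_sum char_K P_unit PiP) sc_sumr mulr_suml /torus_elt !big_seq.
by apply: eq_bigr => q wq; rewrite -key // /scaled_mx scale1r.
Qed.

Lemma zpow_dual_number (u : A) w : u * u = 0 -> zpow (1 + u) (1 - u) w = 1 + u * w%:~R.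
Proof.
move=> uu; have pw n : forall v : A, v * v = 0 -> (1 + v) ^+ n = 1 + v * n%:R.
  move=> v vv; elim: n => [|n IH]; first by rewrite mulr0 addr0.
  rewrite exprS IH mulrDl mul1r mulrDr mulr1 mulrA vv mul0r addr0 -natr1 mulrDr mulr1.
  by rewrite addrA.
case: w => n /=; first by rewrite pw.
by rewrite pw ?mulrNN // NegzE mulrNz mulrN mulNr.
Qed.

(** This is h_i(1 + u): when u has square zero, 1 + u has inverse 1 - u and its z-th power is 1 + z
    u. *)
Lemma h_set_dual (u : A) i : part false u -> u * u = 0 -> h_set (c := c) e i (1 + sc u (T i)).
Proof.
move=> hu uu; exists (1 + u), (1 - u); split.
- by apply: sa_partD => //; apply: sa_part1.
- by apply: sa_partB => //; apply: sa_part1.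
- by rewrite mulrDl mul1r mulrBr mulr1 uu subr0 subrK.
- by rewrite mulrBl mul1r mulrDr mulr1 uu addr0 addrK.
move=> nu w m hm hw; rewrite zpow_dual_number // mulmxDr mulmx1 scalerDl scale1r; congr (_ + _).
have eT : m *m T i = w *: m.
  have := hm _ (H_in (cd_H_basis c_ok) i); rewrite int_vec hw (lfun_vec e_basis) -vecZ.
  move/(vec_inj e_basis); rewrite -/(rm _) -hT -map_mxM -map_mxZ => /matrixP E1.
  by apply/matrixP => r j; apply: (intK_inj char_K); have := E1 r j; rewrite !mxE.
have -> : amx A m *m sc u (T i) = u *: amx A (m *m T i).
  apply/matrixP => r j; rewrite !mxE rmorph_sum mulr_sumr; apply: eq_bigr => q _.
  by rewrite !mxE rmorphM /= !mulrA -(com_int u).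
by rewrite eT; apply/matrixP => r j; rewrite !mxE rmorphM /= mulrA.
Qed.


Section RootSubgroup.
Variables (a : L) (D : nat -> 'M[int]_d).
Hypothesis ra : a \in cd_root c false.
Hypothesis hD : forall n, int_mx e (div_power (rho V (X a)) n) (D n).

Let rra : a \in roots_c := cd_rootW ra.

Lemma dp_fact n : (n`!%:Z) *: D n = N a ^+ n.
Proof.
apply: (imx_inj char_K); rewrite imxZ -((int_mxP e_basis _ _).1 (hD n)).
rewrite /div_power lfun_mxZ // lfun_mx_power // scalerA divff ?scale1r ?natK_eq0 -?lt0n ?fact_gt0 //.
rewrite -/(rm _) -hN //; elim: n => [|n IH]; first by rewrite !expr0 imx1.
by rewrite !exprS imxM IH.
Qed.

Lemma N_nilpotent : N a ^+ d = 0.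
Proof.
apply: (weight_nilpotent char_K P_unit T_diag_op (b := be a)) => [i|].
  exact: (N_weight char_K c_ok M_admissible hN hT hbe i rra).
exact: (be_neq0 char_K c_ok hbe ra).
Qed.

(** The divided powers of ad X_a keep N b in the image of g_1 while being integral on M, which is
    the situation of [saturation]. *)
Lemma dp_ad_odd b n : b \in s -> exists2 x, x \in Defs.part g true & rm x = im (dp_ad D (N b) n).
Proof.
rewrite s_odd => rb; elim: n => [|n [x px ex]].
  exists (X b); first exact: X_part.
  by rewrite (dp_ad0 dp_fact) hN // (cd_rootW rb).
exists (n.+1%:R^-1 *: br x (X a)).
  by apply: memvZ; apply: (br_part (i := true) (j := false) px); apply: X_part.
have n0 : (n.+1%:R : K) != 0 by rewrite natK_eq0.
rewrite rmxZ // (rmx_br e_basis px (X_part char_K c_ok ra)) expr0 scale1r ex -hN //.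
by rewrite -!imxM -imxB -(dp_adS dp_fact) imxZ scalerA mulVf ?scale1r.
Qed.

Lemma exp_even_pair (t : A) : part false t -> even_pair (dp_exp D t) (dp_exp D (- t)).
Proof.
have good u : part false u -> even_mx (dp_exp D u).
  move=> hu; apply: even_mx_sum => n; apply: even_mx_sc; first exact: sa_partX.
  exact: (dp_block_diag dp_fact n (N_even char_K c_ok M_admissible hN ra)).
have stab u : part false u -> odd_stable (dp_exp D u) (dp_exp D (- u)).
  move=> hu b sb.
  have [w hw] := @seq_choice nat (L -> int) (fun=> 0) (iota 0 (d.+1 + d.+1))
    (fun n w => dp_ad D (N b) n = \sum_(q <- s) w q *: N q)
    (fun n _ => let: ex_intro2 x px ex := dp_ad_odd n sb in
      saturation char_K c_ok not_P3 V_faithful M_admissible hN hT hbe P_unit T_diag_op PiP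
        s_uniq s_odd px ex).
  exists (fun q => \sum_(n < d.+1 + d.+1) u ^+ n * (w n q)%:~R).
    by move=> q; apply: sa_part_sum => n _; rewrite mulrzr; apply: sa_partMz; apply: sa_partX.
  have := dp_exp_conj dp_fact N_nilpotent u (N b); rewrite {1}/scaled_mx scale1r => ->.
  rewrite [RHS](eq_bigr _ (fun q _ => sc_suml _ _ (N q))) exchange_big /=.
  apply: eq_bigr => n _; rewrite hw ?mem_iota ?ltn_ord // sc_sumr.
  by apply: eq_bigr => q _; rewrite scZr.
move=> ht; have hnt := sa_partN ht; split.
- exact: (dp_expV dp_fact N_nilpotent).
- by rewrite -{2}[t]opprK; apply: (dp_expV dp_fact N_nilpotent).
- by split; apply: good.
- by split; [exact: stab | rewrite -{2}[t]opprK; exact: stab].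
Qed.

Lemma dp_exp_dual (u : A) : u * u = 0 -> dp_exp D u = 1 + sc u (N a).
Proof.
move=> uu; rewrite /dp_exp big_ord_recl expr0 (dp0 dp_fact) -[1 : 'M[int]_d]/(1%:M) sc11.
congr (_ + _); have D1 : D 1 = N a by rewrite -[LHS]scale1r (dp_fact 1) expr1.
(* For d = 0 the truncated sum has no term of degree one; then N a is an empty matrix, hence
   zero. *)
have [d0|d_gt0] := posnP d.
  rewrite big1 => [|n _]; last by have := ltn_ord n; rewrite [X in (_ < X)%N]d0.
  have e0 : N a ^+ d = 1 by rewrite -(expr0 (N a)); congr (_ ^+ _).
  by rewrite -[N a]mul1r -e0 N_nilpotent mul0r /scaled_mx map_mx0 scaler0.
rewrite (bigD1 (Ordinal d_gt0)) //= expr1 D1 big1 ?addr0 // => n nn.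
have : (0 < n)%N by rewrite lt0n; apply: contraNneq nn => n0; apply/eqP/val_inj.
by case: (nat_of_ord n) => // m _; rewrite /bump /= add1n !exprS mulrA uu mul0r sc0l.
Qed.
End RootSubgroup.

(** Equality of matrices is decidable and integer matrices form a choice type, so the infinite
    sequence is chosen without an axiom. *)
Lemma divided_powers_exist a : a \in cd_root c false -> exists D : nat -> 'M[int]_d,
  forall n, int_mx e (div_power (rho V (X a)) n) (D n).
Proof.
move=> ra; have ex n : exists M : 'M[int]_d, lfun_mx e (div_power (rho V (X a)) n) == im M.
  by have [M hM] := kostant_int M_admissible (kostant_X V n ra); exists M; apply/eqP.
exists (fun n => xchoose (ex n)) => n; apply/(int_mxP e_basis); apply/eqP.
exact: (xchooseP (ex n)).
Qed.

Local Notation G0A := (@G0 K g c V d e p k A).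

Lemma G0_even_pair x : G0A x -> exists y, even_pair x y.
Proof.
move=> hx; apply: (hx (fun x => exists y, even_pair x y)); first exact: even_pair_subgroup.
move=> y [[i /h_set_torus[t [t' [ht ht' e1 e2 ->]]]]|[a ra [t ht [D hD ->]]]].
  by exists (torus_elt t' t i); apply: torus_even_pair.
by exists (dp_exp D (- t)); apply: (exp_even_pair ra hD ht).
Qed.

Lemma G0_unit : G0A 1.
Proof. by move=> Q [_ h1 _ _] _; exact: h1. Qed.

Lemma G0_mul x y : G0A x -> G0A y -> G0A (x * y).
Proof.
by move=> hx hy Q hQ hS; have [_ _ hM _] := hQ; apply: (hM y x); [apply: hy | apply: hx].
Qed.

Lemma G0_inv x : G0A x -> exists y, [/\ G0A y, x * y = 1 & y * x = 1].
Proof.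
move=> hx; have [y [h1 h2 _ _]] := G0_even_pair hx; exists y; split=> //.
by move=> Q hQ hS; have [_ _ _ hV] := hQ; apply: (hV x y) => //; apply: hx.
Qed.

Lemma G0_conj x y a : G0A x -> x * y = 1 -> y * x = 1 -> a \in s ->
  exists2 al : L -> A, (forall b, part false (al b)) &
    x * map_mx intr (N a) * y = \sum_(b <- s) sc (al b) (N b).
Proof.
move=> /G0_even_pair[y' [h1 h2 _ [hs _]]] xy yx sa.
by rewrite (inv_uniq xy h2); apply: hs.
Qed.

(** As u has square zero, 1 + u Y turns differences of Y into products, so the generators of the
    lattice suffice. *)
Lemma G0_dual (u : A) Y : part false u -> u * u = 0 -> even_lattice N T Y -> G0A (1 + sc u Y).
Proof.
move=> hu uu hY; elim: hY u hu uu => [|i|a ra|Z Z' _ IH _ IH'] u hu uu.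
- by rewrite /scaled_mx map_mx0 scaler0 addr0; apply: G0_unit.
- move=> Q hQ hS; apply: hS; left; exists i; exact: h_set_dual.
- have [D hD] := divided_powers_exist ra.
  rewrite -(dp_exp_dual ra hD uu) => Q hQ hS; apply: hS; right; exists a => //.
  by exists u => //; exists D.
have -> : 1 + sc u (Z - Z') = (1 + sc u Z) * (1 + sc (- u) Z').
  rewrite scBr mulrDl mul1r mulrDr mulr1 scM mulrN uu oppr0 sc0l addr0 scNl.
  by rewrite -addrA; congr (_ + _); rewrite addrC.
apply: G0_mul; first exact: IH.
by apply: IH'; [exact: sa_partN | rewrite mulrNN].
Qed.

End ChevalleyGroup.

(** * The factorization *)

Section Factorization.
Variables (K : fieldType) (char_K : [pchar K] =i pred0).
Variables (g : lieSuperalg K) (c : chevData g).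
Hypothesis c_ok : chev_ok c.
Hypothesis not_P3 : ~ type_P g 3.
Local Notation h := (cd_h c).
Local Notation H := (cd_H c).
Local Notation l := (\dim h).
Local Notation X := (cd_X c).
Local Notation L := (lat (cd_h c) (cd_kind c)).
Local Notation roots_c := (Defs.roots c).
Implicit Types a b : L.
Variables (V : lieSupermod g) (V_faithful : faithful V) (d : nat) (e : d.-tuple V).
Variable p : 'I_d -> bool.
Hypothesis V_rational : rational c V.
Hypothesis M_admissible : admissible c e p.
Let e_basis : basis_of fullv e. Proof. by case: M_admissible. Qed.
Local Notation im := (@imx K d).
Variable N : L -> 'M[int]_d.
Hypothesis hN : forall a, a \in roots_c -> im (N a) = rmx e (X a).
Variables (k : comPzRingType) (A : comSuperalg k) (tf2 : torsionfree A 2).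
Local Notation part i x := (@sa_part k A i x).
Local Notation sc := (@scaled_mx k A d).
Local Notation E := 'M[A]_d.
Local Notation G0A := (@G0 K g c V d e p k A).
Local Notation GA := (@G K g c V d e p k A).

(** The interface between the integral form and the factorization: the choices of a weight basis,
    projections and root weights stay hidden behind its existence. *)
Record G0_facts (s : seq L) (ev : 'M[int]_d -> Prop) : Prop := G0Facts {
  G0_facts_br : forall Y Y', ev Y -> ev Y' -> ev (Y * Y' - Y' * Y);
  G0_facts_odd : forall Y a, ev Y -> a \in s -> exists z : L -> int,
    Y * N a - N a * Y = \sum_(b <- s) z b *: N b;
  G0_facts_oo : forall a b, a \in s -> b \in s -> ev (N a * N b + N b * N a);
  G0_facts_sq : forall a, a \in s -> ev (N a * N a);
  G0_facts_sq_int : forall a, a \in s -> N a * N a = 0 \/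
    (a + a \in cd_root c false /\ exists t : int, N a * N a = t *: N (a + a));
  G0_facts_dual : forall b, b \in s -> exists C : 'M[int]_d,
    forall a, a \in s -> \tr (C *m N a) = (a == b)%:R;
  G0_facts_inv : forall x, G0A x -> exists y, [/\ G0A y, x * y = 1 & y * x = 1];
  G0_facts_ev : forall (u : A) Y, part false u -> u * u = 0 -> ev Y -> G0A (1 + sc u Y);
  G0_facts_even : forall x, G0A x -> even_mx p x;
  G0_facts_conj : forall x y a, G0A x -> x * y = 1 -> y * x = 1 -> a \in s ->
    exists2 al : L -> A, (forall b, part false (al b)) &
      x * map_mx intr (N a) * y = \sum_(b <- s) sc (al b) (N b)
}.

Lemma G0_facts_exist s : uniq s -> s =i cd_root c true -> exists ev, G0_facts s ev.
Proof.
move=> s_uniq s_odd.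
have H_basis := cd_H_basis c_ok.
have [P [mu [z [P_unit P_weight mu_int]]]] := weight_basis_exists V_rational M_admissible.
have [T hT] := T_exists M_admissible.
have T_diag := T_diag_op c_ok M_admissible hT P_unit P_weight mu_int.
have T_bin := binom_exists char_K (cd_h_even c_ok) H_basis M_admissible P_unit P_weight mu_int.
have [Pi PiP] := weight_proj_exists char_K P_unit T_bin.
have [be hbe] := root_weight_exists char_K c_ok V_faithful M_admissible hN hT.
have rs a : a \in s -> a \in cd_root c true by rewrite s_odd.
exists (even_lattice N T); split.
- exact: (ev_br char_K c_ok V_faithful M_admissible hN hT hbe).
- exact: (ev_odd char_K c_ok not_P3 V_faithful M_admissible hN hT hbe P_unit T_diag PiP s_uniq s_odd).
- move=> a b /rs ra /rs rb; exact: (odd_odd char_K c_ok V_faithful M_admissible hN hT ra rb).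
- move=> a /rs ra; exact: (odd_sq char_K c_ok V_faithful M_admissible T hN ra).
- move=> a /rs ra; exact: (odd_sq_int char_K c_ok V_faithful M_admissible hN ra).
- exact: (N_dual char_K c_ok not_P3 V_faithful M_admissible hN hT hbe P_unit T_diag PiP s_odd).
- exact: (G0_inv char_K c_ok not_P3 V_faithful M_admissible hN hT hbe P_unit P_weight mu_int PiP s_uniq s_odd).
- exact: (G0_dual char_K c_ok M_admissible hN hT hbe P_unit P_weight mu_int).
- move=> x hx; have [y [_ _ [hy _] _]] := G0_even_pair char_K c_ok not_P3 V_faithful M_admissible hN hT hbe
    P_unit P_weight mu_int PiP s_uniq s_odd hx.
  exact: hy.
exact: (G0_conj char_K c_ok not_P3 V_faithful M_admissible hN hT hbe P_unit P_weight mu_int PiP s_uniq s_odd).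
Qed.


Local Notation oprod r th := (@odd_prod k A d L N r th).

Definition super_mx (x : E) : Prop := forall i j, sa_part (p i (+) p j) (x i j).

Lemma super_mxM x y : super_mx x -> super_mx y -> super_mx (x * y).
Proof.
move=> hx hy i j; rewrite mxE; apply: sa_part_sum => q _.
have := sa_partM (hx i q) (hy q j).
by rewrite addbA -(addbA (p i)) addbb addbF.
Qed.

Lemma super_letter u a : part true u -> a \in cd_root c true -> super_mx (1 + sc u (N a)).
Proof.
move=> hu ra i j; rewrite !mxE; case: (eqVneq (p i) (p j)) => pij.
  rewrite (N_odd char_K c_ok M_admissible hN ra pij) mulr0 addr0 pij addbb.
  by apply: sa_partMn; apply: sa_part1.
rewrite (_ : i == j = false) ?mulr0n ?add0r; last by apply: contraNF pij => /eqP->.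
have -> : p i (+) p j = true by case: (p i) (p j) pij => [] [].
by rewrite mulrzr; apply: sa_partMz.
Qed.

Lemma x_even_mul b (D : nat -> 'M[int]_d) (t : A) : b \in cd_root c false ->
  (forall n, int_mx e (div_power (rho V (X b)) n) (D n)) -> part false t -> G0A (dp_exp D t).
Proof.
move=> rb hD ht Q hQ hS; apply: hS; right; exists b => //; exists t => //.
by exists D.
Qed.

(** The square of X_a is zero or t times the root vector of 2a; in the latter case its divided
    powers are t^n D n, and its exponential at u is x_{2a}(u t). *)
Lemma square_exp a : a \in cd_root c true ->
  (N a * N a = 0 \/ (a + a \in cd_root c false /\ exists t : int, N a * N a = t *: N (a + a))) ->
  exists D : nat -> 'M[int]_d,
  (forall n, int_mx e (div_power (rho V (X a) \o rho V (X a))%VF n) (D n)) /\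
  forall t : A, part false t -> G0A (dp_exp D t).
Proof.
move=> ra hsq.
have esq n : lfun_mx e (div_power (rho V (X a) \o rho V (X a))%VF n) =
    (n`!%:R)^-1 *: im (N a * N a) ^+ n.
  rewrite /div_power lfun_mxZ // lfun_mx_power // lfun_mx_comp // -/(rmx e _) -hN ?(cd_rootW ra) //.
  by rewrite imxM.
case: hsq => [N0|[raa [t et]]].
  exists (fun n => if n is 0 then 1 else 0); split=> [n|t ht].
    apply/(int_mxP e_basis); rewrite esq N0 imx0; case: n => [|n].
      by rewrite expr0 fact0 invr1 scale1r imx1.
    by rewrite exprS mul0r scaler0 imx0.
  rewrite /dp_exp big_ord_recl expr0 big1 ?addr0 => [|n _].
    by rewrite -[1 : 'M[int]_d]/(1%:M) sc11; apply: G0_unit.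
  by rewrite /= /scaled_mx map_mx0 scaler0.
have [D hD] := divided_powers_exist M_admissible raa.
exists (fun n => t ^+ n *: D n); split=> [n|u hu].
  apply/(int_mxP e_basis); rewrite esq et imxZ imxZ -((int_mxP e_basis _ _).1 (hD n)).
  rewrite /div_power lfun_mxZ // lfun_mx_power // -/(rmx e _) -hN ?(cd_rootW raa) // !scalerA.
  have -> (M : 'M[K]_d) : (t%:~R *: M) ^+ n = (t%:~R) ^+ n *: M ^+ n.
    elim: n => [|n IH]; first by rewrite !expr0 scale1r.
    by rewrite !exprS IH sqmx_scalel sqmx_scaler scalerA.
  by rewrite scalerA rmorphXn mulrC.
rewrite (_ : dp_exp _ u = dp_exp D (u * t%:~R)).
  by apply: (x_even_mul raa hD); rewrite mulrzr; apply: sa_partMz.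
apply: eq_bigr => n _; rewrite scZr; congr (scaled_mx _ _).
rewrite exprMn_comm; last by rewrite /GRing.comm com_int.
by rewrite -rmorphXn.
Qed.

Section ForList.
Variables (s : seq L) (s_uniq : uniq s) (s_odd : s =i cd_root c true).
Variables (ev : 'M[int]_d -> Prop) (F : G0_facts s ev).

Local Notation factoredA := (@factored k A d L N s G0A).

Let G0_even x i j : G0A x -> part false (x i j).
Proof. by move=> hx; case: (G0_facts_even F hx). Qed.

Let rs a : a \in s -> a \in cd_root c true. Proof. by rewrite s_odd. Qed.

Let factM x y : factoredA x -> factoredA y -> factoredA (x * y).
Proof. exact: (factoredM tf2 (@G0_mul _ _ _ _ _ _ _ _ _) (G0_facts_inv F) G0_even (G0_facts_conj F)). Qed.

Let factV x : factoredA x -> exists y, [/\ factoredA y, x * y = 1 & y * x = 1].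
Proof. exact: (factoredV tf2 (@G0_unit _ _ _ _ _ _ _ _ _) (@G0_mul _ _ _ _ _ _ _ _ _) (G0_facts_inv F) G0_even (G0_facts_conj F)). Qed.

Lemma factored_super x : factoredA x -> super_mx x.
Proof.
move=> [r [x0 [hr hx0 ->]]]; apply: super_mxM; last first.
  by move=> i j; apply: even_mx_GL; apply: (G0_facts_even F).
elim: r hr => [|[u a] r IH] hr.
  by rewrite /list_prod big_nil => i j; apply: even_mx_GL; apply: even_mx1.
rewrite list_prod_cons; apply: super_mxM.
  by have [h1 h2] := hr _ (mem_head _ _); apply: super_letter => //; apply: rs.
by apply: IH => q qr; apply: hr; rewrite inE qr orbT.
Qed.

Lemma factored_subgroup : subgroup_GL p factoredA.
Proof.
split.
- move=> x hx; split; first exact: factored_super.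
  by have [y [_ h1 h2]] := factV hx; exists y.
- exact: (factored_G0 N s (@G0_unit _ _ _ _ _ _ _ _ _)).
- by move=> x y hx hy; apply: factM.
- move=> x y hx xy yx; have [y' [hy' h1 h2]] := factV hx.
  by rewrite (inv_uniq yx h2).
Qed.

Lemma odd_letter_x_odd u a : part true u -> a \in s -> x_odd e a (1 + sc u (N a)).
Proof.
move=> hu sa; have ra := rs sa; have rra := cd_rootW ra.
have one : is_one_plus e (rho V (X a)) u (1 + sc u (N a)).
  by exists (N a) => //; apply/(int_mxP e_basis); rewrite -/(rmx e _) -hN.
rewrite /x_odd; case: ifP => _; last by exists u.
have [D [hD _]] := square_exp ra (G0_facts_sq_int F sa).
(* When 2a is a root, the odd letter is the element x_a(0, u). *)
exists 0, u, (1 + sc u (N a)), 1; split=> //; first exact: sa_part0.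
  exists D => //; rewrite big_ord_recl expr0 scale1r big1 ?addr0 => [|n _]; last first.
    by rewrite exprS mul0r scale0r.
  have -> : D (ord0 : 'I_d.+1) = 1%:M.
    apply: (imx_inj char_K); rewrite -((int_mxP e_basis _ _).1 (hD _)) /div_power /=.
    by rewrite fact0 invr1 scale1r lfun_mx1 // -[RHS]/(im 1) imx1.
  by rewrite /amx map_mx1.
by rewrite /gmul mul1mx.
Qed.

Lemma G_gen_factored x : G0A x \/ (exists2 a, a \in cd_root c true & x_odd e a x) -> factoredA x.
Proof.
case=> [hx|[a ra]]; first exact: factored_G0.
have sa : a \in s by rewrite s_odd.
have one u y : part true u -> is_one_plus e (rho V (X a)) u y -> y = 1 + sc u (N a).
  move=> hu [M /(int_mxP e_basis) hM ->]; congr (1 + u *: map_mx _ _).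
  by apply: (imx_inj char_K); rewrite -hM hN // (cd_rootW ra).
rewrite /x_odd; case: ifP => _.
  move=> [t [u [y [w [ht hu /(one _ _ hu) -> [D hD ->] ->]]]]].
  rewrite /gmul mulmxE; apply: factM; last exact: (factored_odd N (@G0_unit _ _ _ _ _ _ _ _ _) hu sa).
  apply: factored_G0; have [D' [hD' hG]] := square_exp ra (G0_facts_sq_int F sa).
  have -> : \sum_(n < d.+1) t ^+ n *: amx A (D n) = dp_exp D' t; last exact: hG.
  apply: eq_bigr => n _; congr (_ *: map_mx _ _); apply: (imx_inj char_K).
  by rewrite -((int_mxP e_basis _ _).1 (hD n)) ((int_mxP e_basis _ _).1 (hD' n)).
by move=> [u hu /(one _ _ hu) ->]; apply: (factored_odd N (@G0_unit _ _ _ _ _ _ _ _ _) hu sa).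
Qed.

Lemma G_factored x : GA x -> factoredA x.
Proof. by move=> hx; apply: (hx factoredA factored_subgroup) => y; apply: G_gen_factored. Qed.

Lemma G0_sub_G x : G0A x -> GA x.
Proof. by move=> hx Q hQ hS; apply: hS; left. Qed.

Lemma G_mul x y : GA x -> GA y -> GA (x * y).
Proof.
by move=> hx hy Q hQ hS; have [_ _ hM _] := hQ; apply: (hM y x); [apply: hy | apply: hx].
Qed.

Lemma G_inv x : GA x -> exists y, [/\ GA y, x * y = 1 & y * x = 1].
Proof.
move=> hx; have [y [_ h1 h2]] := factV (G_factored hx); exists y; split=> //.
by move=> Q hQ hS; have [_ _ _ hV] := hQ; apply: (hV x y) => //; apply: hx.
Qed.

Lemma oprod_G r th : {subset r <= s} -> (forall a, a \in r -> part true (th a)) -> GA (oprod r th).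
Proof.
rewrite /odd_prod; elim: r => [|a r IH] rsub hth.
  by rewrite big_nil; apply: G0_sub_G; apply: G0_unit.
have [sa tha] : a \in s /\ part true (th a).
  by split; [apply: rsub | apply: hth]; rewrite mem_head.
rewrite big_cons; apply: G_mul.
  by move=> Q hQ hS; apply: hS; right; exists a; [apply: rs | apply: odd_letter_x_odd].
by apply: IH => b br; [apply: rsub | apply: hth]; rewrite inE br orbT.
Qed.

Lemma G_sorted x : GA x -> exists x0 th, [/\ G0A x0, forall a, part true (th a) & x = x0 * oprod s th].
Proof.
move/G_factored; apply: (factored_sorted tf2 s_uniq (G0_facts_br F) (G0_facts_odd F)
  (G0_facts_oo F) (G0_facts_sq F) (@G0_unit _ _ _ _ _ _ _ _ _) (@G0_mul _ _ _ _ _ _ _ _ _) (G0_facts_inv F)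
  (G0_facts_ev F) G0_even (G0_facts_conj F)).
Qed.

Lemma G_sorted_inj x0 x0' th th' : G0A x0 -> G0A x0' ->
  (forall a, a \in s -> part true (th a)) -> (forall a, a \in s -> part true (th' a)) ->
  x0 * oprod s th = x0' * oprod s th' -> {in s, th =1 th'}.
Proof.
move=> h0 h0' hth hth' E0; have [y [hy h1 h2]] := G0_facts_inv F h0'.
apply: (odd_prod_inj tf2 s_uniq (p := p) _ (G0_facts_dual F) (g := y * x0)) => //.
- by move=> a i j sa; apply: (N_odd char_K c_ok M_admissible hN (rs sa)).
- by case: (G0_facts_even F (G0_mul hy h0)).
- by rewrite -mulrA E0 mulrA h2 mul1r.
Qed.

End ForList.

Definition odd_set (r : seq L) (y : E) : Prop :=
  exists2 th : L -> A, (forall a, a \in r -> part true (th a)) & y = oprod r th.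

(** The list is reversed because [gmul] is the opposite of the matrix product. The integer matrices
    occurring in [G1] agree with N, as both represent X_a. *)
Lemma G1_odd_set r y : {subset r <= cd_root c true} -> G1 e r y <-> odd_set (rev r) y.
Proof.
move=> rs; have fold (th : L -> A) (N' : L -> 'M[int]_d) :
    foldr (@gmul d k A) 1%:M [seq 1%:M + th a *: amx A (N' a) | a <- r] = oprod (rev r) th \/
    ~ {in r, N' =1 N}.
  have [eN|ne] := boolP (all (fun a => N' a == N a) r); last first.
    by right=> h; case/negP: ne; apply/allP => a ra; rewrite h.
  left; elim: r {rs} eN => [|a r IH] /=; first by rewrite /odd_prod /rev big_nil.
  case/andP => /eqP ea /IH ->; rewrite /odd_prod rev_cons -cats1 big_cat big_seq1 ea.
  by rewrite /gmul mulmxE.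
split=> [[N' [th [hN' hth ->]]]|[th hth ->]].
  exists th; first by move=> a; rewrite mem_rev; apply: hth.
  case: (fold th N') => // ne; case: ne => a ra; apply: (imx_inj char_K).
  by rewrite hN ?(cd_rootW (rs a ra)) // -((int_mxP e_basis _ _).1 (hN' a ra)).
exists N, th; split=> [a ra|a ra|].
- by apply/(int_mxP e_basis); rewrite hN ?(cd_rootW (rs a ra)).
- by apply: hth; rewrite mem_rev.
by case: (fold th N) => // ne; case: ne => a ra.
Qed.

Section TwoLists.
Variables r1 r2 : seq L.
Hypothesis r_uniq : uniq (r1 ++ r2).
Hypothesis r_odd : r1 ++ r2 =i cd_root c true.

Lemma odd_set_cat y1 y2 : odd_set r1 y1 -> odd_set r2 y2 -> exists th : L -> A,
  [/\ forall a, a \in r1 ++ r2 -> part true (th a), y1 = oprod r1 th, y2 = oprod r2 th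
    & y1 * y2 = oprod (r1 ++ r2) th].
Proof.
move=> [t1 h1 ->] [t2 h2 ->]; pose th a := if a \in r1 then t1 a else t2 a.
have e1 : oprod r1 t1 = oprod r1 th by apply: eq_odd_prod => a ra; rewrite /th ra.
have e2 : oprod r2 t2 = oprod r2 th.
  apply: eq_odd_prod => a ra; rewrite /th; case: ifP => // ra1.
  by move: r_uniq; rewrite cat_uniq => /and3P[_ /hasPn/(_ a ra)]; rewrite /= ra1.
exists th; split=> //; last by rewrite e1 e2 /odd_prod big_cat.
move=> a; rewrite mem_cat /th; case: ifP => [ra1 _|_ /= ra2]; first exact: h1.
exact: h2.
Qed.

Lemma odd_sets_G y1 y2 : odd_set r1 y1 -> odd_set r2 y2 -> GA (y1 * y2).
Proof.
move=> /odd_set_cat h /h[th [hth _ _ ->]].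
have [ev F] := G0_facts_exist r_uniq r_odd.
exact: (oprod_G r_odd F).
Qed.

Lemma G_factor_left w : GA w -> exists x y1 y2,
  [/\ G0A x, odd_set r1 y1, odd_set r2 y2 & w = x * (y1 * y2)].
Proof.
move=> hw.
have [ev F] := G0_facts_exist r_uniq r_odd.
have [x [th [hx hth ->]]] := G_sorted r_uniq r_odd F hw.
exists x, (oprod r1 th), (oprod r2 th); split=> //; try by exists th.
by rewrite /odd_prod big_cat.
Qed.

Lemma G_factor_left_inj x y1 y2 x' y1' y2' : G0A x -> odd_set r1 y1 -> odd_set r2 y2 ->
  G0A x' -> odd_set r1 y1' -> odd_set r2 y2' -> x * (y1 * y2) = x' * (y1' * y2') ->
  [/\ x = x', y1 = y1' & y2 = y2'].
Proof.
move=> hx /odd_set_cat h1 /h1[th [hth -> -> ->]] hx' /odd_set_cat h2 /h2[th' [hth' -> -> ->]] E0.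
have [ev F] := G0_facts_exist r_uniq r_odd.
have eth := G_sorted_inj r_uniq r_odd F hx hx' hth hth' E0.
have e1 : oprod r1 th = oprod r1 th'.
  by apply: eq_odd_prod => a ra; apply: eth; rewrite mem_cat ra.
have e2 : oprod r2 th = oprod r2 th'.
  by apply: eq_odd_prod => a ra; apply: eth; rewrite mem_cat ra orbT.
split=> //; have V1 := odd_prodV tf2 N hth'.
rewrite (eq_odd_prod _ eth) in E0.
by rewrite -[x]mulr1 -[x']mulr1 -V1 !mulrA E0.
Qed.

End TwoLists.

Lemma odd_set_inv r y : odd_set r y -> exists y', [/\ odd_set (rev r) y', y * y' = 1 & y' * y = 1].
Proof.
move=> [th hth ->]; exists (oprod (rev r) (fun a => - th a)); split.
- by exists (fun a => - th a) => // a; rewrite mem_rev => /hth; apply: sa_partN.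
- exact: odd_prodV.
- exact: odd_prodVl.
Qed.

Section TwoListsRight.
Variables r1 r2 : seq L.
Hypothesis r_uniq : uniq (r1 ++ r2).
Hypothesis r_odd : r1 ++ r2 =i cd_root c true.

Let rev_uniq : uniq (rev r2 ++ rev r1). Proof. by rewrite -rev_cat rev_uniq. Qed.
Let rev_odd : rev r2 ++ rev r1 =i cd_root c true.
Proof. by move=> a; rewrite -rev_cat mem_rev. Qed.

(** The inverse of w is factored with G_0 on the left and with reversed, exchanged lists; inverting
    this factorization restores the order. *)
Lemma G_factor_right w : GA w -> exists x y1 y2,
  [/\ G0A x, odd_set r1 y1, odd_set r2 y2 & w = (y1 * y2) * x].
Proof.
move=> hw.
have [ev F] := G0_facts_exist r_uniq r_odd.
have [v [hv e1 e2]] := G_inv r_odd F hw.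
have [x [y2 [y1 [hx h2 h1 ev']]]] := G_factor_left rev_uniq rev_odd hv.
have [x' [hx' f1 f2]] := G0_facts_inv F hx.
have [y1' [h1' f3 f4]] := odd_set_inv h1; have [y2' [h2' f5 f6]] := odd_set_inv h2.
rewrite !revK in h1' h2'.
exists x', y1', y2'; split=> //.
apply: (inv_uniq (x := v)) => //.
rewrite ev'; rewrite -!mulrA (mulrA x') f2 mul1r.
by rewrite (mulrA y2') f6 mul1r.
Qed.

Lemma G_factor_right_inj x y1 y2 x' y1' y2' : G0A x -> odd_set r1 y1 -> odd_set r2 y2 ->
  G0A x' -> odd_set r1 y1' -> odd_set r2 y2' -> (y1 * y2) * x = (y1' * y2') * x' ->
  [/\ x = x', y1 = y1' & y2 = y2'].
Proof.
move=> hx h1 h2 hx' h1' h2' E0.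
have [ev F] := G0_facts_exist r_uniq r_odd.
have [v [hv e1 e2]] := G0_facts_inv F hx; have [v' [hv' e1' e2']] := G0_facts_inv F hx'.
have [u1 [k1 f1 f2]] := odd_set_inv h1; have [u2 [k2 f3 f4]] := odd_set_inv h2.
have [u1' [k1' f1' f2']] := odd_set_inv h1'; have [u2' [k2' f3' f4']] := odd_set_inv h2'.
have E1 : v * (u2 * u1) = v' * (u2' * u1').
  apply: (inv_uniq (x := (y1 * y2) * x)).
    by rewrite -!mulrA (mulrA x) e1 mul1r (mulrA y2) f3 mul1r f1.
  by rewrite E0 -!mulrA (mulrA u1') f2' mul1r (mulrA u2') f4' mul1r e2'.
have [ev1 eu2 eu1] := G_factor_left_inj rev_uniq rev_odd hv k2 k1 hv' k2' k1' E1.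
split.
- by apply: (inv_uniq (x := v)); rewrite // ev1.
- by apply: (inv_uniq (x := u1)); rewrite // eu1.
- by apply: (inv_uniq (x := u2)); rewrite // eu2.
Qed.

End TwoListsRight.

End Factorization.

Theorem theorem5p3p9
  (K : closedFieldType) (char_K : [pchar K] =i pred0)
  (g : lieSuperalg K) (g_classical : classical g) (g_type : allowed_type g)
  (c : chevData g) (c_ok : chev_ok c)
  (V : lieSupermod g) (V_faithful : faithful V) (V_rational : rational c V)
  (d : nat) (e : d.-tuple V) (p : 'I_d -> bool)
  (M_admissible : admissible c e p)
  (k : comPzRingType) (k_2 : (2%:R : k) != 0) (k_3 : (3%:R : k) != 0)
  (k_tf2 : torsionfree k 2) (k_tf3 : torsionfree k 3)
  (A : comSuperalg k) (A_tf2 : torsionfree A 2) (A_tf3 : torsionfree A 3)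
  (odd_pos odd_neg : seq (lat (cd_h c) (cd_kind c)))
  (odd_pos_uniq : uniq odd_pos) (odd_neg_uniq : uniq odd_neg)
  (odd_posP : forall a, (a \in odd_pos) = (a \in cd_root c true) && pos c a)
  (odd_negP : forall a, (a \in odd_neg) = (a \in cd_root c true) && neg c a) :
  let G0A := @G0 K g c V d e p k A in
  let GA := @G K g c V d e p k A in
  let G1p := @G1 K g c V d e k A odd_pos in
  let G1m := @G1 K g c V d e k A odd_neg in
  [/\ product_bijection G0A G1m G1p GA,
      product_bijection G0A G1p G1m GA,
      product_bijection G1m G1p G0A GA
    & product_bijection G1p G1m G0A GA].
Proof.
move=> G0A GA G1p G1m.
have not_P3 : ~ type_P g 3 by case: g_type.
have [N hN] := X_int_exists M_admissible.
have [_ _ _ [_ _ posneg _ _] _] := c_ok.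
have subp : {subset odd_pos <= cd_root c true} by move=> a; rewrite odd_posP => /andP[].
have subm : {subset odd_neg <= cd_root c true} by move=> a; rewrite odd_negP => /andP[].
(* A root both positive and negative has all its coordinates zero, so it is zero, which no root
   is. *)
have disj a : a \in odd_pos -> a \in odd_neg -> False.
  rewrite odd_posP odd_negP => /andP[ra /forallP pa] /andP[_ /forallP na].
  have := root_neq0 char_K c_ok (cd_rootW ra); case/eqP.
  rewrite (posneg a (cd_rootW ra)).1 big1 // => i _.
  by rewrite (_ : cd_coord c a i = 0) ?mulr0z //; apply/eqP; rewrite eq_le pa na.
have cover a : a \in cd_root c true -> (a \in odd_pos) || (a \in odd_neg).
  by move=> ra; rewrite odd_posP odd_negP ra (posneg a (cd_rootW ra)).2.
have lists r r' : uniq r -> uniq r' -> (forall a, a \in r -> a \in r' -> False) ->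
    {subset r <= cd_root c true} -> {subset r' <= cd_root c true} ->
    (forall a, a \in cd_root c true -> (a \in r) || (a \in r')) ->
    uniq (rev r ++ rev r') /\ rev r ++ rev r' =i cd_root c true.
  move=> ur ur' dj sr sr' cv; split.
    rewrite cat_uniq !rev_uniq ur ur' /= andbT; apply/hasPn => a; rewrite !mem_rev => ra'.
    by apply/negP => ra; apply: dj ra ra'.
  move=> a; rewrite mem_cat !mem_rev; apply/idP/idP; last exact: cv.
  by case/orP; [apply: sr | apply: sr'].
have [upm opm] := lists _ _ odd_pos_uniq odd_neg_uniq disj subp subm cover.
have [ump omp] := lists _ _ odd_neg_uniq odd_pos_uniq (fun a h1 h2 => disj a h2 h1) subm subp
  (fun a ra => etrans (orbC _ _) (cover a ra)).
have E1p y : G1p y <-> odd_set N (rev odd_pos) y by apply: (G1_odd_set char_K M_admissible hN).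
have E1m y : G1m y <-> odd_set N (rev odd_neg) y by apply: (G1_odd_set char_K M_admissible hN).
pose G1 r := odd_set N (A := A) (rev r).
(* In matrix products the order is reversed: G_0 as first factor of the group product stands
   rightmost, and Q and R are exchanged. *)
have right r r' (u : uniq (rev r ++ rev r')) (o : rev r ++ rev r' =i cd_root c true)
    (Q R : 'M[A]_d -> Prop) : (forall y, Q y <-> G1 r' y) -> (forall y, R y <-> G1 r y) ->
    product_bijection G0A Q R GA.
  move=> eQ eR; split=> [x y z hx /eQ hy /eR hz|w hw].
    rewrite /gmul mulmxA !mulmxE; apply: G_mul; last exact: G0_sub_G.
    exact: (odd_sets_G char_K c_ok not_P3 V_faithful V_rational M_admissible hN u o).
  have [x [z [y [hx hz hy ew]]]] := G_factor_right char_K c_ok not_P3 V_faithful V_rational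
    M_admissible hN A_tf2 u o hw.
  exists (x, y, z); split=> /=.
    by split=> //; [apply/eQ | apply/eR | rewrite /gmul mulmxA !mulmxE].
  move=> [[x' y'] z'] /= [hx' /eQ hy' /eR hz' ew'].
  have E0 : (z * y) * x = (z' * y') * x' by rewrite -ew ew' /gmul mulmxA !mulmxE.
  by have [-> -> ->] := G_factor_right_inj char_K c_ok not_P3 V_faithful V_rational
    M_admissible hN A_tf2 u o hx hz hy hx' hz' hy' E0.
have left r r' (u : uniq (rev r ++ rev r')) (o : rev r ++ rev r' =i cd_root c true)
    (Q R : 'M[A]_d -> Prop) : (forall y, Q y <-> G1 r' y) -> (forall y, R y <-> G1 r y) ->
    product_bijection Q R G0A GA.
  move=> eQ eR; split=> [y z x /eQ hy /eR hz hx|w hw].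
    rewrite /gmul !mulmxE; apply: G_mul; first exact: G0_sub_G.
    exact: (odd_sets_G char_K c_ok not_P3 V_faithful V_rational M_admissible hN u o).
  have [x [z [y [hx hz hy ew]]]] := G_factor_left char_K c_ok not_P3 V_faithful V_rational
    M_admissible hN A_tf2 u o hw.
  exists (y, z, x); split=> /=.
    by split=> //; [apply/eQ | apply/eR].
  move=> [[y' z'] x'] /= [/eQ hy' /eR hz' hx' ew'].
  have E0 : x * (z * y) = x' * (z' * y') by rewrite -ew ew' /gmul !mulmxE.
  by have [-> -> ->] := G_factor_left_inj char_K c_ok not_P3 V_faithful V_rational
    M_admissible hN A_tf2 u o hx hz hy hx' hz' hy' E0.
split.
- exact: (right _ _ upm opm).
- exact: (right _ _ ump omp).
- exact: (left _ _ upm opm).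
- exact: (left _ _ ump omp).
Qed.
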